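(* Let $(\Omega,\mathfrak S,\mathbb P)$ be a probability space with a group of $\mathbb P$-preserving measurable bijections $(\theta_x)_{x\in\mathbb Z^2}$, and $Y=(Y_x)_{x\in\mathbb Z^2}$ i.i.d. $\mathrm{Exp}(1)$ random variables on $\Omega$ with $Y_x(\omega)=Y_0(\theta_x\omega)$. Let $0<\alpha<1$. Let $u_n\le z_n\le v_n$ be three sequences in $\mathbb Z^2$ such that: $u_n$ and $v_n$ can be random (measurable functions of $\omega$) but $z_n$ is not (it does not depend on $\omega$); and, $\mathbb P$-almost surely, $|v_n-z_n|_1\to\infty$, $|z_n-u_n|_1\to\infty$, and $$\lim_{n\to\infty}\frac{v_n-z_n}{|v_n-z_n|_1}=\xi(\alpha)\quad\text{and}\quad\lim_{n\to\infty}\frac{z_n-u_n}{|z_n-u_n|_1}=\xi(\alpha).$$ Then $\displaystyle\lim_{n\to\infty}\mathbb P\{z_n\in\pi^{u_n,v_n}\}=0$.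
   Context: Inequalities in $\mathbb Z^2$ are coordinatewise; $|x|_1=|x_1|+|x_2|$. $\xi(\alpha)=\Bigl(\frac{(1-\alpha)^2}{(1-\alpha)^2+\alpha^2},\frac{\alpha^2}{(1-\alpha)^2+\alpha^2}\Bigr)$. For $x\le y$, $G_{x,y}=\max\sum_{k=0}^{|y-x|_1}Y_{x_k}$ over up-right lattice paths from $x_0=x$ to $y$ with increments in $\{(1,0),(0,1)\}$, and $\pi^{x,y}$ denotes the (almost surely unique) maximizing path (geodesic) for $G_{x,y}$. *)

(* Defs.v *)
From HB Require Import structures.
From mathcomp Require Import all_boot all_order all_algebra.
From mathcomp Require Import all_classical all_reals all_analysis.

Set Implicit Arguments.
Unset Strict Implicit.
Unset Printing Implicit Defensive.

Import Order.TTheory GRing.Theory Num.Theory.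
Import numFieldNormedType.Exports.

Local Open Scope classical_set_scope.
Local Open Scope ring_scope.

Notation Z2 := (int * int)%type.

Definition le_site (x y : Z2) : bool := (x.1 <= y.1) && (x.2 <= y.2).

Definition l1norm (x : Z2) : nat := (`|x.1| + `|x.2|)%N.

(* Equal to (0, 0) at x = 0, since 0^-1 = 0. *)
Definition direction (R : realType) (x : Z2) : R * R :=
  (x.1%:~R / (l1norm x)%:R, x.2%:~R / (l1norm x)%:R).

Definition xi (R : realType) (alpha : R) : R * R :=
  let s := (1 - alpha) ^+ 2 + alpha ^+ 2 in
  ((1 - alpha) ^+ 2 / s, alpha ^+ 2 / s).

(* Bijectivity of each theta x is a consequence of the group law. *)
Definition measure_preserving_group d (T : measurableType d) (R : realType)
    (P : probability T R) (theta : Z2 -> T -> T) : Prop :=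
  [/\ theta 0 = id,
      forall x y : Z2, theta (x + y) = theta x \o theta y,
      forall x, measurable_fun [set: T] (theta x) &
      forall x A, measurable A -> P (theta x @^-1` A) = P A].

Definition independent_RVs d (T : measurableType d) (R : realType)
    (P : probability T R) (I : eqType) (X : I -> {RV P >-> R}) : Prop :=
  forall (s : seq I) (B : I -> set R), uniq s ->
    (forall i, measurable (B i)) ->
    P (\bigcap_(i in [set` s]) X i @^-1` B i) =
    (\prod_(i <- s) P (X i @^-1` B i))%E.

Arguments independent_RVs {d T R} P {I} X.

Definition iid_Exp1 d (T : measurableType d) (R : realType)
    (P : probability T R) (I : eqType) (X : I -> {RV P >-> R}) : Prop :=
  independent_RVs P X /\
  forall i A, measurable A -> distribution P (X i) A = exponential_prob 1 A.

Arguments iid_Exp1 {d T R} P {I} X.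

(* Measurability of a Z2-valued map for the discrete sigma-algebra on Z2. *)
Definition measurable_site d (T : measurableType d) (u : T -> Z2) : Prop :=
  forall A : set Z2, measurable (u @^-1` A).

Definition up_right_step (a b : Z2) : bool :=
  (b == a + (1, 0)) || (b == a + (0, 1)).

(* A path is given by its starting site x and the list p of the later ones;
   the sites visited are x :: p, and necessarily size p = l1norm (y - x). *)
Definition up_right_path (x y : Z2) (p : seq Z2) : bool :=
  path up_right_step x p && (last x p == y).

Definition path_weight (R : realType) (Y : Z2 -> R) (x : Z2) (p : seq Z2) : R :=
  \sum_(a <- x :: p) Y a.

Definition is_geodesic (R : realType) (Y : Z2 -> R) (x y : Z2) (p : seq Z2) :
    Prop :=
  up_right_path x y p /\
  forall q, up_right_path x y q -> path_weight Y x q <= path_weight Y x p.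

(* The sites of the geodesic from x to y. When several paths are maximizing,
   which has probability 0 for i.i.d. Exp(1) weights, the sites of all of them
   are included, so that membership is a measurable event and no tie-breaking
   rule is needed. *)
Definition geodesic (R : realType) (Y : Z2 -> R) (x y : Z2) : set Z2 :=
  [set z | exists2 p, is_geodesic Y x y p & z \in x :: p].

(* Main.v *)
Require Import Defs.
From HB Require Import structures.
From mathcomp Require Import all_boot all_order all_algebra.
From mathcomp Require Import all_classical all_reals all_analysis.
From mathcomp Require Import measurable_realfun zify ring lra.

Import Order.TTheory GRing.Theory Num.Theory.
Import numFieldNormedType.Exports.

Local Open Scope classical_set_scope.
Local Open Scope ring_scope.

(* Translate [z n] to the origin and let [- e] be the site preceding it on the
   geodesic. Starting from the increments Exp(1 - a), Exp(a) on a remote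
   antidiagonal, the last-passage recursion defines a function [busemann a];
   by Burke's property its increments along rows and along columns are
   independent exponentials, hence concentrated. Consequently, for [b] close to
   but different from [alpha], the [busemann b]-geodesic issued from [diag k]
   stays on a prescribed side of the cone around [xi alpha]. It then meets the
   part of the geodesic beyond the origin, and exchanging initial segments
   yields a path from [diag k] to [v] that gains
   [busemann b (diag k) - busemann b (diag 0)], which is nearly the same for
   [b] as for [alpha]. After a half-turn the same holds below the edge, for
   [diag (- k)]. As the geodesic cannot be improved, the sum [profile] of the
   two Busemann functions nearly attains at [k = 0] its maximum over
   [|k| <= L]. Stationarity along the antidiagonal makes that event of
   probability at most [1 / L], up to the probability of a near tie, and near
   ties are rare because [profile j - profile k] contains the weight at
   [diag j] as an independent summand. *)

(** The obstacle is that the endpoints may depend on all the weights, so an estimate for fixed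
    endpoints is useless: each exceptional event must serve all remote endpoints in the cone at
    once. This is why exponential tails are used: they are summable over the endpoints at distance
    at least [M]. It is also why [M] and the cone width [delta] must not depend on the horizon [K],
    which is chosen last, as a bound that the distances to the endpoints rarely exceed. No
    infinite-volume limit is taken: by Burke's property the increments have the same law at every
    level below the terminal antidiagonal. The parameter [b] has to differ from [alpha]: a fixed
    difference creates a drift gap linear in the distance, which beats the fluctuations and the
    width of a narrow cone. The order of choices is: [L] from the target probability, then the loss
    [rho], then [b] so close to [alpha] that its increments near the origin barely differ, then
    [delta] and [M], and finally [n] and [K]. *)

Definition rt (x : Z2) : Z2 := (x.1 + 1, x.2).
Definition up (x : Z2) : Z2 := (x.1, x.2 + 1).
Definition diag (k : int) : Z2 := (k, - k).

Definition urpath (g : nat -> Z2) (n : nat) : Prop :=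
  forall i, (i < n)%N -> g i.+1 = rt (g i) \/ g i.+1 = up (g i).

Ltac site_lia := apply/pair_equal_spec; split; rewrite /=; lia.

(** * Busemann functions with a finite horizon *)

Section antiderivative.
Context {R : realType}.
Implicit Types f : int -> R.

Definition isum f (p : int) : R :=
  match p with
  | Posz n => \sum_(i < n) f i%:Z
  | Negz n => - \sum_(i < n.+1) f (Negz i)
  end.

Lemma isumS f p : isum f (p + 1) = isum f p + f p.
Proof.
case: p => [n|[|n]].
- have -> : n%:Z + 1 = n.+1%:Z by lia.
  by rewrite /= big_ord_recr.
- have -> : Negz 0 + 1 = 0%:Z by lia.
  by rewrite /= big_ord1 big_ord0 addNr.
- have -> : Negz n.+1 + 1 = Negz n by lia.
  by rewrite /= [in RHS]big_ord_recr /= opprD subrK.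
Qed.

End antiderivative.

(* [t] counts the antidiagonals between [x] and the terminal one, where the
   increments are rescaled weights: I ~ Exp(1 - a) and J ~ Exp(a). *)
Fixpoint incr {R : realType} (a : R) (w : Z2 -> R) (t : nat) (x : Z2) : R * R :=
  match t with
  | 0 => (w x / (1 - a), w (rt x) / a)
  | t'.+1 =>
      let i := (incr a w t' (up x)).1 in
      let j := (incr a w t' (rt x)).2 in
      (w x + Num.max (i - j) 0, w x + Num.max (j - i) 0)
  end.

(** On the terminal antidiagonal only differences matter. They are those that hold if two
    neighbouring sites step, with the increments of [incr], to their common site one level further;
    the sum is anchored at abscissa 0. *)
Fixpoint busemann {R : realType} (a : R) (w : Z2 -> R) (t : nat) (x : Z2) : R :=
  match t with
  | 0 => isum (fun p => (incr a w 0 (p + 1, x.1 + x.2 - p - 1)).2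
                      - (incr a w 0 (p, x.1 + x.2 - p)).1) x.1
  | t'.+1 => w x + Num.max (busemann a w t' (rt x)) (busemann a w t' (up x))
  end.

Section busemann_theory.
Context {R : realType}.
Implicit Types (a b : R) (w : Z2 -> R).

Lemma busemann_max a w t x : busemann a w t.+1 x =
  w x + Num.max (busemann a w t (rt x)) (busemann a w t (up x)).
Proof. by []. Qed.

Lemma incrS a w t x : incr a w t.+1 x =
  (w x + Num.max ((incr a w t (up x)).1 - (incr a w t (rt x)).2) 0,
   w x + Num.max ((incr a w t (rt x)).2 - (incr a w t (up x)).1) 0).
Proof. by []. Qed.

Lemma busemann_step_aux a w t x :
  busemann a w t (up x) - busemann a w t (rt x) =
    (incr a w t (up x)).1 - (incr a w t (rt x)).2 ->
  busemann a w t.+1 x - busemann a w t (rt x) = (incr a w t.+1 x).1 /\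
  busemann a w t.+1 x - busemann a w t (up x) = (incr a w t.+1 x).2.
Proof.
rewrite incrS busemann_max /= => E; split; rewrite -addrA; congr (_ + _).
  by rewrite -E addr_maxl subrr maxC.
rewrite (_ : _.2 - _ = busemann a w t (rt x) - busemann a w t (up x)).
  by rewrite addr_maxl subrr.
by rewrite -opprB -E opprB.
Qed.

(** The increments close up around a unit square: [up x] and [rt x] reach the same corner in one
    step, so their values differ by the two increments into it. On the terminal antidiagonal this is
    the choice of the data. *)
Lemma busemann_diag a w t x :
  busemann a w t (up x) - busemann a w t (rt x) =
  (incr a w t (up x)).1 - (incr a w t (rt x)).2.
Proof.
elim: t x => [|t IH] x.
  case: x => p q; rewrite /busemann /=.
  have -> : p + 1 + q = p + (q + 1) by lia.
  rewrite isumS.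
  have -> : p + (q + 1) - p - 1 = q by lia.
  have -> : p + (q + 1) - p = q + 1 by lia.
  rewrite /rt /up /=; lra.
have [_ h1] := busemann_step_aux _ _ _ _ (IH (rt x)).
have [h2 _] := busemann_step_aux _ _ _ _ (IH (up x)).
rewrite -h1 -h2.
have -> : up (rt x) = rt (up x) by [].
lra.
Qed.

Lemma busemann_rt a w t x :
  busemann a w t.+1 x - busemann a w t (rt x) = (incr a w t.+1 x).1.
Proof. by have [] := busemann_step_aux _ _ _ _ (busemann_diag a w t x). Qed.

Lemma busemann_up a w t x :
  busemann a w t.+1 x - busemann a w t (up x) = (incr a w t.+1 x).2.
Proof. by have [] := busemann_step_aux _ _ _ _ (busemann_diag a w t x). Qed.

Lemma busemann_diagS a w t k :
  busemann a w t (diag (k + 1)) - busemann a w t (diag k) =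
  (incr a w t (diag (k + 1))).2 - (incr a w t (diag k)).1.
Proof.
have := busemann_diag a w t (k, - (k + 1)).
rewrite /up /rt /= (_ : - (k + 1) + 1 = - k); last by lia.
rewrite -/(diag k) -/(diag (k + 1)); lra.
Qed.

(** All parameters share the weights. The order holds for the terminal data, and the recursion
    preserves it: each new increment grows with the old one of its kind and decreases with the
    other. *)
Lemma incr_mono a b w t x : 0 < a -> a <= b -> b < 1 -> (forall y, 0 <= w y) ->
  (incr a w t x).1 <= (incr b w t x).1 /\ (incr b w t x).2 <= (incr a w t x).2.
Proof.
move=> a0 ab b1 w0; elim: t x => [|t IH] x /=.
  split; apply: ler_wpM2l => //; rewrite lef_pV2 ?posrE; lra.
have [h1 _] := IH (up x); have [_ h2] := IH (rt x).
split; rewrite lerD2l ge_max !le_max lexx orbT andbT.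
  by apply/orP; left; lra.
by apply/orP; left; lra.
Qed.

Lemma rtD (x c : Z2) : rt x + c = rt (x + c).
Proof. by case: x c => [p q] [r s]; site_lia. Qed.

Lemma upD (x c : Z2) : up x + c = up (x + c).
Proof. by case: x c => [p q] [r s]; site_lia. Qed.

Lemma diagD j k : diag j + diag k = diag (j + k).
Proof. by site_lia. Qed.

Lemma incr_shift a w c t x :
  incr a (fun y => w (y + c)) t x = incr a w t (x + c).
Proof.
elim: t x => [|t IH] x; first by rewrite [LHS]/incr rtD.
by rewrite !incrS !IH rtD upD.
Qed.

Lemma eq_increments (f g : int -> R) :
  (forall k, f (k + 1) - f k = g (k + 1) - g k) ->
  forall j k, f j - f k = g j - g k.
Proof.
move=> fg; suff H k : f k - g k = f 0 - g 0 by move=> j k; have := H j; have := H k; lra.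
elim/int_rect: k => [//|n IH|n IH].
  by have := fg n%:Z; rewrite (_ : n%:Z + 1 = n.+1%:Z); [lra|lia].
by have := fg (- n.+1%:Z); rewrite (_ : - n.+1%:Z + 1 = - n%:Z); [lra|lia].
Qed.

(** Only differences are covariant, because the terminal sum stays anchored at abscissa 0 under
    translation; hence the detour through increments along the antidiagonal. *)
Lemma busemann_shift a w c t j k :
  busemann a (fun y => w (y + diag c)) t (diag j)
  - busemann a (fun y => w (y + diag c)) t (diag k) =
  busemann a w t (diag (j + c)) - busemann a w t (diag (k + c)).
Proof.
apply: (eq_increments (fun j => busemann a (fun y => w (y + diag c)) t (diag j))
  (fun j => busemann a w t (diag (j + c)))) => i.
by rewrite addrAC !busemann_diagS !incr_shift !diagD addrAC.
Qed.

(** The difference does not depend on the path chosen between the two sites; a row followed by a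
    column splits it into two sums, each of independent terms. *)
Lemma busemann_path_sum a w t x m n : (m + n <= t)%N ->
  busemann a w t x - busemann a w (t - (m + n)) (x.1 + m%:Z, x.2 + n%:Z) =
  \sum_(i < m) (incr a w (t - i) (x.1 + i%:Z, x.2)).1 +
  \sum_(j < n) (incr a w (t - m - j) (x.1 + m%:Z, x.2 + j%:Z)).2.
Proof.
elim: n => [|n IH] mnt.
  rewrite !big_ord0 !addr0 addn0 in mnt *.
  elim: m mnt => [|m IH] mt.
    rewrite big_ord0 subn0 (_ : (x.1 + 0%:Z, x.2) = x) ?subrr//.
    by case: x => p q; site_lia.
  rewrite big_ord_recr /= -IH; last by lia.
  have -> : (t - m = (t - m.+1).+1)%N by lia.
  rewrite -busemann_rt (_ : rt _ = (x.1 + m.+1%:Z, x.2)); first by lra.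
  by site_lia.
rewrite big_ord_recr /= addrA -IH; last by lia.
have -> : (t - m - n = (t - (m + n.+1)).+1)%N by lia.
have -> : (t - (m + n) = (t - (m + n.+1)).+1)%N by lia.
rewrite -busemann_up (_ : up _ = (x.1 + m%:Z, x.2 + n.+1%:Z)); first by lra.
by site_lia.
Qed.

Lemma busemann_close a b w t (L : nat) (kap : R) :
  (forall i, `|i| <= L%:Z ->
     `|(incr b w t (diag i)).1 - (incr a w t (diag i)).1| <= kap /\
     `|(incr b w t (diag i)).2 - (incr a w t (diag i)).2| <= kap) ->
  forall k, `|k| <= L%:Z ->
  `|(busemann b w t (diag k) - busemann b w t (diag 0)) -
    (busemann a w t (diag k) - busemann a w t (diag 0))| <= L%:R * (2 * kap).
Proof.
move=> H.
have kap0 : 0 <= kap by have [h _] := H 0 isT; apply: le_trans h.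
pose f k := (busemann b w t (diag k) - busemann b w t (diag 0)) -
    (busemann a w t (diag k) - busemann a w t (diag 0)).
have f0 : f 0 = 0 by rewrite /f; lra.
have fS i : `|i| <= L%:Z -> `|i + 1| <= L%:Z -> `|f (i + 1) - f i| <= 2 * kap.
  move=> hi hi1; have [_ h2] := H _ hi1; have [h1 _] := H _ hi.
  rewrite (_ : f (i + 1) - f i =
    (busemann b w t (diag (i + 1)) - busemann b w t (diag i)) -
    (busemann a w t (diag (i + 1)) - busemann a w t (diag i))); last by rewrite /f; lra.
  rewrite !busemann_diagS; move: h1 h2; rewrite !ler_norml => /andP[? ?] /andP[? ?].
  by apply/andP; split; lra.
have Hpos (n : nat) : (n <= L)%N ->
    `|f n%:Z| <= n%:R * (2 * kap) /\ `|f (- n%:Z)| <= n%:R * (2 * kap).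
  elim: n => [_|n IH nL]; first by rewrite oppr0 f0 normr0 mul0r.
  have [IH1 IH2] := IH (ltnW nL).
  have a1 := fS n%:Z ltac:(lia) ltac:(lia).
  have a2 := fS (- n.+1%:Z) ltac:(lia) ltac:(lia).
  rewrite (_ : n%:Z + 1 = n.+1%:Z) in a1; last by lia.
  rewrite (_ : - n.+1%:Z + 1 = - n%:Z) in a2; last by lia.
  rewrite -[n.+1]addn1 natrD mulrDl mul1r addn1.
  move: IH1 IH2 a1 a2; rewrite !ler_norml.
  move=> /andP[? ?] /andP[? ?] /andP[? ?] /andP[? ?].
  by split; apply/andP; split; lra.
move=> k kL; rewrite -/(f k).
have nL : (`|k|%N <= L)%N by lia.
have [h1 h2] := Hpos _ nL.
apply: (@le_trans _ _ (`|k|%N%:R * (2 * kap))).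
  case: (leP 0 k) => k0; [move: h1|move: h2].
    by rewrite (_ : `|k|%N%:Z = k) //; lia.
  by rewrite (_ : - `|k|%N%:Z = k) //; lia.
by apply: ler_wpM2r; [lra|rewrite ler_nat].
Qed.

Lemma busemann_path_le a w (g : nat -> Z2) t m : urpath g m -> (m <= t)%N ->
  \sum_(i < m) w (g i) + busemann a w (t - m) (g m) <= busemann a w t (g 0%N).
Proof.
elim: m => [|m IH] gm mt; first by rewrite big_ord0 add0r subn0.
have gm' : urpath g m by move=> i im; apply: gm; lia.
apply: le_trans (IH gm' (ltnW mt)); rewrite big_ord_recr /= -addrA lerD2l.
have -> : (t - m = (t - m.+1).+1)%N by lia.
rewrite busemann_max lerD2l le_max.
by case: (gm m (ltnSn m)) => ->; rewrite lexx ?orbT.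
Qed.

Lemma busemann_geodesic a w t x : exists g : nat -> Z2, [/\ g 0%N = x, urpath g t &
  forall m, (m <= t)%N ->
    \sum_(i < m) w (g i) + busemann a w (t - m) (g m) = busemann a w t x].
Proof.
elim: t x => [|t IH] x.
  exists (fun=> x); split => // m; rewrite leqn0 => /eqP ->.
  by rewrite big_ord0 add0r.
pose y := if busemann a w t (up x) <= busemann a w t (rt x) then rt x else up x.
have [g [g0 gs gB]] := IH y.
exists (fun n => if n is n'.+1 then g n' else x); split => //.
  move=> [_|i it]; last exact: gs.
  by rewrite g0 /y; case: ifP => _; [left|right].
move=> [_|m mt]; first by rewrite big_ord0 add0r.
rewrite big_ord_recl /= -addrA subSS gB // /y; congr (_ + _).
by case: leP.
Qed.

End busemann_theory.

(** * Crossing paths and the exchange of their initial segments *)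

Definition lev (x : Z2) : int := x.1 + x.2.

Lemma urpath_lev g n m : urpath g n -> (m <= n)%N -> lev (g m) = lev (g 0%N) + m%:Z.
Proof.
move=> gn; elim: m => [|m IH] mn; first by lia.
have := IH (ltnW mn); rewrite /lev.
by case: (gn m mn) => -> /=; lia.
Qed.

Lemma urpath_fst g n m : urpath g n -> (m <= n)%N ->
  exists i j : nat, (i + j = m)%N /\ g m = ((g 0%N).1 + i%:Z, (g 0%N).2 + j%:Z).
Proof.
move=> gn; elim: m => [|m IH] mn.
  by exists 0%N, 0%N; split => //; case: (g 0%N) => p q; site_lia.
have [i [j [ij gE]]] := IH (ltnW mn).
case: (gn m mn) => ->; rewrite gE /=; [exists i.+1, j|exists i, j.+1];
  by split; [lia|site_lia].
Qed.

(* Discrete intermediate value theorem for the difference of abscissas. *)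
Lemma urpath_meet (a g : nat -> Z2) N : urpath a N -> urpath g N ->
  lev (a 0%N) = lev (g 0%N) -> (a 0%N).1 <= (g 0%N).1 -> (g N).1 <= (a N).1 ->
  exists2 m, (m <= N)%N & a m = g m.
Proof.
move=> ha hg l0 le0 leN.
have ex : exists m, (m <= N)%N && ((g m).1 <= (a m).1) by exists N; rewrite leqnn.
case: (ex_minnP ex) => m /andP[mN gam] minm; exists m => //.
have la := urpath_lev _ _ _ ha mN; rewrite l0 -(urpath_lev _ _ _ hg mN) in la.
suff E1 : (a m).1 = (g m).1.
  by move: la E1; rewrite /lev; case: (a m) => ? ?; case: (g m) => ? ? /= *; site_lia.
case: m mN gam minm {la} => [|m] mN gam minm; first by lia.
have : (a m).1 < (g m).1.
  by rewrite ltNge; apply/negP => h; have := minm m; rewrite h (ltnW mN) ltnn => /(_ isT).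
by move: gam; case: (ha m mN) => ->; case: (hg m mN) => -> /=; lia.
Qed.

Section surgery.
Context {R : realType}.
Implicit Types (a b : R) (w : Z2 -> R).

(* A [busemann b]-geodesic from [diag k] collects exactly the decrement of
   [busemann b] and at most that of [busemann a]; so this forbids it from
   crossing level [N] at a point beyond the abscissa [c]. *)
Definition reroutes a b w t (k c : int) N :=
  forall m n, (m + n)%N = N ->
  (if 0 <= k then c < k + m%:Z else k + m%:Z < c) ->
  busemann a w t (diag k) - busemann a w (t - N) ((diag k).1 + m%:Z, (diag k).2 + n%:Z) <
  busemann b w t (diag k) - busemann b w (t - N) ((diag k).1 + m%:Z, (diag k).2 + n%:Z).

(* The Busemann geodesic from [diag k] meets [p]; swap initial segments there. *)
Lemma reroute a b w t k (v : Z2) N (p : nat -> Z2) :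
  urpath p N -> (N <= t)%N -> p 0%N = (0, 0) -> p N = v -> reroutes a b w t k v.1 N ->
  exists q, [/\ urpath q N, q 0%N = diag k, q N = v &
    \sum_(i < N.+1) w (p i) + (busemann b w t (diag k) - busemann b w t (diag 0))
    <= \sum_(i < N.+1) w (q i)].
Proof.
move=> pN Nt p0 pNv rer.
have [g [g0 gt gB]] := busemann_geodesic b w t (diag k).
have gN : urpath g N by move=> i iN; apply: gt; lia.
have side : if 0 <= k then (g N).1 <= v.1 else v.1 <= (g N).1.
  have [m [n [mn gE]]] := urpath_fst _ _ _ gN (leqnn N).
  have le1 := busemann_path_le a w _ _ _ gN Nt.
  have eq1 := gB _ Nt.
  rewrite gE g0 /= in le1 eq1 *.
  have /= := rer m n mn; case: (leP 0 k) => k0 H; rewrite leNgt; apply/negP => h;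
    by have := H h; move: le1 eq1; clear; lra.
have [m mN pg] : exists2 m, (m <= N)%N & p m = g m.
  move: side; case: (leP 0 k) => k0 side.
    by apply: (urpath_meet p g N) => //; rewrite ?p0 ?g0 ?pNv //= /lev /=; lia.
  have [|||m mN gm] := urpath_meet g p N gN pN; rewrite ?p0 ?g0 ?pNv //=.
  - by rewrite /lev /=; lia.
  - by lia.
  by exists m.
exists (fun i => if (i < m)%N then g i else p i); split.
- move=> i iN; case: (ltnP i.+1 m) => h1.
    by rewrite (ltnW h1); apply: gN.
  case: (ltnP i m) => h2; last exact: pN.
  have -> : p i.+1 = g i.+1 by rewrite (_ : i.+1 = m) //; lia.
  exact: gN.
- by case: posnP => [m0|//]; rewrite -g0 -[in RHS]m0 -pg m0.
- by rewrite ltnNge mN.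
have split (f : nat -> R) : \sum_(i < N.+1) f i = \sum_(i < m) f i + \sum_(m <= i < N.+1) f i.
  by rewrite -(big_mkord xpredT f) (@big_cat_nat _ _ _ m) //= ?big_mkord // leqW.
rewrite (split (fun i => w (p i))) (split (fun i => w (if (i < m)%N then g i else p i))).
have -> : \sum_(m <= i < N.+1) w (if (i < m)%N then g i else p i) =
          \sum_(m <= i < N.+1) w (p i).
  by apply: eq_big_nat => i /andP[mi _]; rewrite ltnNge mi.
have -> : \sum_(i < m) w (if (i < m)%N then g i else p i) = \sum_(i < m) w (g i).
  by apply: eq_bigr => i _; rewrite ltn_ord.
have mt : (m <= t)%N by lia.
have pm : urpath p m by move=> i im; apply: pN; lia.
(* Up to the meeting site, [p] collects at most its decrement of [busemann b] and [g] exactly its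
   own; the values at the meeting site cancel. *)
have := busemann_path_le b w _ _ _ pm mt; have := gB _ mt.
rewrite -pg p0 /diag oppr0; clear; lra.
Qed.

End surgery.

(** * Uniqueness of measures, joint laws and densities *)

Definition image_measure d1 d2 (T1 : measurableType d1) (T2 : measurableType d2)
    (R : realType) (m : {measure set T1 -> \bar R}) (f : T1 -> T2)
    (mf : measurable_fun setT f) : {measure set T2 -> \bar R} :=
  measure_function_pushforward__canonical__measure_function_Measure m mf.

Lemma image_measureE d1 d2 (T1 : measurableType d1) (T2 : measurableType d2)
    (R : realType) (m : {measure set T1 -> \bar R}) (f : T1 -> T2)
    (mf : measurable_fun setT f) A :
  image_measure _ _ _ _ _ m f mf A = m (f @^-1` A).
Proof. by []. Qed.

Section measurable_comparison.
Context d (T : measurableType d) (R : realType).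
Implicit Types f g : T -> R.

Lemma measurable_lt_set f g : measurable_fun setT f -> measurable_fun setT g ->
  measurable [set w | f w < g w].
Proof.
move=> mf mg; have mfg : measurable_fun setT (fun w => g w - f w).
  exact: measurable_funB.
rewrite (_ : [set w | _] = setT `&` (fun w => g w - f w) @^-1` `]0, +oo[%classic).
  exact: mfg measurableT _ (measurable_itv _).
by rewrite setTI; apply/seteqP; split => w /=; rewrite in_itv /= andbT subr_gt0.
Qed.

Lemma measurable_le_set f g : measurable_fun setT f -> measurable_fun setT g ->
  measurable [set w | f w <= g w].
Proof.
move=> mf mg; rewrite (_ : [set w | _] = ~` [set w | g w < f w]).
  exact/measurableC/measurable_lt_set.
by apply/seteqP; split => w /=; rewrite leNgt => /negP.
Qed.

End measurable_comparison.

Section measure_uniqueness.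
Context {R : realType}.
Local Open Scope ereal_scope.

Lemma eq_measure_setX d1 d2 (T1 : measurableType d1) (T2 : measurableType d2)
    (m1 m2 : {measure set (T1 * T2) -> \bar R}) :
  m1 setT < +oo ->
  (forall A B, measurable A -> measurable B -> m1 (A `*` B) = m2 (A `*` B)) ->
  forall S, measurable S -> m1 S = m2 S.
Proof.
move=> fin H S mS.
pose G : set (set (T1 * T2)) := [set A `*` B | A in measurable & B in measurable].
apply: (measure_unique G (fun=> setT)) => //.
- exact: measurable_prod_measurableType.
- move=> _ _ [X1 mX1 [X2 mX2 <-]] [Y1 mY1 [Y2 mY2 <-]].
  rewrite -setXI; exists (X1 `&` Y1); first exact: measurableI.
  by exists (X2 `&` Y2) => //; exact: measurableI.
- by move=> _; exists setT => //; exists setT => //; rewrite setXTT.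
- by rewrite bigcup_const //; exists 0%N.
- by move=> _ [A mA [B mB <-]]; exact: H.
Qed.

Lemma eq_measure_tails (m1 m2 : {measure set (measurableTypeR R) -> \bar R}) :
  m1 setT < +oo -> (forall x, m1 `]x, +oo[%classic = m2 `]x, +oo[%classic) ->
  forall S, measurable S -> m1 S = m2 S.
Proof.
move=> fin H S mS.
apply: (@measure_unique _ R (measurableTypeR R) (@RGenOInfty.G R)
  (fun n => `](- n%:R)%R, +oo[%classic)) => //.
- exact: RGenOInfty.measurableE.
- move=> _ _ [x ->] [y ->]; exists (Order.max x y).
  apply/seteqP; split => z /=; rewrite !in_itv /= !andbT gt_max.
    by move=> [-> ->].
  by move=> /andP[].
- by move=> i; eexists.
- apply/seteqP; split => // x _; exists (Num.truncn `|x|).+1 => //=.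
  rewrite in_itv /= andbT ltrNl (le_lt_trans _ (truncnS_gt _)) //.
  by rewrite -normrN ler_norm.
- by move=> _ [x ->].
- move=> k; apply: le_lt_trans fin; apply: le_measure => //.
    by rewrite inE; exact: measurable_itv.
  by rewrite inE.
Qed.

(** One coordinate at a time: restricting to a strip and projecting gives a measure on the line, to
    which the one-dimensional uniqueness applies. *)
Lemma eq_measure_tails2
    (m1 m2 : {measure set (measurableTypeR R * measurableTypeR R) -> \bar R}) :
  m1 setT < +oo ->
  (forall x y, m1 (`]x, +oo[%classic `*` `]y, +oo[%classic) =
               m2 (`]x, +oo[%classic `*` `]y, +oo[%classic)) ->
  forall S, measurable S -> m1 S = m2 S.
Proof.
move=> fin H; apply: eq_measure_setX => //.
have fin' D : measurable D -> m1 D < +oo.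
  by move=> mD; apply: le_lt_trans fin; apply: le_measure; rewrite ?inE.
have H1 A y : measurable A ->
    m1 (A `*` `]y, +oo[%classic) = m2 (A `*` `]y, +oo[%classic).
  move=> mA; have mD : measurable ([set: R] `*` `]y, +oo[%classic).
    exact: measurableX.
  have E (m : {measure set (measurableTypeR R * measurableTypeR R) -> \bar R}) B :
      image_measure _ _ _ _ _ (mrestr m mD) fst measurable_fst B =
      m (B `*` `]y, +oo[%classic).
    rewrite image_measureE /= /mrestr; congr (m _).
    by apply/seteqP; split => -[u v] /=; tauto.
  rewrite -!E; apply: eq_measure_tails => //.
    by rewrite E; apply: fin'; exact: measurableX.
  by move=> x; rewrite !E.
move=> A B mA mB; have mD : measurable (A `*` [set: R]) by exact: measurableX.
have E (m : {measure set (measurableTypeR R * measurableTypeR R) -> \bar R}) C :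
      image_measure _ _ _ _ _ (mrestr m mD) snd measurable_snd C = m (A `*` C).
  rewrite image_measureE /= /mrestr; congr (m _).
  by apply/seteqP; split => -[u v] /=; tauto.
rewrite -!E; apply: eq_measure_tails => //.
  by rewrite E; apply: fin'; exact: measurableX.
by move=> x; rewrite !E H1.
Qed.

End measure_uniqueness.

Section joint_law.
Context d (T : measurableType d) (R : realType) (P : probability T R).
Local Open Scope ereal_scope.

(** The event [E] stands for the rest of an independent family, so that a pair can be replaced by a
    function of it without losing independence from the others; [setT] gives the plain joint law. *)
Lemma joint_law d1 d2 (T1 : measurableType d1) (T2 : measurableType d2)
    (X : T -> T1) (Y : T -> T2) (mu : probability T1 R) (nu : probability T2 R)
    (E : set T) :
  measurable_fun setT X -> measurable_fun setT Y -> measurable E ->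
  (forall A B, measurable A -> measurable B ->
     P (X @^-1` A `&` Y @^-1` B `&` E) = mu A * nu B * P E) ->
  forall S, measurable S ->
    P ((fun w => (X w, Y w)) @^-1` S `&` E) = (mu \x nu) S * P E.
Proof.
move=> mX mY mE H S mS.
have mXY : measurable_fun setT (fun w => (X w, Y w)) by exact: measurable_fun_pair.
have PE : P E = (fine (P E))%:E by rewrite fineK // fin_num_measure.
have c0 : (0 <= fine (P E))%R by rewrite fine_ge0.
pose c := NngNum c0.
transitivity (image_measure _ _ _ _ _ (mrestr P mE) _ mXY S) => //.
rewrite [in RHS]PE muleC.
transitivity (mscale c (mu \x nu) S) => //.
apply: eq_measure_setX => //.
  by rewrite image_measureE /= /mrestr preimage_setT setTI PE ltry.
move=> A B mA mB.
transitivity (P (X @^-1` A `&` Y @^-1` B `&` E)) => //.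
rewrite H // [RHS](_ : _ = (fine (P E))%:E * (mu \x nu) (A `*` B)) //.
by rewrite product_measure1E // -PE muleC.
Qed.

End joint_law.

Section integral_density.
Context d (T : measurableType d) (R : realType).
Variables (mu nu : {measure set T -> \bar R}) (g : T -> R).
Hypothesis g0 : forall x, 0 <= g x.
Hypothesis mg : measurable_fun setT g.
Hypothesis nuE :
  forall A, measurable A -> nu A = (\int[mu]_(x in A) (g x)%:E)%E.
Local Open Scope ereal_scope.

Import HBNNSimple.

Let integral_density_nnsfun (f : {nnsfun T >-> R}) :
  \int[nu]_x (f x)%:E = \int[mu]_x ((f x)%:E * (g x)%:E).
Proof.
rewrite integralT_nnsfun sintegralE.
under [RHS]eq_integral.
  move=> x _; rewrite muleC fimfunE -fsumEFin// ge0_mule_fsumr; last first.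
    by move=> r; exact: nnfun_muleindic_ge0.
  over.
rewrite [RHS]ge0_integral_fsum//; last 2 first.
  - move=> r; apply: emeasurable_funM; first exact/measurable_EFinP.
    by apply/measurable_EFinP; do 2 apply/measurableT_comp => //.
  - by move=> n x _; apply: mule_ge0; rewrite ?lee_fin //; exact: nnfun_muleindic_ge0.
apply: eq_fsbigr => r /set_mem [x _ <-].
have r0 : (0 <= f x)%R by [].
rewrite nuE // [in LHS]integral_mkcond -ge0_integralZl //.
- apply: eq_integral => y _.
  rewrite patchE EFinM muleCA; congr (_ * _).
  by rewrite indicE; case: ifPn => _; rewrite ?mule1 ?mule0.
- by apply/(measurable_restrictT _ _).1 => //; apply/measurable_funTS/measurable_EFinP.
- by move=> y _; apply: erestrict_ge0 => ? _; rewrite lee_fin.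
Qed.

Lemma ge0_integral_density (f : T -> \bar R) :
  measurable_fun setT f -> (forall x, 0 <= f x) ->
  \int[nu]_x f x = \int[mu]_x (f x * (g x)%:E).
Proof.
move=> mf f0.
pose f_ := nnsfun_approx measurableT mf.
have cvf x : (f_ n x)%:E @[n --> \oo] --> f x by exact: cvg_nnsfun_approx.
have ndf x m n : (m <= n)%N -> (f_ m x <= f_ n x)%R.
  by move=> mn; exact/lefP/nd_nnsfun_approx.
transitivity (limn (fun n => \int[nu]_x (f_ n x)%:E)).
  rewrite -monotone_convergence//=.
  - by apply: eq_integral => x _; apply/esym/cvg_lim.
  - by move=> n; exact/measurable_EFinP/measurable_funTS.
  - by move=> n ? _; rewrite lee_fin.
  - by move=> x _ m n mn; rewrite lee_fin ndf.
transitivity (limn (fun n => \int[mu]_x ((f_ n x)%:E * (g x)%:E))).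
  by apply: congr_lim; apply/funext => n; exact: integral_density_nnsfun.
rewrite -monotone_convergence//=.
- apply: eq_integral => x _; apply/cvg_lim => //.
  by apply: cvgeZr.
- by move=> n; apply: emeasurable_funM; exact/measurable_EFinP/measurable_funTS.
- by move=> n x _; rewrite mule_ge0 ?lee_fin.
- by move=> x _ m n mn; rewrite lee_wpmul2r ?lee_fin ?ndf.
Qed.

End integral_density.

(** * The exponential law: tails, exponential moments, small intervals *)

Section exponential_law.
Context {R : realType}.
Local Open Scope ereal_scope.

Definition expo (l : R) (l0 : (0 < l)%R) : probability (measurableTypeR R) R :=
  exponential_distribution_exponential_prob__canonical__probability_measure_Probability l0.

Lemma expoE l l0 A : expo l l0 A = exponential_prob l A.
Proof. by []. Qed.

Lemma expo_lt0 l l0 : expo l l0 `]-oo, 0%R[%classic = 0.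
Proof.
rewrite expoE /exponential_prob; apply: integral0_eq => x /=.
by rewrite in_itv /= => x0; rewrite lt0_exponential_pdf.
Qed.

Lemma expo_itv0c l l0 y : (0 <= y)%R ->
  expo l l0 `[0%R, y]%classic = 1 - (expR (- l * y))%:E.
Proof.
rewrite le_eqVlt => /orP[/eqP <-|y0]; last exact: exponential_prob_itv0c.
by rewrite mulr0 expR0 subee // set_itv1 expoE /exponential_prob integral_set1.
Qed.

Lemma expo_tail l l0 x : expo l l0 `]x, +oo[%classic = (expR (- l * Num.max x 0))%:E.
Proof.
rewrite -setCitvl probability_setC; last exact: measurable_itv.
have [x0|x0] := ltP x 0%R.
  rewrite mulr0 expR0 (_ : expo l l0 _ = 0) ?sube0 //.
  apply: subset_measure0 (expo_lt0 l l0); try exact: measurable_itv.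
  by move=> z /=; rewrite !in_itv /= => /le_lt_trans; apply.
rewrite (_ : `]-oo, x]%classic = `]-oo, 0%R[%classic `|` `[0%R, x]%classic).
  transitivity (1 - (expo l l0 `]-oo, 0%R[%classic + expo l l0 `[0%R, x]%classic)).
    congr (1 - _); apply: measureU; try exact: measurable_itv.
    apply/seteqP; split => z //=; rewrite !in_itv /= => -[z0 /andP[z1 _]].
    by move: z0; rewrite ltNge z1.
  by rewrite expo_lt0 add0e expo_itv0c // oppeB // addeA subee // add0e.
apply/seteqP; split => z /=; rewrite !in_itv /=.
  by move=> zx; case: (ltP z 0%R) => z0; [left|right; rewrite zx].
by case=> [/ltW z0|/andP[]//]; exact: le_trans x0.
Qed.

Lemma integral_expo l l0 (f : R -> \bar R) :
  measurable_fun setT f -> (forall x, 0 <= f x) ->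
  \int[expo l l0]_x f x = \int[lebesgue_measure]_x (f x * (exponential_pdf l x)%:E).
Proof.
move=> mf f0; apply: ge0_integral_density => //.
- by move=> x; apply: exponential_pdf_ge0; exact: ltW.
- exact: measurable_exponential_pdf.
Qed.

(** Tilting the density of rate [l] by [expR (s * x)] gives [l / (l - s)] times the density of rate
    [l - s]. *)
Lemma expo_mgf l l0 s (s_lt : (s < l)%R) :
  \int[expo l l0]_x (expR (s * x))%:E = (l / (l - s))%:E.
Proof.
have ls0 : (0 < l - s)%R by rewrite subr_gt0.
rewrite integral_expo; last 2 first.
- by apply/measurable_EFinP; apply: measurableT_comp => //; apply: measurable_funM.
- by move=> x; rewrite lee_fin expR_ge0.
transitivity ((l / (l - s))%:E * \int[lebesgue_measure]_x (exponential_pdf (l - s) x)%:E);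
  last by rewrite integral_exponential_pdf ?mule1.
have mp : measurable_fun setT (fun x : R => (exponential_pdf (l - s) x)%:E).
  by apply/measurable_EFinP; exact: measurable_exponential_pdf.
have p0 (x : measurableTypeR R) : setT x -> 0 <= (exponential_pdf (l - s) x)%:E.
  by move=> _; rewrite lee_fin exponential_pdf_ge0 // ltW.
have c0 : 0 <= (l / (l - s))%:E by rewrite lee_fin divr_ge0 // ltW.
rewrite -[RHS](ge0_integralZl lebesgue_measure measurableT mp p0 c0).
apply: eq_integral => x _; rewrite -!EFinM; congr EFin.
have [x0|x0] := leP 0%R x; last by rewrite !lt0_exponential_pdf ?mulr0.
rewrite !exponential_pdfE // mulrCA -expRD mulrA divfK ?gt_eqF //.
by congr (_ * expR _)%R; ring.
Qed.

Lemma expo_itv_le l l0 x y : (l <= 1)%R -> (x <= y)%R ->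
  expo l l0 `[x, y]%classic <= (y - x)%:E.
Proof.
move=> l1 xy; rewrite expoE /exponential_prob.
have -> : (y - x)%:E = \int[lebesgue_measure]_(z in `[x, y]%classic) 1.
  rewrite integral_cst //= mul1e lebesgue_measure_itv /= lte_fin.
  by move: xy; rewrite le_eqVlt => /orP[/eqP ->|->]; rewrite ?ltxx ?subrr.
apply: ge0_le_integral => //=.
- by move=> z _; rewrite lee_fin exponential_pdf_ge0 // ltW.
- by apply/measurable_EFinP/measurable_funTS; exact: measurable_exponential_pdf.
move=> z _; rewrite lee_fin; have [z0|z0] := leP 0%R z; last first.
  by rewrite lt0_exponential_pdf.
rewrite exponential_pdfE // mulr_ile1 ?expR_ge0 ?(ltW l0) //.
by rewrite -expR0 ler_expR mulNr oppr_le0 mulr_ge0 // ltW.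
Qed.

End exponential_law.

(** * Burke's property at a single site *)

Section burke.
Context {R : realType}.
Local Open Scope ereal_scope.

Lemma eq_integral_expo (l : R) l0 (f g : R -> \bar R) :
  measurable_fun setT f -> measurable_fun setT g ->
  (forall x, 0 <= f x) -> (forall x, 0 <= g x) ->
  (forall x, (0 <= x)%R -> f x = g x) ->
  \int[expo l l0]_x f x = \int[expo l l0]_x g x.
Proof.
move=> mf mg f0 g0 fg; rewrite !integral_expo //; apply: eq_integral => x _.
have [x0|x0] := leP 0%R x; first by rewrite fg.
by rewrite lt0_exponential_pdf // !mule0.
Qed.

Lemma measurable_expR_mul (k : R) :
  measurable_fun setT (fun x : R => (expR (k * x))%:E).
Proof.
by apply/measurable_EFinP; apply: measurableT_comp => //; exact: measurable_funM.
Qed.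

(** Lack of memory: the clock of rate [m] rings after that of rate [l] with probability
    [l / (l + m)], here [l], and then the excess is again exponential of rate [m]. *)
Lemma expo_race (l m : R) l0 m0 (r : R) : (l + m = 1)%R -> (0 <= r)%R ->
  \int[expo l l0]_x expo m m0 `](x + r)%R, +oo[%classic = (l * expR (- m * r))%:E.
Proof.
move=> lm r0.
pose g (x : R) : \bar R := (expR (- m * r))%:E * (expR (- m * x))%:E.
transitivity (\int[expo l l0]_x g x).
  apply: eq_integral_expo.
  - have -> : (fun x : R => expo m m0 `](x + r)%R, +oo[%classic) =
        fun x => (expR (- m * Num.max (x + r) 0))%:E.
      by apply/funext => x; rewrite expo_tail.
    apply/measurable_EFinP; apply: measurableT_comp => //.
    apply: measurable_funM => //; apply: measurable_maxr => //.
    exact: measurable_funD.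
  - by apply: emeasurable_funM => //; exact: measurable_expR_mul.
  - by move=> x; exact: measure_ge0.
  - by move=> x; rewrite /g mule_ge0 ?lee_fin ?expR_ge0.
  - move=> x x0; rewrite expo_tail max_l ?addr_ge0 // /g -EFinM -expRD.
    by congr (expR _)%:E; ring.
rewrite /g ge0_integralZl ?lee_fin ?expR_ge0 //; last exact: measurable_expR_mul.
rewrite expo_mgf; last by rewrite (lt_trans _ l0) // oppr_lt0.
by rewrite -EFinM opprK lm divr1 mulrC.
Qed.

(** The integrand is the probability, given the weight [v], that the image under [burke_map] exceeds
    [(x, y)]. On []y, x]] one has [expR (- v) * expR (l * v) = expR (- m * v)] because [l + m = 1],
    so this part becomes a probability under [expo m]. *)
Lemma burke_integral (l m : R) (l0 : (0 < l)%R) (m0 : (0 < m)%R) (x y : R) :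
  (l + m = 1)%R -> (y <= x)%R ->
  \int[expo 1 ltr01]_v (if (x < v)%R then 1 else
     if (y < v)%R then (m * expR (- l * (x - v)))%:E else 0) =
  expo l l0 `]x, +oo[%classic * expo m m0 `]y, +oo[%classic.
Proof.
move=> lm yx.
have mitv (i : interval R) : measurable ([set` i] : set (measurableTypeR R)).
  exact: measurable_itv.
have pdf0 (k v : R) : (0 < k)%R -> 0 <= (exponential_pdf k v)%:E.
  by move=> k0; rewrite lee_fin exponential_pdf_ge0 // ltW.
pose g (v : R) : \bar R :=
  (m * expR (- l * (x - v)))%:E * (\1_(`]y, x]%classic) v)%:E.
have g0 v : 0 <= g v.
  by rewrite /g mule_ge0 ?lee_fin // mulr_ge0 ?expR_ge0 // ltW.
have mg : measurable_fun setT g.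
  apply: emeasurable_funM; apply/measurable_EFinP; last exact: measurable_indic.
  apply: measurable_funM => //; apply: measurableT_comp => //.
  by apply: measurable_funM => //; exact: measurable_funB.
have mI : measurable_fun setT (fun v : R => (\1_(`]x, +oo[%classic) v)%:E : \bar R).
  by apply/measurable_EFinP; exact: measurable_indic.
transitivity (\int[expo 1 ltr01]_v (\1_(`]x, +oo[%classic) v)%:E +
              \int[expo 1 ltr01]_v g v).
  rewrite -ge0_integralD //.
  apply: eq_integral => v _; rewrite /g !indicE !mem_setE !in_itv /= andbT.
  have [xv|vx] := ltP x v; first by rewrite andbF mule0 adde0.
  by case: ifP => _; rewrite ?mule1 ?mule0 add0e.
rewrite integral_indic // setIT.
rewrite [X in X + _](_ : _ = (expR (- 1 * Num.max x 0))%:E); last exact: expo_tail.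
rewrite [X in _ + X](_ : _ = (expR (- l * x))%:E * expo m m0 `]y, x]%classic).
  have E : expo m m0 `]y, +oo[%classic =
           expo m m0 `]y, x]%classic + expo m m0 `]x, +oo[%classic.
    rewrite -measureU //; last first.
      apply/seteqP; split => z //=; rewrite !in_itv /= andbT => -[/andP[_ zx]].
      by rewrite ltNge zx.
    congr (expo m m0 _); apply/seteqP; split => z /=; rewrite !in_itv /= !andbT.
      by move=> yz; rewrite yz; case: (leP z x) => zx; [left|right].
    by case=> [/andP[]//|]; exact: le_lt_trans.
  have fin A : measurable A -> expo m m0 A \is a fin_num by exact: fin_num_measure.
  have {}E : expo m m0 `]y, x]%classic =
      expo m m0 `]y, +oo[%classic - expo m m0 `]x, +oo[%classic.
    by rewrite E addeK // fin.
  rewrite E !expo_tail -!EFinB -!EFinM -EFinD; congr EFin.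
  have [x0|x0] := leP 0%R x.
    have -> : expR (- 1 * x) = (expR (- l * x) * expR (- m * x))%R.
      by rewrite -expRD; congr expR; rewrite -lm; ring.
    by ring.
  by rewrite max_r ?ltW ?(le_lt_trans yx) // !mulr0 !expR0; ring.
rewrite integral_expo // expoE /exponential_prob [in RHS]integral_mkcond.
have mpdf : measurable_fun setT (fun v : R => (exponential_pdf m v)%:E).
  by apply/measurable_EFinP; exact: measurable_exponential_pdf.
have mD : measurable (`]y, x]%classic : set R) by exact: measurable_itv.
have mr := (measurable_restrictT _ mD).1 (measurable_funTS mpdf).
have r0 (v : measurableTypeR R) : setT v ->
    0 <= ((fun v : R => (exponential_pdf m v)%:E) \_ `]y, x]%classic) v.
  by move=> _; apply: erestrict_ge0 => ? _; exact: pdf0.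
have c0 : 0 <= (expR (- l * x))%:E by rewrite lee_fin expR_ge0.
rewrite -[RHS](ge0_integralZl lebesgue_measure measurableT mr r0 c0).
apply: eq_integral => v _; rewrite /g patchE indicE.
case: ifPn => _; last by rewrite mule0 mul0e mule0.
rewrite mule1 -!EFinM; congr EFin.
have [v0|v0] := leP 0%R v; last by rewrite !lt0_exponential_pdf ?mulr0.
rewrite !exponential_pdfE // mul1r mulrAC -mulrA -expRD mulrCA -expRD.
by congr (_ * expR _)%R; rewrite -lm; ring.
Qed.

(** The recursion [incrS] at one site: [v.1] is the weight, [v.2] the pair of incoming
    increments. *)
Definition burke_map (v : R * (R * R)) : R * R :=
  (v.1 + Num.max (v.2.1 - v.2.2) 0, v.1 + Num.max (v.2.2 - v.2.1) 0)%R.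

Lemma measurable_burke_map : measurable_fun setT
  (burke_map : measurableTypeR R * (measurableTypeR R * measurableTypeR R) ->
               measurableTypeR R * measurableTypeR R).
Proof.
have m1 : measurable_fun setT
    (fun v : measurableTypeR R * (measurableTypeR R * measurableTypeR R) => v.2.1 : R).
  by apply: measurableT_comp; [exact: measurable_fst|exact: measurable_snd].
have m2 : measurable_fun setT
    (fun v : measurableTypeR R * (measurableTypeR R * measurableTypeR R) => v.2.2 : R).
  by apply: measurableT_comp; [exact: measurable_snd|exact: measurable_snd].
apply: measurable_fun_pair; apply: measurable_funD.
- exact: measurable_fst.
- by apply: measurable_maxr => //; exact: measurable_funB.
- exact: measurable_fst.
- by apply: measurable_maxr => //; exact: measurable_funB.
Qed.

Lemma product_measure_ysection (m1 m2 : probability (measurableTypeR R) R)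
    (A : set (measurableTypeR R * measurableTypeR R)) : measurable A ->
  (m1 \x m2) A = \int[m2]_y m1 (ysection A y).
Proof.
move=> mA; transitivity ((m1 \x^ m2) A) => //.
apply: product_measure_unique => // B C mB mC.
exact: product_measure2E.
Qed.

(** Joint tails suffice. Given the weight, only the difference of the incoming increments matters,
    and the larger threshold decides: a weight between the two thresholds needs the difference to
    make up for the rest, and the other constraint then holds by itself. *)
Lemma burke (l m : R) (l0 : (0 < l)%R) (m0 : (0 < m)%R) : (l + m = 1)%R ->
  forall S, measurable S ->
  (expo 1 ltr01 \x (expo l l0 \x expo m m0)) (burke_map @^-1` S) =
  (expo l l0 \x expo m m0) S.
Proof.
move=> lm S mS.
have key (p q v s t : R) : (v <= s)%R -> (t < v)%R ->
    ((s < v + Num.max (p - q) 0)%R /\ (t < v + Num.max (q - p) 0)%R) <->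
    (s - v < p - q)%R.
  move=> vs tv; split.
    by move=> []; case: (leP (p - q)%R 0%R) => ?; case: (leP (q - p)%R 0%R) => ?; lra.
  by move=> ?; split; [case: (leP (p - q)%R 0%R)|case: (leP (q - p)%R 0%R)] => ?; lra.
pose nu : probability (measurableTypeR R * measurableTypeR R)%type R :=
  (expo l l0 \x expo m m0)%E.
transitivity (image_measure _ _ _ _ _ (expo 1 ltr01 \x nu) _
  measurable_burke_map S); first by [].
apply: eq_measure_tails2; last exact: mS.
  rewrite image_measureE preimage_setT -setXTT.
  apply: (@le_lt_trans _ _ (expo 1 ltr01 setT * nu setT)); last first.
    by rewrite !probability_setT mule1 ltry.
  by rewrite le_eqVlt; apply/orP; left; apply/eqP; apply: product_measure1E.
move=> x y; rewrite image_measureE.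
transitivity (expo l l0 `]x, +oo[%classic * expo m m0 `]y, +oo[%classic); last first.
  by apply/esym; apply: product_measure1E; exact: measurable_itv.
pose A := burke_map @^-1` (`]x, +oo[%classic `*` `]y, +oo[%classic).
have sndA r : (0 <= r)%R ->
    nu [set w | (r < w.2 - w.1)%R] = (l * expR (- m * r))%:E.
  move=> r0; apply: etrans (expo_race l m l0 m0 r lm r0).
  apply: eq_integral => w _; congr (expo _ _ _); apply/seteqP; split => z;
    by rewrite /xsection /= in_itv /= andbT inE /= ltrBrDr addrC.
have fstA r : (0 <= r)%R ->
    nu [set w | (r < w.1 - w.2)%R] = (m * expR (- l * r))%:E.
  have ml : (m + l = 1)%R by rewrite addrC.
  move=> r0; apply: etrans (expo_race m l m0 l0 r ml r0).
  transitivity (\int[expo m m0]_w expo l l0 (ysection [set w | (r < w.1 - w.2)%R] w)).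
    apply: product_measure_ysection.
    have m1 : measurable_fun setT (fun w : measurableTypeR R * measurableTypeR R => w.1 : R).
      exact: measurable_fst.
    have m2 : measurable_fun setT (fun w : measurableTypeR R * measurableTypeR R => w.2 : R).
      exact: measurable_snd.
    by apply: measurable_lt_set; [exact: measurable_cst|exact: measurable_funB].
  apply: eq_integral => w _; congr (expo _ _ _); apply/seteqP; split => z;
    by rewrite /ysection /= in_itv /= andbT inE /= ltrBrDr addrC.
have secA v : xsection A v = [set w | (x < v + Num.max (w.1 - w.2) 0)%R /\
                                      (y < v + Num.max (w.2 - w.1) 0)%R].
  by apply/seteqP; split => w; rewrite /xsection /= inE /A /burke_map /=
    !in_itv /= !andbT.
have [yx|xy] := leP y x.
  rewrite -(burke_integral l m) //; apply: eq_integral => v _.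
  transitivity (nu (xsection A v)) => //; rewrite secA.
  have [xv|vx] := ltP x v.
    rewrite -(probability_setT nu); congr (nu _).
    apply/seteqP; split => // w _ /=.
    by split; [case: (leP (w.1 - w.2)%R 0%R)|case: (leP (w.2 - w.1)%R 0%R)] => ?; lra.
  have [yv|vy] := ltP y v; last first.
    rewrite -(measure0 nu); congr (nu _).
    apply/seteqP; split => // w /= [].
    by case: (leP (w.1 - w.2)%R 0%R) => ?; case: (leP (w.2 - w.1)%R 0%R) => ?; lra.
  have xv0 : (0 <= x - v)%R by rewrite subr_ge0.
  apply: etrans (fstA _ xv0); congr (nu _); apply/seteqP; split => w.
    exact: (key w.1 w.2 v x y vx yv).1.
  exact: (key w.1 w.2 v x y vx yv).2.
rewrite muleC -(burke_integral m l) ?(ltW xy) //; last by rewrite addrC.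
apply: eq_integral => v _.
transitivity (nu (xsection A v)) => //; rewrite secA.
have [yv|vy] := ltP y v.
  rewrite -(probability_setT nu); congr (nu _).
  apply/seteqP; split => // w _ /=.
  by split; [case: (leP (w.1 - w.2)%R 0%R)|case: (leP (w.2 - w.1)%R 0%R)] => ?; lra.
have [xv|vx] := ltP x v; last first.
  rewrite -(measure0 nu); congr (nu _).
  apply/seteqP; split => // w /= [].
  by case: (leP (w.1 - w.2)%R 0%R) => ?; case: (leP (w.2 - w.1)%R 0%R) => ?; lra.
have yv0 : (0 <= y - v)%R by rewrite subr_ge0.
apply: etrans (sndA _ yv0); congr (nu _); apply/seteqP; split => w.
  by move=> /and_comm; exact: (key w.2 w.1 v y x vy xv).1.
by move=> h; apply/and_comm; exact: (key w.2 w.1 v y x vy xv).2.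
Qed.

End burke.

(** * Independent families and their transformation by Burke's property *)

Section independent_family.
Context d (T : measurableType d) (R : realType) (P : probability T R).
Context (I : eqType).
Implicit Types (A : pred I) (X : I -> T -> R) (s : seq I) (B : I -> set R).
Implicit Types (mu : I -> probability (measurableTypeR R) R).
Local Open Scope ereal_scope.

Definition law (Z : T -> R) (mZ : measurable_fun setT Z) :
    probability (measurableTypeR R) R :=
  distribution P (HB.pack Z (isMeasurableFun.Build _ _ _ (measurableTypeR R) Z mZ)
    : {mfun T >-> measurableTypeR R}).

Definition cylinder X s B : set T := \big[setI/setT]_(i <- s) (X i @^-1` B i).

(** [X] lists all variables at once, dependent ones included; [A] selects those that are jointly
    independent, and changes as the recursion proceeds. *)
Definition ind_fam (A : pred I) X mu : Prop :=
  forall s B, uniq s -> all A s -> (forall i, measurable (B i)) ->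
  P (cylinder X s B) = \prod_(i <- s) mu i (B i).

Lemma measurable_cylinder X s B : (forall i, measurable_fun setT (X i)) ->
  (forall i, measurable (B i)) -> measurable (cylinder X s B).
Proof.
move=> mX mB; rewrite /cylinder; elim/big_ind: _ => //.
  by move=> *; exact: measurableI.
by move=> i _; rewrite -[X in measurable X]setTI; exact: mX.
Qed.

Lemma big_uniq_filter (V : Type) (idx : V) (op : Monoid.com_law idx) s b
    (F : I -> V) : uniq s ->
  \big[op/idx]_(i <- s) F i =
  op (if b \in s then F b else idx) (\big[op/idx]_(i <- s | i != b) F i).
Proof.
move=> us; case: ifPn => bs; first by rewrite (bigD1_seq b).
rewrite Monoid.mul1m big_seq [RHS]big_seq_cond; apply: eq_bigl => i.
by case: eqP => [->|]; rewrite ?(negPf bs) ?andbT.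
Qed.

Lemma cylinder_eq X s B B' : {in s, B =1 B'} -> cylinder X s B = cylinder X s B'.
Proof.
move=> BB'; rewrite /cylinder !big_seq; apply: eq_bigr => i /BB' BB'i.
by rewrite BB'i.
Qed.

Lemma cylinder_cons X s B a C : a \notin s ->
  X a @^-1` C `&` cylinder X s B =
  cylinder X (a :: s) (fun i => if i == a then C else B i).
Proof.
move=> as_; rewrite [RHS]/cylinder big_cons eqxx; congr (_ `&` _).
apply: cylinder_eq => i is_ /=.
by case: eqP => // ia; move: as_; rewrite -ia is_.
Qed.

Lemma ind_fam_cons A X mu s B a C : ind_fam A X mu -> uniq (a :: s) ->
  all A (a :: s) -> (forall i, measurable (B i)) -> measurable C ->
  P (X a @^-1` C `&` cylinder X s B) = mu a C * P (cylinder X s B).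
Proof.
move=> ind us As mB mC.
have [as_ us'] := andP us; have /andP[_ As'] := As.
rewrite cylinder_cons // ind //; last by move=> i; case: ifP.
rewrite ind // big_cons eqxx; congr (_ * _).
rewrite !big_seq; apply: eq_bigr => i is_.
by case: eqP => // ia; move: as_; rewrite -ia is_.
Qed.

Lemma ind_fam_marginal A X mu a C : ind_fam A X mu -> A a -> measurable C ->
  P (X a @^-1` C) = mu a C.
Proof.
move=> ind Aa mC; have Aa' : all A [:: a] by rewrite /= Aa.
have := ind [:: a] (fun=> C) isT Aa' (fun=> mC).
by rewrite /cylinder !big_seq1.
Qed.

Lemma ind_fam_sub A A' X mu : (forall i, A' i -> A i) -> ind_fam A X mu ->
  ind_fam A' X mu.
Proof.
by move=> AA' ind s B us As mB; apply: ind => //; apply: sub_all As => i /AA'.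
Qed.

(** The variables [b'] and [c'] are a function of [a], [b], [c], which are independent of the rest,
    and [burke] gives the law of that function. So [a], [b], [c] leave the selection and [b'], [c']
    enter it. *)
Lemma ind_fam_burke A A' X mu a b c b' c' (l m : R) l0 m0 :
  (forall i, measurable_fun setT (X i)) ->
  (l + m = 1)%R -> ind_fam A X mu ->
  [/\ A a, A b & A c] -> uniq [:: a; b; c] -> b' != c' ->
  mu a = expo 1 ltr01 -> mu b = expo l l0 -> mu c = expo m m0 ->
  mu b' = expo l l0 -> mu c' = expo m m0 ->
  (forall w, (X b' w, X c' w) = burke_map (X a w, (X b w, X c w))) ->
  (forall i, A' i -> i != b' -> i != c' -> A i && (i \notin [:: a; b; c])) ->
  ind_fam A' X mu.
Proof.
move=> mX lm ind [Aa Ab Ac] uabc bc' mua mub muc mub' muc' XE sub s B us As mB.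
pose s0 := [seq i <- s | (i != b') && (i != c')].
(* An index absent from [s] is constrained by [setT], which treats the four cases at once. *)
pose Bb := if b' \in s then B b' else setT.
pose Bc := if c' \in s then B c' else setT.
have mBb : measurable (Bb : set (measurableTypeR R)).
  by rewrite /Bb; case: ifP => _; [exact: mB|exact: measurableT].
have mBc : measurable (Bc : set (measurableTypeR R)).
  by rewrite /Bc; case: ifP => _; [exact: mB|exact: measurableT].
have us0 : uniq s0 by rewrite filter_uniq.
have As0 : all (fun i => A i && (i \notin [:: a; b; c])) s0.
  apply/allP => i; rewrite mem_filter => /andP[/andP[ib ic] is_].
  by apply: sub => //; exact: (allP As).
have As0' : all A s0 by apply: sub_all As0 => i /andP[].
have s0abc i : i \in s0 -> i \notin [:: a; b; c] by move=> /(allP As0) /andP[].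
have us0abc t : uniq t -> {subset t <= [:: a; b; c]} -> uniq (t ++ s0).
  move=> ut tabc; rewrite cat_uniq ut us0 andbT /=; apply/hasPn => i /s0abc.
  by apply: contra; exact: tabc.
have splitE (V : Type) (idx : V) (op : Monoid.com_law idx) (F : I -> V) :
    \big[op/idx]_(i <- s) F i = op (if b' \in s then F b' else idx)
      (op (if c' \in s then F c' else idx) (\big[op/idx]_(i <- s0) F i)).
  rewrite (big_uniq_filter _ _ _ _ b') //; congr (op _ _).
  rewrite -big_filter (big_uniq_filter _ _ _ _ c') ?filter_uniq //.
  rewrite mem_filter eq_sym bc' /= -big_filter -filter_predI.
  by congr (op _ (\big[op/idx]_(i <- _) F i)); apply: eq_filter => i /=; rewrite andbC.
set E := cylinder X s0 B.
have mE : measurable E by exact: measurable_cylinder.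
have -> : cylinder X s B =
    (fun w => (X a w, (X b w, X c w))) @^-1` (burke_map @^-1` (Bb `*` Bc)) `&` E.
  transitivity ((if b' \in s then X b' @^-1` B b' else setT) `&`
    ((if c' \in s then X c' @^-1` B c' else setT) `&` E)); first exact: splitE.
  rewrite setIA; congr (_ `&` _).
  transitivity (X b' @^-1` Bb `&` X c' @^-1` Bc).
    by rewrite /Bb /Bc; congr (_ `&` _); case: ifP; rewrite ?preimage_setT.
  have BE w : (Bb `*` Bc) (X b' w, X c' w) = (Bb `*` Bc) (burke_map (X a w, (X b w, X c w))).
    by rewrite XE.
  by apply/seteqP; split => w; [rewrite -[X in _ -> X]/((Bb `*` Bc) (burke_map _)) -BE
    |rewrite -[X in X -> _]/((Bb `*` Bc) (burke_map _)) -BE].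
transitivity ((if b' \in s then mu b' (B b') else 1) *
  ((if c' \in s then mu c' (B c') else 1) * \prod_(i <- s0) mu i (B i)));
  last by apply/esym; exact: splitE.
have PE : P E = \prod_(i <- s0) mu i (B i) by exact: ind.
rewrite -PE muleA.
have -> : (if b' \in s then mu b' (B b') else 1) * (if c' \in s then mu c' (B c') else 1) =
    (expo l l0 \x expo m m0) (Bb `*` Bc).
  transitivity (expo l l0 Bb * expo m m0 Bc); last first.
    by apply/esym; apply: product_measure1E.
  rewrite -mub' -muc' /Bb /Bc.
  by congr (_ * _); case: ifP => // _; rewrite probability_setT.
have mBB : measurable (Bb `*` Bc : set (measurableTypeR R * measurableTypeR R)).
  exact: measurableX.
rewrite -(burke l m l0 m0 lm _ mBB).
pose X' w : measurableTypeR R * measurableTypeR R := (X b w, X c w).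
have mX' : measurable_fun setT X' by apply: measurable_fun_pair; exact: mX.
apply: (@joint_law _ T R P _ _ _ _ (X a : T -> measurableTypeR R) X' (expo 1 ltr01)
  (expo l l0 \x expo m m0) E (mX a) mX' mE); last first.
  by rewrite -[X in measurable X]setTI; exact: measurable_burke_map.
move=> Ca S mCa mS.
(* The second use of [joint_law] is for the pair of [b] and [c], with the constraint on [a] absorbed
   into the event. *)
transitivity (P (X' @^-1` S `&` (X a @^-1` Ca `&` E))).
  by rewrite [X in P (X `&` _)]setIC -setIA.
have mE' : measurable (X a @^-1` Ca `&` E).
  by apply: measurableI => //; rewrite -[X in measurable X]setTI; exact: mX.
rewrite (@joint_law _ T R P _ _ _ _ (X b : T -> measurableTypeR R)
  (X c : T -> measurableTypeR R) (expo l l0) (expo m m0) _ (mX b) (mX c) mE') //.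
  rewrite (ind_fam_cons A X mu) // -?mua ?muleA; first by congr (_ * _); rewrite muleC.
  - by apply: (us0abc [:: a]) => // i; rewrite !inE => ->.
  - by rewrite /= Aa.
move=> Cb Cc mCb mCc.
have uu : uniq ([:: b; c; a] ++ s0).
  apply: us0abc => [|i].
    move: uabc; rewrite /= !inE !negb_or !andbT => /andP[/andP[ab ac] bc].
    by rewrite bc (eq_sym b a) ab (eq_sym c a) ac.
  by rewrite !inE => /or3P[] ->; rewrite ?orbT.
have [Ab' Ac' Aa'] :
    [/\ all A ([:: b; c; a] ++ s0), all A ([:: c; a] ++ s0) & all A (a :: s0)].
  by rewrite /= Aa Ab Ac.
have [/= h1 /andP[h2 /andP[h3 _]]] := andP uu.
have mB1 : forall i, measurable ((if i == a then Ca else B i) : set R) by move=> i; case: ifP.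
have mB2 : forall i, measurable ((if i == c then Cc else if i == a then Ca else B i) : set R).
  by move=> i; case: ifP.
rewrite -setIA cylinder_cons // cylinder_cons //.
rewrite (ind_fam_cons A X mu) // -cylinder_cons // (ind_fam_cons A X mu) //.
  by rewrite mub muc muleA.
by rewrite /= h2 h3.
Qed.

End independent_family.
Arguments law {d T R} P {Z} mZ.
Arguments cylinder {d T R I} X s B.
Arguments ind_fam {d T R} P {I} A X mu.
Arguments cylinder_cons {d T R I X s B a C}.
Arguments ind_fam_cons {d T R P I A X mu s B a C}.
Arguments ind_fam_marginal {d T R P I A X mu a C}.

(** * Sums of independent variables and Chernoff bounds *)

Section independent_sum.
Context d (T : measurableType d) (R : realType) (P : probability T R).
Context (I : eqType) (A : pred I) (X : I -> T -> R).
Context (mu : I -> probability (measurableTypeR R) R).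
Hypotheses (mX : forall i, measurable_fun setT (X i)) (ind : ind_fam P A X mu).
Local Open Scope ereal_scope.

Definition psum (s : seq I) (w : T) : R := (\sum_(i <- s) X i w)%R.

Lemma measurable_psum s : measurable_fun setT (psum s).
Proof. by apply: measurable_sum => i; exact: mX. Qed.

Lemma lawE Z (mZ : measurable_fun setT Z) C : law P mZ C = P (Z @^-1` C).
Proof. by []. Qed.

Lemma measurable_preim (Z : T -> R) (C : set R) : measurable_fun setT Z ->
  measurable C -> measurable (Z @^-1` C).
Proof. by move=> mZ mC; rewrite -[X in measurable X]setTI; exact: mZ. Qed.

(** The cylinder is kept general for the induction: moving the head of [s] into it shows that the
    head, the remaining sum and the cylinder are independent. *)
Lemma psum_indep s s' B C : uniq (s ++ s') -> all A (s ++ s') ->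
  (forall i, measurable (B i)) -> measurable C ->
  P (psum s @^-1` C `&` cylinder X s' B) = P (psum s @^-1` C) * P (cylinder X s' B).
Proof.
elim: s s' B C => [|a s IH] s' B C us As mB mC.
  have p0 : psum [::] = cst 0%R by apply/funext => w; rewrite /psum big_nil.
  rewrite p0 preimage_cst; case: ifP => _.
    by rewrite setTI probability_setT mul1e.
  by rewrite set0I measure0 mul0e.
have mS := measurable_psum s.
have joint s1 B1 : uniq (a :: s ++ s1) -> all A (a :: s ++ s1) ->
    (forall i, measurable (B1 i)) ->
    forall S, measurable S ->
    P ((fun w => (X a w, psum s w)) @^-1` S `&` cylinder X s1 B1) =
    (mu a \x law P mS) S * P (cylinder X s1 B1).
  move=> us1 As1 mB1.
  have mcyl := measurable_cylinder _ _ _ _ X s1 B1 mX mB1.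
  apply: (@joint_law _ T R P _ _ _ _ (X a : T -> measurableTypeR R)
    (psum s : T -> measurableTypeR R) (mu a) (law P mS) _ (mX a) mS mcyl).
  move=> D E mD mE; rewrite setIAC setIC.
  have us1' : uniq (s ++ a :: s1).
    by rewrite (perm_uniq (_ : perm_eq _ (a :: s ++ s1))) // -cat1s perm_catCA.
  have As1' : all A (s ++ a :: s1) by move: As1; rewrite /= !all_cat /= andbCA.
  have as1 : a \notin s1 by move: us1'; rewrite cat_uniq => /and3P[_ _] /= /andP[].
  rewrite cylinder_cons // IH //; last by move=> i; case: ifP.
  rewrite -cylinder_cons // (ind_fam_cons ind) //; last 2 first.
  - by move: us1'; rewrite cat_uniq => /and3P[].
  - by move: As1'; rewrite all_cat => /andP[].
  by rewrite muleA [X in X * _ = _]muleC.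
pose f (p : measurableTypeR R * measurableTypeR R) : R := (p.1 + p.2)%R.
have mf : measurable_fun setT f.
  have m1 : measurable_fun setT (fun p : measurableTypeR R * measurableTypeR R => p.1 : R).
    exact: measurable_fst.
  have m2 : measurable_fun setT (fun p : measurableTypeR R * measurableTypeR R => p.2 : R).
    exact: measurable_snd.
  exact: measurable_funD.
have psumE : psum (a :: s) @^-1` C = (fun w => (X a w, psum s w)) @^-1` (f @^-1` C).
  by apply/seteqP; split => w; rewrite /preimage /= /psum big_cons.
have mfC : measurable (f @^-1` C) by rewrite -[X in measurable X]setTI; exact: mf.
rewrite psumE joint //; congr (_ * _).
have us0 : uniq (a :: s ++ [::]).
  by move: us; rewrite cats0 cat_uniq => /andP[].
have As0 : all A (a :: s ++ [::]) by move: As; rewrite cats0 all_cat => /andP[].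
have := joint [::] B us0 As0 mB _ mfC.
by rewrite /cylinder big_nil setIT probability_setT mule1 => ->.
Qed.

Lemma psum_joint a s (mS := measurable_psum s) : uniq (a :: s) -> all A (a :: s) ->
  forall S, measurable S ->
  P ((fun w => (X a w, psum s w)) @^-1` S) = (mu a \x law P mS) S.
Proof.
move=> us As S mS'.
have := @joint_law _ T R P _ _ _ _ (X a : T -> measurableTypeR R)
  (psum s : T -> measurableTypeR R) (mu a) (law P mS) setT (mX a) mS measurableT.
move=> /(_ _ S mS'); rewrite setIT probability_setT mule1; apply.
move=> D E mD mE; rewrite setIT mule1 setIC.
have us1 : uniq (s ++ [:: a]) by rewrite cats1 rcons_uniq.
have As1 : all A (s ++ [:: a]) by rewrite cats1 all_rcons.
have := psum_indep s [:: a] (fun=> D) E us1 As1 (fun=> mD) mE.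
rewrite /cylinder big_seq1 => ->; rewrite muleC; congr (_ * _).
by apply: (ind_fam_marginal ind) => //; have /andP[] := As.
Qed.

Lemma psum_mgf s t : uniq s -> all A s ->
  \int[P]_w (expR (t * psum s w))%:E = \prod_(i <- s) \int[mu i]_x (expR (t * x))%:E.
Proof.
have me : measurable_fun setT (fun x : R => (expR (t * x))%:E).
  by apply/measurable_EFinP; apply: measurableT_comp => //; exact: measurable_funM.
have e0 (x : R) : 0 <= (expR (t * x))%:E by rewrite lee_fin expR_ge0.
elim: s => [|a s IH] us As.
  rewrite big_nil (eq_integral (cst 1)) ?integral_cst ?mul1e //; first exact: probability_setT.
  by move=> w _; rewrite /psum big_nil mulr0 expR0.
have mS := measurable_psum s.
pose f (p : measurableTypeR R * measurableTypeR R) : \bar R :=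
  (expR (t * p.1))%:E * (expR (t * p.2))%:E.
have f0 p : 0 <= f p by rewrite mule_ge0.
have mf : measurable_fun setT f.
  apply: emeasurable_funM.
    by apply: (measurableT_comp me); exact: measurable_fst.
  by apply: (measurableT_comp me); exact: measurable_snd.
pose Z w : measurableTypeR R * measurableTypeR R := (X a w, psum s w).
have mZ : measurable_fun setT Z by apply: measurable_fun_pair; [exact: mX|exact: mS].
transitivity (\int[P]_w (f \o Z) w).
  by apply: eq_integral => w _; rewrite /f /= /psum big_cons mulrDr expRD EFinM.
have := ge0_integral_pushforward mZ P measurableT mf (fun p _ => f0 p).
rewrite preimage_setT => <-.
transitivity (\int[mu a \x law P mS]_p f p).
  apply: (@eq_measure_integral _ _ _ setT (mu a \x law P mS) (image_measure _ _ _ _ _ P Z mZ)).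
  by move=> S mS' _; rewrite image_measureE; exact: psum_joint.
rewrite fubini_tonelli1 // big_cons.
transitivity (\int[mu a]_x ((expR (t * x))%:E * \int[law P mS]_y (expR (t * y))%:E)).
  by apply: eq_integral => x _; rewrite /fubini_F /f /= ge0_integralZl.
rewrite ge0_integralZr //; last by apply: integral_ge0.
congr (_ * _); rewrite -IH; last 2 first.
- by case/andP: us.
- by case/andP: As.
have E := ge0_integral_pushforward
  (mS : measurable_fun setT (psum s : T -> measurableTypeR R))
  P measurableT me (fun p _ => e0 p).
by rewrite preimage_setT in E.
Qed.

End independent_sum.

Arguments psum {d T R I} X s w.
Arguments measurable_psum {d T R I X} mX s.
Arguments psum_mgf {d T R P I A X mu} mX ind.

Section expo_sum_tail.
Context d (T : measurableType d) (R : realType) (P : probability T R).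
Context (I : eqType) (A : pred I) (X : I -> T -> R).
Context (mu : I -> probability (measurableTypeR R) R).
Hypotheses (mX : forall i, measurable_fun setT (X i)) (ind : ind_fam P A X mu).

(** From [1 + x <= expR x] and [(1 + c + 2 * c ^+ 2) * (1 - c) = 1 + c ^+ 2 * (1 - 2 * c)]. *)
Lemma le_invr_expR (c : R) : -1/2 <= c <= 1/2 -> (1 - c)^-1 <= expR (c + 2 * c ^+ 2).
Proof.
move=> /andP[c1 c2]; have c0 : 0 < 1 - c by lra.
rewrite -[leLHS]mul1r ler_pdivrMr //.
apply: le_trans (_ : (1 + (c + 2 * c ^+ 2)) * (1 - c) <= _).
  have : 0 <= c ^+ 2 * (1 - 2 * c) by rewrite mulr_ge0 ?sqr_ge0 //; lra.
  by rewrite !expr2; nra.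
by apply: ler_wpM2r; [lra|exact: expR_ge1Dx].
Qed.

(** The sign of [c] selects the tail: positive for large sums, negative for small ones. *)
Lemma expo_sum_chernoff (l : R) l0 s (c r : R) : uniq s -> all A s ->
  {in s, forall i, mu i = expo l l0} -> -1/2 <= c <= 1/2 ->
  (P [set w | (r <= c * l * psum X s w)%R] <=
   (expR ((size s)%:R * (c + 2 * c ^+ 2) - r))%:E)%E.
Proof.
move=> us As mus c12.
have mZ : measurable_fun setT (fun w => c * l * psum X s w).
  by apply: measurable_funM => //; exact: measurable_psum mX s.
pose Z : {RV P >-> R} := HB.pack (fun w => c * l * psum X s w)
  (isMeasurableFun.Build _ _ _ _ _ mZ).
have := @chernoff _ T R P Z 1 r ltr01.
rewrite /mmt_gen_fun unlock.
rewrite (_ : (\int[P]_w _)%E = (\prod_(i <- s) ((1 - c)^-1)%:E)%E); last first.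
  transitivity (\int[P]_w (expR (c * l * psum X s w))%:E)%E.
    by apply: eq_integral => w _ /=; rewrite mulr1.
  rewrite (psum_mgf mX ind) //.
  rewrite !big_seq; apply: eq_bigr => i is_; rewrite mus // expo_mgf; last first.
    by move/andP: c12 => [? ?]; rewrite gtr_pMl //; lra.
  congr EFin; rewrite (_ : l - c * l = l * (1 - c)); last by ring.
  by rewrite invfM mulrA divff ?mul1r // gt_eqF.
move=> /le_trans; apply.
rewrite mul1r (_ : (\prod_(i <- s) _)%E = ((1 - c)^-1 ^+ size s)%:E); last first.
  elim: s {us As mus mZ Z} => [|i s IH]; first by rewrite big_nil expr0.
  by rewrite big_cons IH exprS -EFinM.
rewrite -EFinM lee_fin expRD; apply: ler_wpM2r; first exact: expR_ge0.
rewrite mulrC expRM_natr; apply: lerXn2r; rewrite ?nnegrE ?expR_ge0 //.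
  by move/andP: c12 => [? ?]; rewrite invr_ge0; lra.
exact: le_invr_expR.
Qed.

End expo_sum_tail.

(** Deviations are measured by [N] and not by the number of terms, because the row or the column of
    a long path may be short. The rate [rho] is the same for all probability spaces. *)
Lemma expo_sum_tails (R : realType) (l e : R) : 0 < l -> 0 < e ->
  exists2 rho : R, 0 < rho &
  forall d (T : measurableType d) (P : probability T R)
    (I : eqType) (A : pred I) (X : I -> T -> R)
    (mu : I -> probability (measurableTypeR R) R) (l0 : 0 < l) (s : seq I) (N : nat),
  (forall i, measurable_fun setT (X i)) -> ind_fam P A X mu ->
  uniq s -> all A s -> {in s, forall i, mu i = expo l l0} -> (size s <= N)%N ->
  (P [set w | ((size s)%:R / l + e * N%:R <= psum X s w)%R] <= (expR (- rho * N%:R))%:E)%E /\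
  (P [set w | (psum X s w <= (size s)%:R / l - e * N%:R)%R] <= (expR (- rho * N%:R))%:E)%E.
Proof.
(* As [c <= l * e / 4], the quadratic term [2 * c ^+ 2] costs at most half of the gain
   [c * (l * e)]. *)
move=> l0 e0; pose c := Num.min (1/2) (l * e / 4).
have le0 : 0 < l * e by rewrite mulr_gt0.
have c0 : 0 < c by rewrite lt_min; apply/andP; split; lra.
have c1 : c <= 1/2 by rewrite ge_min lexx.
have c2 : c <= l * e / 4 by rewrite ge_min lexx orbT.
exists (c * (l * e) / 2); first by rewrite divr_gt0 // mulr_gt0.
move=> d T P I A X mu l0' s N mX ind us As mus sN.
have sN' : (size s)%:R <= N%:R :> R by rewrite ler_nat.
have N0 : 0 <= N%:R :> R by [].
have bound : (size s)%:R * (2 * c ^+ 2) - c * (l * e) * N%:R <= - (c * (l * e) / 2) * N%:R.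
  have h1 : (size s)%:R * (2 * c ^+ 2) <= N%:R * (2 * c ^+ 2).
    by apply: ler_wpM2r => //; rewrite mulr_ge0 ?sqr_ge0.
  have h2 : N%:R * (2 * c ^+ 2) <= N%:R * (c * (l * e) / 2).
    apply: ler_wpM2l => //; rewrite expr2.
    have := ler_wpM2l (ltW c0) c2; lra.
  lra.
split.
  have h : -1/2 <= c <= 1/2 by apply/andP; split; lra.
  rewrite (_ : [set w | _] =
    [set w | (size s)%:R * c + c * (l * e) * N%:R <= c * l * psum X s w]).
    have H := expo_sum_chernoff _ _ _ _ _ _ _ _ mX ind l l0' s c
      ((size s)%:R * c + c * (l * e) * N%:R) us As mus h.
    apply: (le_trans H).
    by rewrite lee_fin ler_expR; lra.
  apply/eq_set => w; rewrite -(ler_pM2l (mulr_gt0 c0 l0)); congr is_true.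
  congr (_ <= _); field; lra.
have h : -1/2 <= - c <= 1/2 by apply/andP; split; lra.
rewrite (_ : [set w | _] =
    [set w | (size s)%:R * - c + c * (l * e) * N%:R <= - c * l * psum X s w]).
  have H := expo_sum_chernoff _ _ _ _ _ _ _ _ mX ind l l0' s (- c)
    ((size s)%:R * - c + c * (l * e) * N%:R) us As mus h.
  apply: (le_trans H).
  by rewrite lee_fin ler_expR sqrrN; lra.
apply/eq_set => w; rewrite -(ler_pM2l (mulr_gt0 c0 l0)) -lerN2; congr is_true.
by congr (_ <= _); [field; lra|rewrite !mulNr].
Qed.

Lemma expo_scale (R : realType) (c : R) (c0 : 0 < c) (B : set R) : measurable B ->
  expo 1 ltr01 [set r | B (r / c)] = expo c c0 B.
Proof.
move=> mB.
have ms : measurable_fun setT ((fun r : R => r / c) : measurableTypeR R -> measurableTypeR R).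
  have h : measurable_fun setT (fun r : R => r / c) by exact: measurable_funM.
  exact: h.
transitivity (image_measure _ _ _ _ _ (expo 1 ltr01) _ ms B); first by [].
apply: eq_measure_tails; last exact: mB.
  rewrite image_measureE preimage_setT.
  by apply: (@le_lt_trans _ _ 1%E); [exact: probability_le1|exact: ltry].
move=> x; rewrite image_measureE.
rewrite (_ : _ @^-1` _ = `](c * x), +oo[%classic).
  apply: etrans (expo_tail _ _ _) (etrans _ (esym (expo_tail _ _ _))).
  congr (expR _)%:E; by rewrite mulN1r mulNr maxr_pMr ?mulr0 // ltW.
by apply/seteqP; split => r; rewrite /= !in_itv /= !andbT ltr_pdivlMr // mulrC.
Qed.

(** * Fronts: independence of the increments along rows and columns *)

Definition lf (x : Z2) : Z2 := (x.1 - 1, x.2).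
Definition dn (x : Z2) : Z2 := (x.1, x.2 - 1).

Lemma lf_rt x : lf (rt x) = x.
Proof. by case: x => p q; site_lia. Qed.

Lemma dn_up x : dn (up x) = x.
Proof. by case: x => p q; site_lia. Qed.

Section fronts.
Context d (T : measurableType d) (R : realType) (P : probability T R).
Context (Y : Z2 -> T -> R) (a : R) (a0 : 0 < a) (a1 : 0 < 1 - a).
Hypothesis mY : forall x, measurable_fun setT (Y x).
Hypothesis Y_ind : ind_fam P xpredT Y (fun=> expo 1 ltr01).

Lemma measurable_incr t x :
  measurable_fun setT (fun w => (incr a (Y^~ w) t x).1) /\
  measurable_fun setT (fun w => (incr a (Y^~ w) t x).2).
Proof.
elim: t x => [|t IH] x; first by split; exact: measurable_funM.
have [h1 _] := IH (up x); have [_ h2] := IH (rt x).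
split; apply: measurable_funD => //; apply: measurable_maxr => //;
  exact: measurable_funB.
Qed.

Variable K : int.

(** The horizon that makes the increments at all sites start from the same antidiagonal, that of
    level [K]. *)
Let tl (x : Z2) : nat := `|K - lev x|%N.

(* The index (0, x) stands for the weight at [x], (1, x) for the increment
   across the edge from [x] to [rt x] and (2, x) for the one to [up x]. *)
Definition front_var (i : nat * Z2) (w : T) : R :=
  match i.1 with
  | 0 => Y i.2 w
  | 1 => (incr a (Y^~ w) (tl i.2) i.2).1
  | _ => (incr a (Y^~ w) (tl i.2) i.2).2
  end.

Definition front_law (i : nat * Z2) : probability (measurableTypeR R) R :=
  match i.1 with
  | 0 => expo 1 ltr01
  | 1 => expo (1 - a) a1
  | _ => expo a a0
  end.

(** [S] is the set of sites already absorbed by the recursion. An increment is available once its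
    site is absorbed or terminal, and until it is consumed by the site below (kind 1) or to the left
    (kind 2). The weights of the sites still to be absorbed complete the family. *)
Definition front (S : pred Z2) (i : nat * Z2) : bool :=
  match i.1 with
  | 0 => (lev i.2 < K) && ~~ S i.2
  | 1 => (S i.2 || (lev i.2 == K)) && ~~ S (dn i.2)
  | 2 => (S i.2 || (lev i.2 == K)) && ~~ S (lf i.2)
  | _ => false
  end.

Lemma measurable_front_var i : measurable_fun setT (front_var i).
Proof.
case: i => [[|[|k]] x] //=.
- exact: mY.
- exact: (measurable_incr _ _).1.
- exact: (measurable_incr _ _).2.
Qed.

(** With nothing absorbed, each variable of the front is a rescaled weight, at a site of its own:
    the increments of kind 1 take theirs from level [K], those of kind 2 from level [K + 1]. *)
Lemma ind_fam_terminal : ind_fam P (front xpred0) front_var front_law.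
Proof.
(* [sg] is the site of that weight, [tau] inverts it on the front, and [c] is the resulting rate. *)
pose sg (i : nat * Z2) := if i.1 == 2 then rt i.2 else i.2.
pose tau (y : Z2) : nat * Z2 :=
  if lev y < K then (0%N, y) else if lev y == K then (1%N, y) else (2%N, lf y).
pose c (y : Z2) : R := if lev y < K then 1 else if lev y == K then 1 - a else a.
have c0 y : 0 < c y by rewrite /c; do 2?case: ifP => _.
have tausg i : front xpred0 i -> tau (sg i) = i.
  case: i => [[|[|[|k]]] x]; rewrite /front /= ?andbT /tau /sg /= => //.
  - by move=> ->.
  - by move=> /eqP ->; rewrite ltxx eqxx.
  move=> /eqP xK; have -> : lev (rt x) = K + 1 by rewrite -xK /lev /=; lia.
  by rewrite ifF ?ifF ?lf_rt //; lia.
have varE i w : front xpred0 i -> front_var i w = Y (sg i) w / c (sg i).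
  case: i => [[|[|[|k]]] x]; rewrite /front /= ?andbT /sg /c /front_var /tl /= => //.
  - by move=> ->; rewrite divr1.
  - by move=> /eqP ->; rewrite ltxx eqxx subrr.
  move=> /eqP xK; have -> : lev (rt x) = K + 1 by rewrite -xK /lev /=; lia.
  by rewrite xK subrr ifF ?ifF //; lia.
have lawE i : front xpred0 i -> front_law i = expo (c (sg i)) (c0 (sg i)).
  move=> fi; suff H : forall l (l0 : 0 < l), l = c (sg i) ->
      expo l l0 = expo (c (sg i)) (c0 (sg i)).
    apply: esym; apply: esym; move: fi H.
    case: i => [[|[|[|k]]] x]; rewrite /front /= ?andbT /sg /c /front_law /= => //.
    - by move=> h H; apply: H; rewrite h.
    - by move=> /eqP h H; apply: H; rewrite h ltxx eqxx.
    move=> /eqP xK H; apply: H.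
    have -> : lev (rt x) = K + 1 by rewrite -xK /lev /=; lia.
    by rewrite ifF ?ifF //; lia.
  by move=> l l0 E; subst l; congr (expo _ _); exact: bool_irrelevance.
move=> s B us As mB.
pose B' y := [set r | B (tau y) (r / c y)].
have mB' y : measurable (B' y).
  have h : measurable_fun setT (fun r : R => r / c y) by exact: measurable_funM.
  by rewrite -[X in measurable X]setTI; exact: h.
have uss : uniq (map sg s).
  rewrite map_inj_in_uniq // => i j /(allP As) fi /(allP As) fj E.
  by rewrite -(tausg i) // -(tausg j) // E.
have := Y_ind (map sg s) B' uss (all_predT _) mB'.
rewrite /cylinder !big_map => H.
transitivity (\prod_(j <- s) expo 1 ltr01 (B' (sg j)))%E; last first.
  rewrite !big_seq; apply: eq_bigr => i /(allP As) fi.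
  by rewrite (lawE _ fi) -(expo_scale _ _ _ _ (mB i)) /B' (tausg _ fi).
rewrite -H; congr (P _); rewrite !big_seq; apply: eq_bigr => i /(allP As) fi.
by apply/seteqP; split => w; rewrite /B' /preimage /= tausg // varE.
Qed.

(** Absorbing [x] trades its weight and the increments entering from [up x] and [rt x] for the two
    increments at [x]: one application of Burke's property. *)
Lemma ind_fam_flip (S S' : pred Z2) x : ind_fam P (front S) front_var front_law ->
  lev x < K -> ~~ S x -> S (rt x) || (lev (rt x) == K) ->
  S (up x) || (lev (up x) == K) ->
  (forall y, S' y = (y == x) || S y) ->
  ind_fam P (front S') front_var front_law.
Proof.
move=> ind xK Sx Srt Sup S'E.
apply: (@ind_fam_burke _ T R P _ (front S) (front S') front_var front_law
  (0%N, x) (1%N, up x) (2%N, rt x) (1%N, x) (2%N, x) (1 - a) a a1 a0) => //.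
- exact: measurable_front_var.
- by rewrite subrK.
- by split; rewrite /front /= ?xK ?Sx // ?Srt ?Sup ?dn_up ?lf_rt.
- move=> w; rewrite /front_var /=.
  have -> : tl x = (tl (up x)).+1 by rewrite /tl; move: xK; rewrite /lev /=; lia.
  have -> : tl (rt x) = tl (up x) by rewrite /tl /lev /=; congr `|_|%N; lia.
  by [].
case=> [[|[|[|k]]] y]; rewrite /front /= ?S'E // !inE !xpair_eqE /= ?orbF.
- by rewrite negb_or => /and3P[-> -> ->].
- move=> /andP[h1]; rewrite negb_or => /andP[h2 h3] yx _.
  rewrite (negPf yx) /= in h1.
  by rewrite h1 h3 /=; apply: contra h2 => /eqP ->; rewrite dn_up.
move=> /andP[h1]; rewrite negb_or => /andP[h2 h3] _ yx.
rewrite (negPf yx) /= in h1.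
by rewrite h1 h3 /=; apply: contra h2 => /eqP ->; rewrite lf_rt.
Qed.

Definition corner (p : Z2) : pred Z2 :=
  fun z => [&& p.1 <= z.1, p.2 <= z.2 & lev z < K].

Lemma front_eq (S S' : pred Z2) : S =1 S' -> front S =1 front S'.
Proof. by move=> E [[|[|[|k]]] x]; rewrite /front /= ?E. Qed.

(** The sites of this finite triangle are absorbed level by level downwards from [K], and from left
    to right within a level, so that both upper neighbours are absorbed or terminal in time. *)
Lemma ind_fam_corner p : ind_fam P (front (corner p)) front_var front_law.
Proof.
pose Sn (n : nat) (z : Z2) := corner p z && (K <= lev z + n%:Z).
have H n : ind_fam P (front (Sn n)) front_var front_law.
  elim: n => [|n IH].
    apply: ind_fam_sub ind_fam_terminal => i; rewrite (@front_eq _ xpred0) // => z.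
    by rewrite /Sn /corner /=; apply/negP => /andP[/and3P[_ _ ?] ?]; lia.
  pose Snm (m : nat) (z : Z2) :=
    Sn n z || [&& corner p z, lev z + n.+1%:Z == K & z.1 < p.1 + m%:Z].
  have H' m : ind_fam P (front (Snm m)) front_var front_law.
    elim: m => [|m IHm].
      apply: ind_fam_sub IH => i; rewrite (@front_eq _ (Sn n)) // => z.
      rewrite /Snm; case: (Sn n z) => //=; apply/negP => /and3P[/and3P[? _ _] _ ?]; lia.
    pose z0 : Z2 := (p.1 + m%:Z, K - n.+1%:Z - p.1 - m%:Z).
    have lz0 : lev z0 = K - n.+1%:Z by rewrite /lev /=; lia.
    have [pz0|pz0] := leP p.2 z0.2.
      apply: (ind_fam_flip (Snm m) _ z0) => //.
      - by rewrite lz0; lia.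
      - rewrite /Snm /Sn negb_or; apply/andP; split.
          by apply/negP => /andP[_]; rewrite lz0; lia.
        by apply/negP => /and3P[_ _] /=; lia.
      - rewrite /Snm /Sn /corner /= (_ : lev (rt z0) = K - n%:Z); last by rewrite /lev /=; lia.
        by move: pz0 => /=; lia.
      - rewrite /Snm /Sn /corner /= (_ : lev (up z0) = K - n%:Z); last by rewrite /lev /=; lia.
        by move: pz0 => /=; lia.
      move=> y; rewrite /Snm orbCA; congr (_ || _).
      apply/idP/idP.
        move=> /and3P[h1 h2 h3]; case: (ltP y.1 (p.1 + m%:Z)) => h4.
          by rewrite h1 h2 /= orbT.
        have -> : y == z0; last by [].
        by case: y h1 h2 h3 h4 => y1 y2; rewrite /lev xpair_eqE /= => *; lia.
      move=> /orP[/eqP ->|/and3P[-> -> h3]].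
        by rewrite lz0 /corner lz0 pz0 /=; lia.
      by rewrite /=; lia.
    (* The antidiagonal has left the quadrant: nothing is added. *)
    apply: ind_fam_sub IHm => i; rewrite (@front_eq _ (Snm m)) // => y.
    rewrite /Snm; congr (_ || _); apply/idP/idP.
      move=> /and3P[h1 h2 h3]; rewrite h1 h2 /=.
      by case/and3P: h1 h2 h3 => _; move: pz0; rewrite /lev /=; lia.
    by move=> /and3P[-> -> h3] /=; lia.
  pose m0 : nat := (absz (K - n.+1%:Z - p.1 - p.2)%R).+1.
  have Hn := H' m0; apply: ind_fam_sub Hn => i.
  rewrite (@front_eq _ (Snm m0)) // => z.
  rewrite /Snm /Sn /m0; case E: (corner p z) => //=.
  by move: E; rewrite /corner /lev => /and3P[? ? ?]; lia.
have Hn := H `|K - lev p|%N; apply: ind_fam_sub Hn => i.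
rewrite (@front_eq _ (Sn `|K - lev p|%N)) // => z.
rewrite /Sn; case E: (corner p z) => //=.
by move: E; rewrite /corner /lev => /and3P[? ? ?]; lia.
Qed.

End fronts.
Arguments front_var {d T R} Y a K i w.
Arguments front_law {R a} a0 a1 i.
Arguments measurable_incr {d T R Y} a mY t x.
Arguments measurable_front_var {d T R Y} a mY K i.
Arguments ind_fam_corner {d T R P Y a} a0 a1 mY Y_ind K p.

Definition exp_field d (T : measurableType d) (R : realType) (P : probability T R)
    (Y : Z2 -> T -> R) : Prop :=
  (forall x, measurable_fun setT (Y x)) /\
  ind_fam P xpredT Y (fun=> expo 1 ltr01).
Arguments exp_field {d T R} P Y.

(** The row to the right of [p] and the column above it bound the quadrant at [p] from below and
    from the left, so they lie on the front once the quadrant is absorbed. *)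
Lemma row_ind d (T : measurableType d) (R : realType) (Y : Z2 -> T -> R) (a : R) t (p : Z2) m :
  (m <= t)%N ->
  let K := lev p + t%:Z in
  let sI := [seq (1%N, ((p.1 + i%:Z, p.2) : Z2)) | i <- iota 0 m] in
  let sJ := [seq (2%N, ((p.1, p.2 + i%:Z) : Z2)) | i <- iota 0 m] in
  let A := front K (corner K p) in
  let X := front_var Y a K in
  [/\ uniq sI /\ uniq sJ, all A sI /\ all A sJ,
   forall w, psum X sI w = \sum_(i < m) (incr a (Y^~ w) (t - i) (p.1 + i%:Z, p.2)).1 &
   forall w, psum X sJ w = \sum_(i < m) (incr a (Y^~ w) (t - i) (p.1, p.2 + i%:Z)).2].
Proof.
move=> mt K sI sJ A X; split.
- by rewrite !map_inj_uniq ?iota_uniq // => i j [] ?; lia.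
- split; apply/allP => z /mapP[i]; rewrite mem_iota => /andP[_ im] ->;
    rewrite /A /front /corner /K /lev /=; lia.
- move=> w; rewrite /psum big_map -{1}[m]subn0 big_mkord.
  apply: eq_bigr => i _; rewrite /X /front_var /=; congr (incr _ _ _ _).1.
  by rewrite /K /lev /=; have := ltn_ord i; lia.
move=> w; rewrite /psum big_map -{1}[m]subn0 big_mkord.
apply: eq_bigr => i _; rewrite /X /front_var /=; congr (incr _ _ _ _).2.
by rewrite /K /lev /=; have := ltn_ord i; lia.
Qed.

(** * Laws and concentration of the Busemann increments *)

Section increment_laws.
Context d (T : measurableType d) (R : realType) (P : probability T R).
Context (Y : Z2 -> T -> R) (a : R) (a0 : 0 < a) (a1 : 0 < 1 - a).
Hypothesis Y_field : exp_field P Y.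

Let mY := Y_field.1.
Let Y_ind := Y_field.2.

Lemma incr_law t p B : measurable B ->
  P [set w | B (incr a (Y^~ w) t p).1] = expo (1 - a) a1 B /\
  P [set w | B (incr a (Y^~ w) t p).2] = expo a a0 B.
Proof.
move=> mB.
have ind := ind_fam_corner a0 a1 mY Y_ind (lev p + t%:Z) p.
have c (p' : Z2) : p' = dn p \/ p' = lf p -> corner (lev p + t%:Z) p p' = false.
  by rewrite /corner => -[] ->; rewrite /=; apply/negP => /and3P[]; lia.
have act : corner (lev p + t%:Z) p p || (lev p == lev p + t%:Z).
  by rewrite /corner !lexx /=; lia.
have tE : absz (lev p + t%:Z - lev p)%R = t by lia.
split.
  have := ind_fam_marginal (a := (1%N, p)) (C := B) ind.
  rewrite /front_var /front_law /front /= act c ?tE; first by apply.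
  by left.
have := ind_fam_marginal (a := (2%N, p)) (C := B) ind.
rewrite /front_var /front_law /front /= act c ?tE; first by apply.
by right.
Qed.

End increment_laws.
Arguments incr_law {d T R P Y a} a0 a1 Y_field t p B.

Section busemann_tails.
Context {R : realType}.
Implicit Types (a b : R).

Lemma incr_sum_tails a e : 0 < a -> 0 < 1 - a -> 0 < e ->
  exists2 rho : R, 0 < rho &
  forall d (T : measurableType d) (P : probability T R) Y t (p : Z2) m N,
  exp_field P Y -> (m <= t)%N -> (m <= N)%N ->
  let SI w := \sum_(i < m) (incr a (Y^~ w) (t - i) (p.1 + i%:Z, p.2)).1 in
  let SJ w := \sum_(i < m) (incr a (Y^~ w) (t - i) (p.1, p.2 + i%:Z)).2 in
  let r := (expR (- rho * N%:R))%:E in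
  [/\ (P [set w | (m%:R / (1 - a) + e * N%:R <= SI w)%R] <= r)%E,
      (P [set w | (SI w <= m%:R / (1 - a) - e * N%:R)%R] <= r)%E,
      (P [set w | (m%:R / a + e * N%:R <= SJ w)%R] <= r)%E &
      (P [set w | (SJ w <= m%:R / a - e * N%:R)%R] <= r)%E].
Proof.
move=> a0 a1 e0.
have [r1 r10 H1] := expo_sum_tails _ _ _ a1 e0.
have [r2 r20 H2] := expo_sum_tails _ _ _ a0 e0.
exists (Num.min r1 r2); first by rewrite lt_min r10.
move=> d T P Y t p m N YF mt mN SI SJ r.
have [/= [uI uJ] [aI aJ] sumI sumJ] := row_ind _ _ _ Y a t p m mt.
have ind := ind_fam_corner a0 a1 YF.1 YF.2 (lev p + t%:Z) p.
have mX := measurable_front_var a YF.1 (lev p + t%:Z).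
have le1 : ((expR (- r1 * N%:R))%:E <= r)%E.
  by rewrite lee_fin ler_expR !mulNr lerN2 ler_wpM2r // ge_min lexx.
have le2 : ((expR (- r2 * N%:R))%:E <= r)%E.
  by rewrite lee_fin ler_expR !mulNr lerN2 ler_wpM2r // ge_min lexx orbT.
have := H1 _ _ _ _ _ _ _ a1 _ N mX ind uI aI.
rewrite size_map size_iota => /(_ _ mN)[|h1 h2].
  by move=> i /mapP[j _ ->].
have := H2 _ _ _ _ _ _ _ a0 _ N mX ind uJ aJ.
rewrite size_map size_iota => /(_ _ mN)[|h3 h4].
  by move=> i /mapP[j _ ->].
have sumI' := funext sumI; have sumJ' := funext sumJ.
rewrite sumI' in h1 h2; rewrite sumJ' in h3 h4.
by split; [exact: le_trans le1|exact: le_trans le1|exact: le_trans le2|exact: le_trans le2].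
Qed.

Lemma measurable_isum d (T : measurableType d) (f : int -> T -> R) k :
  (forall p, measurable_fun setT (f p)) ->
  measurable_fun setT (fun w => isum (f^~ w) k).
Proof.
move=> mf; case: k => n /=; last apply: measurable_funN.
  by apply: measurable_sum.
by apply: measurable_sum.
Qed.

Lemma measurable_busemann d (T : measurableType d) (Y : Z2 -> T -> R) a t x :
  (forall x, measurable_fun setT (Y x)) ->
  measurable_fun setT (fun w => busemann a (Y^~ w) t x).
Proof.
move=> mY; elim: t x => [|t IH] x; last first.
  by apply: measurable_funD => //; exact: measurable_maxr.
apply: measurable_isum => p; apply: measurable_funB.
  exact: (measurable_incr _ mY _ _).2.
exact: (measurable_incr _ mY _ _).1.
Qed.

(** The mean decrement of [busemann a] over [m] steps to the right and [n] steps up. *)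
Definition drift a (m n : nat) : R := m%:R / (1 - a) + n%:R / a.

(** The failure, at one endpoint, of the inequality that [reroutes] demands. *)
Definition overtakes a b w t (x : Z2) (m n : nat) : Prop :=
  busemann b w t x - busemann b w (t - (m + n)) (x.1 + m%:Z, x.2 + n%:Z) <=
  busemann a w t x - busemann a w (t - (m + n)) (x.1 + m%:Z, x.2 + n%:Z).

Lemma measurable_overtakes d (T : measurableType d) (Y : Z2 -> T -> R) a b t x m n :
  (forall x, measurable_fun setT (Y x)) ->
  measurable [set w | overtakes a b (Y^~ w) t x m n].
Proof.
by move=> mY; apply: measurable_le_set; apply: measurable_funB;
  exact: measurable_busemann.
Qed.

Lemma overtakes_tail a b c : 0 < a -> 0 < 1 - a -> 0 < b -> 0 < 1 - b -> 0 < c ->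
  exists2 rho : R, 0 < rho &
  forall d (T : measurableType d) (P : probability T R) Y t x m n,
  exp_field P Y -> (m + n <= t)%N ->
  c * (m + n)%:R <= drift b m n - drift a m n ->
  (P [set w | overtakes a b (Y^~ w) t x m n] <=
   (4 * expR (- rho * (m + n)%:R))%:E)%E.
Proof.
move=> a0 a1 b0 b1 c0.
(* Two sums for each parameter: four deviations below [c / 4] cannot close a gap of [c]. *)
have e0 : 0 < c / 4 by rewrite divr_gt0.
have [ra ra0 Ha] := incr_sum_tails _ _ a0 a1 e0.
have [rb rb0 Hb] := incr_sum_tails _ _ b0 b1 e0.
exists (Num.min ra rb); first by rewrite lt_min ra0.
move=> d T P Y t x m n YF mnt cN.
set N := (m + n)%N in cN *.
have mN : (m <= N)%N by rewrite leq_addr.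
have nN : (n <= N)%N by rewrite leq_addl.
have mt : (m <= t)%N by exact: leq_trans mnt.
have nt : (n <= t - m)%N by rewrite leq_subRL ?(leq_trans _ mnt).
pose r := (expR (- Num.min ra rb * N%:R))%:E.
have le1 : ((expR (- ra * N%:R))%:E <= r)%E.
  by rewrite lee_fin ler_expR !mulNr lerN2 ler_wpM2r // ge_min lexx.
have le2 : ((expR (- rb * N%:R))%:E <= r)%E.
  by rewrite lee_fin ler_expR !mulNr lerN2 ler_wpM2r // ge_min lexx orbT.
have [/= A1 _ _ _] := Ha _ _ _ _ _ x _ _ YF mt mN.
have [/= _ _ A2 _] := Ha _ _ _ _ _ (x.1 + m%:Z, x.2) _ _ YF nt nN.
have [/= _ B1 _ _] := Hb _ _ _ _ _ x _ _ YF mt mN.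
have [/= _ _ _ B2] := Hb _ _ _ _ _ (x.1 + m%:Z, x.2) _ _ YF nt nN.
have mI s q k (u : R) : measurable_fun setT
    (fun w => \sum_(i < k) (incr u (Y^~ w) (s - i) (q.1 + i%:Z, q.2)).1).
  by apply: measurable_sum => i; exact: (measurable_incr _ YF.1 _ _).1.
have mJ s q k (u : R) : measurable_fun setT
    (fun w => \sum_(i < k) (incr u (Y^~ w) (s - i) (q.1, q.2 + i%:Z)).2).
  by apply: measurable_sum => i; exact: (measurable_incr _ YF.1 _ _).2.
set EA1 := [set w | _] in A1; set EA2 := [set w | _] in A2.
set EB1 := [set w | _] in B1; set EB2 := [set w | _] in B2.
have mEA1 : measurable EA1 by apply: measurable_le_set => //; exact: mI.
have mEA2 : measurable EA2 by apply: measurable_le_set => //; exact: (mJ _ (x.1 + m%:Z, x.2)).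
have mEB1 : measurable EB1 by apply: measurable_le_set => //; exact: mI.
have mEB2 : measurable EB2 by apply: measurable_le_set => //; exact: (mJ _ (x.1 + m%:Z, x.2)).
apply: (@le_trans _ _ (P ((EA1 `|` EA2) `|` (EB1 `|` EB2)))).
  apply: le_measure; rewrite ?inE.
  - exact: measurable_overtakes YF.1.
  - by apply: measurableU; exact: measurableU.
  move=> w /=; rewrite /overtakes !busemann_path_sum //.
  apply: contraPP => /not_orP[/not_orP[/negP h1 /negP h2] /not_orP[/negP h3 /negP h4]].
  rewrite -!ltNge in h1 h2 h3 h4; apply/negP; rewrite -ltNge.
  move: cN h1 h2 h3 h4; rewrite /drift /=; lra.
have -> : (4 * expR (- Num.min ra rb * N%:R))%:E = ((r + r) + (r + r))%E.
  by rewrite /r -!EFinD; congr EFin; ring.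
apply: (le_trans (measureU2 _ _ _)); [exact: measurableU|exact: measurableU|].
apply: leeD; apply: (le_trans (measureU2 _ _ _)) => //; apply: leeD.
- exact: le_trans le1.
- exact: le_trans le1.
- exact: le_trans le2.
- exact: le_trans le2.
Qed.

End busemann_tails.

(** * Closeness of the increments for nearby parameters *)

Section coupling.
Context d (T : measurableType d) (R : realType) (P : probability T R).
Local Open Scope ereal_scope.

Lemma integral_law (U : T -> R) (mu : probability (measurableTypeR R) R) (f : R -> \bar R) :
  measurable_fun setT U -> (forall B, measurable B -> P (U @^-1` B) = mu B) ->
  measurable_fun setT f -> (forall x, 0 <= f x) ->
  \int[P]_w f (U w) = \int[mu]_x f x.
Proof.
move=> mU lawU mf f0.
have mU' : measurable_fun setT (U : T -> measurableTypeR R) by exact: mU.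
have E := ge0_integral_pushforward mU' P measurableT mf (fun p _ => f0 p).
rewrite preimage_setT in E.
transitivity (\int[image_measure _ _ T (measurableTypeR R) R P U mU']_x f x); first exact: esym E.
apply: (@eq_measure_integral _ _ _ setT mu (image_measure _ _ T (measurableTypeR R) R P U mU')).
by move=> B mB _; exact: lawU.
Qed.

(** Because [U <= V], the marginals alone control the gap. The mean of [expR (- U) - expR (- V)] is
    a difference of Laplace transforms at 1, and the integrand is at least
    [expR (- M) * (1 - expR (- kap))] where [U <= M] and the gap reaches [kap]. The first term of
    the bound is the probability that [U] exceeds [M]. *)
Lemma expo_coupling (U V : T -> R) (u v M kap : R) u0 v0 (N0 : set T) :
  measurable_fun setT U -> measurable_fun setT V ->
  (forall B, measurable B -> P (U @^-1` B) = expo u u0 B) ->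
  (forall B, measurable B -> P (V @^-1` B) = expo v v0 B) ->
  P.-negligible N0 -> (forall w, ~ N0 w -> (U w <= V w)%R) ->
  (0 < kap)%R -> (0 <= M)%R ->
  P [set w | (kap <= V w - U w)%R] <=
  (expR (- u * M) + (u / (u + 1) - v / (v + 1)) / (expR (- M) * (1 - expR (- kap))))%:E.
Proof.
move=> mU mV lawU lawV N0neg UV kap0 M0.
set c : R := (expR (- M) * (1 - expR (- kap)))%R.
have c0 : (0 < c)%R.
  by rewrite mulr_gt0 ?expR_gt0 // subr_gt0 -expR0 ltr_expR oppr_lt0.
pose D1 := [set w | (kap <= V w - U w)%R].
pose D2 := [set w | (U w <= M)%R].
have mD1 : measurable D1 by apply: measurable_le_set => //; exact: measurable_funB.
have mD2 : measurable D2 by exact: measurable_le_set.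
have mD : measurable (D1 `&` D2) by exact: measurableI.
have e0 (x : R) : 0 <= (expR (-1 * x))%:E by rewrite lee_fin expR_ge0.
have me : measurable_fun setT (fun x : R => (expR (-1 * x))%:E) by exact: measurable_expR_mul.
have intU : \int[P]_w (expR (-1 * U w))%:E = (u / (u + 1))%:E.
  apply: etrans (integral_law U _ _ mU lawU me e0) _.
  by rewrite expo_mgf ?opprK // (lt_trans _ u0) // oppr_lt0.
have intV : \int[P]_w (expR (-1 * V w))%:E = (v / (v + 1))%:E.
  apply: etrans (integral_law V _ _ mV lawV me e0) _.
  by rewrite expo_mgf ?opprK // (lt_trans _ v0) // oppr_lt0.
have le1 : (v / (v + 1))%:E + c%:E * P (D1 `&` D2) <= (u / (u + 1))%:E.
  rewrite -intU -intV.
  have mI : measurable_fun setT (fun w => c%:E * (\1_(D1 `&` D2) w)%:E).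
    by apply: emeasurable_funM => //; apply/measurable_EFinP; exact: measurable_indic.
  have I0 w : 0 <= c%:E * (\1_(D1 `&` D2) w)%:E by rewrite mule_ge0 ?lee_fin // ltW.
  have mV' : measurable_fun setT (fun w => (expR (-1 * V w))%:E) by exact: (measurableT_comp me).
  have mU' : measurable_fun setT (fun w => (expR (-1 * U w))%:E) by exact: (measurableT_comp me).
  have -> : c%:E * P (D1 `&` D2) = \int[P]_w (c%:E * (\1_(D1 `&` D2) w)%:E).
    rewrite ge0_integralZl ?lee_fin ?(ltW c0) //; last first.
      by apply/measurable_EFinP; exact: measurable_indic.
    by rewrite integral_indic // setIT.
  rewrite -ge0_integralD //.
  apply: ae_ge0_le_integral => //.
  - by move=> w _; rewrite adde_ge0.
  - exact: emeasurable_funD.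
  apply: negligibleS N0neg => w /=.
  apply: contra_notP => /UV h _; rewrite -EFinM -EFinD lee_fin indicE.
  have [|_] := boolP (w \in D1 `&` D2); last by rewrite mulr0 addr0 ler_expR; lra.
  rewrite inE => -[h1 h2]; rewrite mulr1.
  have {}h1 : (kap <= V w - U w)%R := h1; have {}h2 : (U w <= M)%R := h2.
  have -> : expR (-1 * V w) = (expR (-1 * U w) * expR (- (V w - U w)))%R.
    by rewrite -expRD; congr expR; ring.
  have k1 : (expR (- (V w - U w)) <= expR (- kap))%R by rewrite ler_expR lerN2.
  have k2 : (expR (- M) <= expR (-1 * U w))%R by rewrite ler_expR mulN1r lerN2.
  have k3 : (0 < 1 - expR (- kap))%R by rewrite subr_gt0 -expR0 ltr_expR oppr_lt0.
  have k4 := ler_wpM2r (ltW k3) k2.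
  have k5 := ler_wpM2l (expR_ge0 (-1 * U w)) k1.
  rewrite /c; lra.
have le2 : P (D1 `&` D2) <= ((u / (u + 1) - v / (v + 1)) / c)%:E.
  have fP : P (D1 `&` D2) \is a fin_num by exact: fin_num_measure.
  rewrite -(fineK fP) lee_fin ler_pdivlMr //.
  by move: le1; rewrite -(fineK fP) -EFinM -EFinD lee_fin; lra.
apply: (@le_trans _ _ (P (U @^-1` `]M, +oo[%classic `|` (D1 `&` D2)))).
  apply: le_measure; rewrite ?inE //.
    by apply: measurableU => //; apply: measurable_preim => //; exact: measurable_itv.
  move=> w h; case: (leP (U w) M) => h'; [right|left] => //=.
  by rewrite in_itv /= andbT.
apply: (le_trans (measureU2 _ _ _)) => //.
  by apply: measurable_preim => //; exact: measurable_itv.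
rewrite EFinD; apply: leeD => //.
have E1 := lawU _ (measurable_itv `]M, +oo[); rewrite expo_tail max_l // in E1.
by rewrite le_eqVlt; apply/orP; left; apply/eqP.
Qed.

End coupling.

Section incr_close.
Context {R : realType}.

Lemma exp_field_ge0 d (T : measurableType d) (P : probability T R) (Y : Z2 -> T -> R) :
  exp_field P Y -> P.-negligible [set w | exists x, Y x w < 0].
Proof.
move=> [mY Yind].
pose F (n : nat) := if unpickle n is Some x then [set w | Y x w < 0] else set0.
have sub : [set w | exists x, Y x w < 0] `<=` \bigcup_n F n.
  move=> w [x Yx]; exists (pickle x); first exact: Logic.I.
  rewrite /F pickleK; exact: Yx.
apply: (negligibleS sub).
apply: negligible_bigcup => n; rewrite /F.
case: unpickle => [x|]; last exact: negligible_set0.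
have mx : measurable [set w | Y x w < 0] by exact: measurable_lt_set.
apply/negligibleP => //.
have := ind_fam_marginal (a := x) (C := `]-oo, 0[%classic) Yind isT (measurable_itv _).
by rewrite (expo_lt0 1 ltr01) => E; rewrite -[RHS]E; congr (P _).
Qed.

Lemma le_expRN (x : R) : 0 < x -> expR (- x) <= x^-1.
Proof.
move=> x0; rewrite expRN lef_pV2 ?posrE ?expR_gt0 //.
by apply: le_trans (expR_ge1Dx x); rewrite lerDr.
Qed.

Lemma expo_coupling_close (e0 kap eta : R) : 0 < e0 -> 0 < kap -> 0 < eta ->
  exists2 eps : R, 0 < eps &
  forall d (T : measurableType d) (P : probability T R) (U V : T -> R)
    (u v : R) u0 v0 (N0 : set T),
  measurable_fun setT U -> measurable_fun setT V ->
  (forall B, measurable B -> P (U @^-1` B) = expo u u0 B) ->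
  (forall B, measurable B -> P (V @^-1` B) = expo v v0 B) ->
  P.-negligible N0 -> (forall w, ~ N0 w -> U w <= V w) ->
  e0 <= u -> v <= u -> u - v <= eps ->
  (P [set w | (kap <= `|V w - U w|)%R] <= eta%:E)%E.
Proof.
(* By [expR (- x) <= x^-1], this [M] brings [expR (- u * M)] below [eta / 2] for every rate
   [u >= e0]. *)
move=> e00 kap0 eta0; pose M := 2 / (eta * e0).
have M0 : 0 < M by rewrite divr_gt0 // mulr_gt0.
have c0 : 0 < expR (- M) * (1 - expR (- kap)).
  by rewrite mulr_gt0 ?expR_gt0 // subr_gt0 -expR0 ltr_expR oppr_lt0.
exists (expR (- M) * (1 - expR (- kap)) * (eta / 2)).
  by rewrite mulr_gt0 // divr_gt0.
move=> d T P U V u v u0 v0 N0 mU mV lawU lawV N0neg UV e0u vu uv.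
have H := expo_coupling _ _ _ P U V u v M kap u0 v0 N0 mU mV lawU lawV N0neg UV kap0 (ltW M0).
case: N0neg => [N1 [mN1 PN1 N01]].
have mVU : measurable_fun setT (fun w => V w - U w) by exact: measurable_funB.
apply: (@le_trans _ _ (P (N1 `|` [set w | (kap <= V w - U w)%R]))).
  apply: le_measure; rewrite ?inE.
  - by apply: measurable_le_set => //; exact: measurableT_comp.
  - by apply: measurableU => //; exact: measurable_le_set.
  move=> w /= h; have [N0w|/UV UVw] := pselect (N0 w); [left; exact: N01|right].
  by move: h; rewrite ger0_norm // subr_ge0.
apply: (le_trans (measureU2 _ _ _)) => //; first exact: measurable_le_set.
rewrite [X in (X + _)%E](_ : _ = 0%E); last exact: PN1.
rewrite add0e; apply: (le_trans H); rewrite lee_fin.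
have h1 : expR (- u * M) <= eta / 2.
  have uM : 0 < u * M by rewrite mulr_gt0.
  rewrite mulNr; apply: (le_trans (le_expRN _ uM)).
  rewrite -[leRHS]invrK lef_pV2 ?posrE ?invr_gt0 ?divr_gt0 //.
  rewrite invf_div /M.
  apply: le_trans (_ : e0 * (2 / (eta * e0)) <= _); last by apply: ler_wpM2r => //; exact: ltW.
  by rewrite le_eqVlt; apply/orP; left; apply/eqP; field; rewrite ?gt_eqF.
have h2 : u / (u + 1) - v / (v + 1) <= u - v.
  have E : u / (u + 1) - v / (v + 1) = (u - v) / ((u + 1) * (v + 1)).
    by field; rewrite ?gt_eqF //; lra.
  rewrite E ler_pdivrMr; last by rewrite mulr_gt0 //; lra.
  rewrite -[leLHS]mulr1; apply: ler_wpM2l; first lra.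
  by have := mulr_gt0 u0 v0; lra.
have h3 : (u / (u + 1) - v / (v + 1)) / (expR (- M) * (1 - expR (- kap))) <= eta / 2.
  by rewrite ler_pdivrMr //; apply: le_trans h2 _; rewrite mulrC.
lra.
Qed.

(** Raising the parameter raises the first increment and lowers the second; the four cases differ
    only in which variable plays the smaller one in the coupling. *)
Lemma incr_close (a kap eta : R) : 0 < a -> 0 < 1 - a -> 0 < kap -> 0 < eta ->
  exists2 eps : R, 0 < eps & forall b, `|b - a| <= eps ->
  [/\ 0 < b, 0 < 1 - b &
   forall d (T : measurableType d) (P : probability T R) Y t x, exp_field P Y ->
   (P [set w | (kap <= `|(incr b (Y^~ w) t x).1 - (incr a (Y^~ w) t x).1|)%R] <= eta%:E)%E /\
   (P [set w | (kap <= `|(incr b (Y^~ w) t x).2 - (incr a (Y^~ w) t x).2|)%R] <= eta%:E)%E].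
Proof.
move=> a0 a1 kap0 eta0.
(* If [b] is within [e0] of [a], then [a], [1 - a], [b] and [1 - b] are all at least [e0]. *)
pose e0 := Num.min a (1 - a) / 2.
have e00 : 0 < e0 by rewrite divr_gt0 // lt_min a0.
have e0a : e0 <= a / 2 by rewrite ler_pM2r ?invr_gt0 // ge_min lexx.
have e0a1 : e0 <= (1 - a) / 2 by rewrite ler_pM2r ?invr_gt0 // ge_min lexx orbT.
have [e1 e10 H] := expo_coupling_close _ _ _ e00 kap0 eta0.
exists (Num.min e0 e1); first by rewrite lt_min e00.
move=> b; rewrite le_min => /andP[be0 be1].
move: (be0) (be1); rewrite !ler_norml => /andP[b1 b2] /andP[b3 b4].
have b0 : 0 < b by lra.
have b10 : 0 < 1 - b by lra.
split => // d T P Y t x YF.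
have [mIa mJa] := measurable_incr a YF.1 t x.
have [mIb mJb] := measurable_incr b YF.1 t x.
have neg := exp_field_ge0 _ _ P Y YF.
have lawa B (mB : measurable B) := incr_law a0 a1 YF t x B mB.
have lawb B (mB : measurable B) := incr_law b0 b10 YF t x B mB.
have pos w : ~ (exists x, Y x w < 0) -> forall y, 0 <= Y y w.
  by move=> h y; rewrite leNgt; apply/negP => hy; apply: h; exists y.
have [ab|ba] := leP a b; split.
- apply: (H _ _ _ _ _ _ _ a1 b10 _ mIa mIb _ _ neg) => //; try lra.
  + by move=> B mB; exact: (lawa _ mB).1.
  + by move=> B mB; exact: (lawb _ mB).1.
  + by move=> w /pos h; apply: (incr_mono _ _ _ _ _ a0 ab _ h).1; lra.
- under eq_set do rewrite distrC.
  apply: (H _ _ _ _ _ _ _ b0 a0 _ mJb mJa _ _ neg) => //; try lra.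
  + by move=> B mB; exact: (lawb _ mB).2.
  + by move=> B mB; exact: (lawa _ mB).2.
  + by move=> w /pos h; apply: (incr_mono _ _ _ _ _ a0 ab _ h).2; lra.
- under eq_set do rewrite distrC.
  apply: (H _ _ _ _ _ _ _ b10 a1 _ mIb mIa _ _ neg) => //; try lra.
  + by move=> B mB; exact: (lawb _ mB).1.
  + by move=> B mB; exact: (lawa _ mB).1.
  + by move=> w /pos h; apply: (incr_mono _ _ _ _ _ b0 (ltW ba) _ h).1; lra.
- apply: (H _ _ _ _ _ _ _ a0 b0 _ mJa mJb _ _ neg) => //; try lra.
  + by move=> B mB; exact: (lawa _ mB).2.
  + by move=> B mB; exact: (lawb _ mB).2.
  + by move=> w /pos h; apply: (incr_mono _ _ _ _ _ b0 (ltW ba) _ h).2; lra.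
Qed.

End incr_close.

(** * Near ties: isolating a single weight *)

Lemma busemann_ext (R : realType) (a : R) (w w' : Z2 -> R) t z :
  (forall y, lev z <= lev y -> w y = w' y) -> busemann a w t z = busemann a w' t z.
Proof.
elim: t z => [|t IH] z ww'; last first.
  rewrite !busemann_max ww' // !IH // => y zy; apply: ww'; move: zy;
    by rewrite /lev /=; lia.
have E p : (incr a w 0 (p + 1, z.1 + z.2 - p - 1)).2 - (incr a w 0 (p, z.1 + z.2 - p)).1 =
    (incr a w' 0 (p + 1, z.1 + z.2 - p - 1)).2 - (incr a w' 0 (p, z.1 + z.2 - p)).1.
  by rewrite /= !ww' //; rewrite /lev /=; lia.
by rewrite /busemann; congr (isum _ _); apply/funext => p; exact: E.
Qed.

Section near_tie.
Context d (T : measurableType d) (R : realType) (P : probability T R).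
Context (Y : Z2 -> T -> R) (Y_field : exp_field P Y) (x : Z2).

(** A pi-system generating the sigma-algebra of all weights except the one at [x]. *)
Definition off_site : set (set T) :=
  [set E | exists (s : seq Z2) (B : Z2 -> set R), [/\ x \notin s,
     forall y, measurable (B y) & E = cylinder Y s B]].

Lemma cylinderE s (B : Z2 -> set R) :
  cylinder Y s B = [set w | forall y, y \in s -> B y (Y y w)].
Proof.
rewrite /cylinder -bigcap_seq; apply/seteqP; split => w /=.
  by move=> h y ys; exact: h.
by move=> h y ys; exact: h.
Qed.

Lemma off_siteI : setI_closed off_site.
Proof.
move=> _ _ [s [B [xs mB ->]]] [s' [B' [xs' mB' ->]]].
exists (s ++ s'), (fun y => (if y \in s then B y else setT) `&`
                           (if y \in s' then B' y else setT)); split.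
- by rewrite mem_cat negb_or xs.
- by move=> y; apply: measurableI; case: ifP.
rewrite !cylinderE; apply/seteqP; split => w /=.
  move=> [h h'] y _; split; case: ifP => // ys; [exact: h|exact: h'].
move=> h; split => y ys; have := h y; rewrite mem_cat ys ?orbT => /(_ isT) [];
  by rewrite ?ys.
Qed.

Lemma off_site_indep A E : measurable A -> <<s off_site >> E ->
  P (Y x @^-1` A `&` E) = (expo 1 ltr01 A * P E)%E.
Proof.
move=> mA sE.
have mYA : measurable (Y x @^-1` A) by apply: measurable_preim => //; exact: Y_field.1.
have PA : P (Y x @^-1` A) = expo 1 ltr01 A.
  by apply: (ind_fam_marginal Y_field.2).
have mG E' : off_site E' -> measurable E'.
  by move=> [s [B [_ mB ->]]]; apply: measurable_cylinder => // y; exact: Y_field.1.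
have PE : P (Y x @^-1` A) = (fine (P (Y x @^-1` A)))%:E by rewrite fineK // fin_num_measure.
have c0 : 0 <= fine (P (Y x @^-1` A)) by rewrite fine_ge0.
pose c := NngNum c0.
transitivity (mrestr P mYA E); first by rewrite /mrestr setIC.
transitivity (mscale c P E); last by rewrite /mscale /= -PE PA.
have GT : off_site setT.
  by exists [::], (fun=> setT); split => //; rewrite /cylinder big_nil.
have cover : \bigcup_(k : nat) [set: T] = setT by rewrite bigcup_const //; exists 0%N.
apply: (@g_sigma_algebra_measure_unique _ R T off_site mG (fun=> setT) (fun=> GT)
  cover (mrestr P mYA) (mscale c P) off_siteI _ _ E sE).
- move=> _ [s [B [xs mB ->]]].
  have -> : cylinder Y s B = cylinder Y (undup s) B.
    rewrite !cylinderE; apply/seteqP; split => w /= h y.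
      by rewrite mem_undup; exact: h.
    by move=> ys; apply: h; rewrite mem_undup.
  transitivity (P (Y x @^-1` A `&` cylinder Y (undup s) B)).
    by rewrite /= /mrestr setIC.
  transitivity (expo 1 ltr01 A * P (cylinder Y (undup s) B))%E.
    apply: (ind_fam_cons Y_field.2) => //.
      by rewrite /= mem_undup xs undup_uniq.
    exact: all_predT.
  by rewrite -PA PE.
- by move=> k; rewrite /= /mrestr setTI PE ltry.
Qed.

Notation T' := (g_sigma_algebraType off_site).

Lemma measurable_off_site y : y != x -> measurable_fun [set: T'] (Y y : T' -> R).
Proof.
move=> yx _ B mB; rewrite setTI; apply: sub_sigma_algebra.
exists [:: y], (fun=> B); split => //; first by rewrite inE eq_sym.
by rewrite /cylinder big_seq1.
Qed.

(** Given the other weights, the one at [x] has to fall into an interval of length [2 * rho], and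
    its density is at most 1. *)
Lemma near_tie (Z : T -> R) rho : 0 <= rho ->
  measurable_fun setT Z -> measurable_fun [set: T'] (Z : T' -> R) ->
  (P [set w | (`|Y x w + Z w| <= rho)%R] <= (2 * rho)%:E)%E.
Proof.
move=> rho0 mZ mZ'.
have mYx : measurable_fun setT (Y x : T -> measurableTypeR R) by exact: Y_field.1.
have mZ2 : measurable_fun setT (Z : T -> measurableTypeR R) by exact: mZ.
pose S := [set p : measurableTypeR R * measurableTypeR R | (`|p.1 + p.2| <= rho)%R].
have mS : measurable S.
  have m1 : measurable_fun setT (fun w : measurableTypeR R * measurableTypeR R => w.1 : R).
    exact: measurable_fst.
  have m2 : measurable_fun setT (fun w : measurableTypeR R * measurableTypeR R => w.2 : R).
    exact: measurable_snd.
  apply: measurable_le_set => //; apply: measurableT_comp => //.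
  exact: measurable_funD.
have J := @joint_law _ T R P _ _ _ _ (Y x : T -> measurableTypeR R)
  (Z : T -> measurableTypeR R) (expo 1 ltr01) (law P mZ) setT mYx mZ2 measurableT.
have {}J : P ((fun w => (Y x w, Z w)) @^-1` S) = (expo 1 ltr01 \x law P mZ)%E S.
  have := J _ _ mS; rewrite setIT probability_setT mule1; apply.
  move=> A B mA mB; rewrite setIT mule1.
  have sB : <<s off_site >> (Z @^-1` B).
    by have := mZ' measurableT B mB; rewrite setTI.
  exact: off_site_indep.
apply: (@le_trans _ _ ((expo 1 ltr01 \x law P mZ)%E S)).
  by rewrite -J.
rewrite product_measure_ysection //.
apply: (@le_trans _ _ (\int[law P mZ]_y (cst (2 * rho)%:E y))%E); last first.
  rewrite integral_cst // -[leRHS]mule1; apply: lee_wpmul2l.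
    by rewrite lee_fin; lra.
  exact: probability_le1.
apply: ge0_le_integral => //.
  exact: measurable_fun_ysection.
move=> y _; apply: le_trans (_ : expo 1 ltr01 `[(- rho - y)%R, (rho - y)%R]%classic <= _)%E.
  apply: le_measure; rewrite ?inE; first exact: measurable_ysection.
    exact: measurable_itv.
  move=> v; rewrite /ysection /= inE /S /= ler_norml in_itv /=.
  by move=> /andP[? ?]; apply/andP; split; lra.
apply: (le_trans (expo_itv_le _ ltr01 _ _ _ _)) => //; first lra.
by rewrite lee_fin; lra.
Qed.

End near_tie.

(** * Drift gap between two parameters near a direction *)

Section cone.
Context {R : realType}.

(* [drift b m n - drift a m n] vanishes to second order in [b - a] along
   [xi a], so it is positive on the side of [xi a] facing away from [xi b]. *)
Lemma cone_drift (a b : R) : 0 < a -> 0 < 1 - a -> 0 < b -> 0 < 1 - b -> b != a ->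
  exists delta c : R, [/\ 0 < delta, 0 < c & forall L : nat, exists M : nat,
  forall (N m n : nat) (k v1 : int), (M <= N)%N -> (m + n)%N = N -> `|k| <= L%:Z ->
  `|v1%:~R - (xi a).1 * N%:R| <= delta * N%:R ->
  (if a < b then v1 < k + m%:Z else k + m%:Z < v1) ->
  c * N%:R <= drift b m n - drift a m n].
Proof.
move=> a0 a1 b0 b1 ba.
pose p := (xi a).1; pose s := (1 - a) ^+ 2 + a ^+ 2.
pose A := ((1 - b) * (1 - a))^-1; pose B := (a * b)^-1; pose q := b - a.
have s0 : 0 < s by rewrite ltr_wpDl ?sqr_ge0 // exprn_gt0.
have A0 : 0 < A by rewrite invr_gt0 mulr_gt0.
have B0 : 0 < B by rewrite invr_gt0 mulr_gt0.
have q0 : q != 0 by rewrite subr_eq0.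
have aq0 : 0 < `|q| by rewrite normr_gt0.
(* [2 * c] is the drift gap per step along [xi a]. One [c] is kept; the other pays for an abscissa
   off by at most [2 * delta * N] on the unfavourable side, half of it due to the cone and half to
   [|k| <= L]. *)
pose c := q ^+ 2 / (s * b * (1 - b)) / 2.
have c0 : 0 < c.
  have q20 : 0 < q ^+ 2 by rewrite exprn_even_gt0.
  by rewrite divr_gt0 // divr_gt0 // !mulr_gt0.
pose delta := c / (`|q| * 2 * (A + B)).
have AB0 : 0 < A + B by rewrite addr_gt0.
have delta0 : 0 < delta by rewrite divr_gt0 // !mulr_gt0.
exists delta, c; split => // L; exists (Num.truncn (L%:R / delta)).+1.
move=> N m n k v1 MN mnN kL v1p side.
have LN : L%:R <= delta * N%:R.
  rewrite mulrC -ler_pdivrMr //; apply/ltW/(lt_le_trans (truncnS_gt _)).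
  by rewrite ler_nat.
have kL' : `|k%:~R| <= L%:R :> R by rewrite -intr_norm -(ler_int R) in kL *.
pose mu := m%:R - p * N%:R.
have nE : n%:R = N%:R - m%:R :> R by rewrite -mnN natrD; lra.
have E1 : drift b m n - drift a m n = q * (m%:R * A - n%:R * B).
  rewrite /drift /A /B /q; field; by rewrite !gt_eqF.
have E2 : q * (p * A - (1 - p) * B) = 2 * c.
  rewrite /p /c /A /B /xi /= -/s.
  have -> : 1 - (1 - a) ^+ 2 / s = a ^+ 2 / s.
    by apply/eqP; rewrite subr_eq -mulrDl addrC divff // gt_eqF.
  by rewrite /q; field; rewrite !gt_eqF.
have qmu : - (`|q| * (2 * delta * N%:R)) <= q * mu.
  move: v1p kL'; rewrite !ler_norml => /andP[v1a v1b] /andP[ka kb].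
  move: side; have [ab|ab] := ltP a b.
    rewrite -(ltr_int R) rmorphD /= => side.
    have qp : 0 < q by rewrite subr_gt0.
    rewrite gtr0_norm // -mulrN; apply: ler_wpM2l; first exact: ltW.
    rewrite /mu /p; lra.
  rewrite -(ltr_int R) rmorphD /= => side.
  have qn : q < 0 by rewrite subr_lt0 lt_neqAle ba.
  rewrite ltr0_norm // mulNr opprK; apply: ler_wnM2l; first exact: ltW.
  rewrite /mu /p; lra.
have E3 : `|q| * (2 * delta * N%:R) * (A + B) = c * N%:R.
  by rewrite /delta; field; rewrite !gt_eqF.
have := ler_wpM2r (ltW AB0) qmu.
rewrite E1 nE mulNr E3.
have -> : q * (m%:R * A - (N%:R - m%:R) * B) =
    N%:R * (q * (p * A - (1 - p) * B)) + q * mu * (A + B) by rewrite /mu; ring.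
rewrite E2; lra.
Qed.

End cone.

(** * Excluding all remote endpoints at once *)

Section overtaken.
Context {R : realType}.

Lemma measure_bigsetU_le d (T : measurableType d) (P : probability T R) (I : Type)
    (s : seq I) (F : I -> set T) (r : I -> R) :
  (forall i, measurable (F i)) -> (forall i, (P (F i) <= (r i)%:E)%E) ->
  (P (\big[setU/set0]_(i <- s) F i) <= (\sum_(i <- s) r i)%:E)%E.
Proof.
move=> mF Fr; elim: s => [|i s IH]; first by rewrite !big_nil measure0.
rewrite !big_cons EFinD.
apply: (@le_trans _ _ (P (F i) + P (\big[setU/set0]_(j <- s) F j))%E).
  by apply: measureU2; [exact: mF|exact: bigsetU_measurable].
apply: leeD; [exact: Fr|exact: IH].
Qed.

Lemma geometric_sum_le (r : R) n : 0 < r < 1 -> \sum_(i < n) r ^+ i <= (1 - r)^-1.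
Proof.
move=> /andP[r0 r1].
have E : (\sum_(i < n) r ^+ i) * (1 - r) = 1 - r ^+ n.
  elim: n => [|n IH]; first by rewrite big_ord0 mul0r expr0 subrr.
  by rewrite big_ord_recr /= mulrDl IH exprS; ring.
rewrite -[leRHS]mul1r ler_pdivlMr; last by lra.
by rewrite E; have := exprn_gt0 n r0; lra.
Qed.

(** A single event for all endpoints at distance between [M] and [K] that have the drift gap, so
    that random ones can be inserted later. *)
Definition overtaken (a b c : R) (M K : nat) (k : int) (w : Z2 -> R) : Prop :=
  exists m n, [/\ (m + n <= K)%N, (M <= m + n)%N,
    c * (m + n)%:R <= drift b m n - drift a m n & overtakes a b w K (diag k) m n].

(** Half of the decay rate makes the sum over [m] and [n] converge, uniformly in [K]; the other half
    makes it small through [M]. *)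
Lemma overtaken_rare (a b c eta : R) : 0 < a -> 0 < 1 - a -> 0 < b -> 0 < 1 - b ->
  0 < c -> 0 < eta -> exists M : nat,
  forall d (T : measurableType d) (P : probability T R) Y K k, exp_field P Y ->
  measurable [set w | overtaken a b c M K k (Y^~ w)] /\
  (P [set w | overtaken a b c M K k (Y^~ w)] <= eta%:E)%E.
Proof.
move=> a0 a1 b0 b1 c0 eta0.
have [rho rho0 H] := overtakes_tail _ _ _ a0 a1 b0 b1 c0.
pose r := expR (- (rho / 2)).
have r01 : 0 < r < 1.
  by rewrite expR_gt0 -expR0 ltr_expR oppr_lt0 divr_gt0.
have r10 : 0 < 1 - r by case/andP: r01 => ? ?; lra.
pose x := 4 * ((1 - r)^-1 * (1 - r)^-1) / eta.
have x0 : 0 < x by rewrite divr_gt0 // !mulr_gt0 ?invr_gt0.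
exists (Num.truncn (2 * x / rho)).+1; set M := (Num.truncn _).+1.
move=> d T P Y K k YF.
have small : 4 * expR (- (rho / 2) * M%:R) * ((1 - r)^-1 * (1 - r)^-1) <= eta.
  have xM : x <= rho / 2 * M%:R.
    have := ltW (truncnS_gt (2 * x / rho)); rewrite -/M ler_pdivrMr //; lra.
  have h : expR (- (rho / 2) * M%:R) <= x^-1.
    rewrite mulNr; apply: (le_trans (le_expRN _ _)); first exact: lt_le_trans xM.
    by rewrite lef_pV2 ?posrE // (lt_le_trans x0).
  have -> : eta = 4 * x^-1 * ((1 - r)^-1 * (1 - r)^-1).
    rewrite /x invf_div; field; by rewrite !gt_eqF.
  apply: ler_wpM2r; first by rewrite ltW // mulr_gt0 ?invr_gt0.
  by rewrite ler_pM2l.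
pose F (m n : nat) : set T :=
  if [&& (m + n <= K)%N, (M <= m + n)%N & c * (m + n)%:R <= drift b m n - drift a m n]
  then [set w | overtakes a b (Y^~ w) K (diag k) m n] else set0.
have mF m n : measurable (F m n).
  by rewrite /F; case: ifP => // _; exact: measurable_overtakes YF.1.
have FE : [set w | overtaken a b c M K k (Y^~ w)] =
    \big[setU/set0]_(m <- iota 0 K.+1) \big[setU/set0]_(n <- iota 0 K.+1) F m n.
  apply/seteqP; split => w /=.
    move=> [m [n [h1 h2 h3 h4]]].
    have hm : m \in iota 0 K.+1.
      by rewrite mem_iota add0n ltnS (leq_trans (leq_addr n m)).
    have hn : n \in iota 0 K.+1.
      by rewrite mem_iota add0n ltnS (leq_trans (leq_addl m n)).
    rewrite -bigcup_seq; exists m; first exact: hm.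
    rewrite -bigcup_seq; exists n; first exact: hn.
    by rewrite /F h1 h2 h3.
  rewrite -bigcup_seq => -[m _]; rewrite -bigcup_seq => -[n _].
  by rewrite /F; case: ifP => // /and3P[h1 h2 h3] h4; exists m, n.
rewrite FE; split.
  by apply: bigsetU_measurable => m _; exact: bigsetU_measurable.
have PF m n : (P (F m n) <= (4 * expR (- (rho / 2) * M%:R) * (r ^+ m * r ^+ n))%:E)%E.
  rewrite /F; case: ifP => [/and3P[h1 h2 h3]|_]; last first.
    by rewrite measure0 lee_fin !mulr_ge0 ?expR_ge0 // exprn_ge0 ?expR_ge0.
  apply: (le_trans (H _ _ _ _ _ _ _ _ YF h1 h3)).
  rewrite lee_fin -mulrA ler_pM2l // -exprD /r -expRM_natr -expRD ler_expR.
  have : rho / 2 * M%:R <= rho / 2 * (m + n)%:R by rewrite ler_pM2l ?divr_gt0 // ler_nat.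
  lra.
set C := 4 * expR (- (rho / 2) * M%:R) in small PF.
have C0 : 0 < C by rewrite mulr_gt0 ?expR_gt0.
apply: (@le_trans _ _
  (\sum_(m <- iota 0 K.+1) \sum_(n <- iota 0 K.+1) C * (r ^+ m * r ^+ n))%:E).
  apply: measure_bigsetU_le => m; first exact: bigsetU_measurable.
  exact: measure_bigsetU_le.
rewrite lee_fin; apply: le_trans small.
under eq_bigr do rewrite -mulr_sumr -mulr_sumr.
rewrite -mulr_sumr ler_pM2l // -mulr_suml.
have g : \sum_(n <- iota 0 K.+1) r ^+ n <= (1 - r)^-1.
  have -> : iota 0 K.+1 = index_iota 0 K.+1 by rewrite /index_iota subn0.
  by rewrite big_mkord; exact: geometric_sum_le.
have g0 : 0 <= \sum_(n <- iota 0 K.+1) r ^+ n.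
  by apply: sumr_ge0 => i _; rewrite exprn_ge0 ?expR_ge0.
by apply: ler_pM.
Qed.

Lemma not_overtaken_reroutes (a b c : R) (w : Z2 -> R) M K k N (v1 : int) :
  (forall (m n : nat), (m + n)%N = N ->
     (if 0 <= k then v1 < k + m%:Z else k + m%:Z < v1) ->
     c * N%:R <= drift b m n - drift a m n) ->
  ~ overtaken a b c M K k w -> (M <= N)%N -> (N <= K)%N -> reroutes a b w K k v1 N.
Proof.
move=> cone nover MN NK m n mnN side.
rewrite ltNge; apply/negP => h; apply: nover; exists m, n.
by rewrite mnN; split => //; [exact: cone|rewrite /overtakes mnN].
Qed.

End overtaken.

(** * Joining two rerouted halves across an edge *)

Section concatenation.
Context {R : realType}.

(* [p] is a geodesic through the edge from [- e] to the origin. *)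
Definition through (w : Z2 -> R) (u v e : Z2) (n1 n2 : nat) : Prop :=
  exists p : nat -> Z2,
  [/\ urpath p (n1 + n2).+1, p 0%N = u /\ p n1 = - e, p n1.+1 = (0, 0),
      p (n1 + n2).+1 = v &
      forall q, urpath q (n1 + n2).+1 -> q 0%N = u -> q (n1 + n2).+1 = v ->
      \sum_(i < (n1 + n2).+2) w (q i) <= \sum_(i < (n1 + n2).+2) w (p i)].

(* The half-turn that swaps the end points of the edge from [- e] to [0]. *)
Definition rotated (w : Z2 -> R) (e : Z2) : Z2 -> R := fun y => w (- e - y).

(** The half-turn sends [diag (- k)] to [diag k - e]. Hence a translate of the edge [e] joins the
    two rerouted halves into a competitor of the geodesic, whose maximality bounds the total
    gain. *)
Lemma through_le w (u v e : Z2) n1 n2 (k : int) (D1 D2 : R) :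
  e = (1, 0) \/ e = (0, 1) -> through w u v e n1 n2 ->
  (forall p, urpath p n2 -> p 0%N = (0, 0) -> p n2 = v ->
    exists q, [/\ urpath q n2, q 0%N = diag k, q n2 = v &
      \sum_(i < n2.+1) w (p i) + D1 <= \sum_(i < n2.+1) w (q i)]) ->
  (forall p, urpath p n1 -> p 0%N = (0, 0) -> p n1 = - e - u ->
    exists q, [/\ urpath q n1, q 0%N = diag (- k), q n1 = - e - u &
      \sum_(i < n1.+1) rotated w e (p i) + D2 <= \sum_(i < n1.+1) rotated w e (q i)]) ->
  D1 + D2 <= 0.
Proof.
move=> eE [p [pu [p0 pn1] pn1S pv pmax]] H1 H2.
have refl_step (x y : Z2) : y = rt x \/ y = up x ->
    (- e - x) = rt (- e - y) \/ (- e - x) = up (- e - y).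
  by case=> ->; [left|right]; case: x => x1 x2; case: (e) => f1 f2; site_lia.
pose p1 i := p (n1.+1 + i)%N; pose p2 i := - e - p (n1 - i)%N.
have [|||q1 [q1u q10 q1v q1w]] := H1 p1.
- by move=> i i2; rewrite /p1 addnS; apply: pu; lia.
- by rewrite /p1 addn0.
- by rewrite /p1 addSn.
have [|||q2 [q2u q20 q2v q2w]] := H2 p2.
- move=> i i1; rewrite /p2; apply: refl_step.
  have -> : (n1 - i = (n1 - i.+1).+1)%N by lia.
  by apply: pu; lia.
- by rewrite /p2 subn0 pn1 opprK addNr.
- by rewrite /p2 subnn p0.
(* The lower half is turned back and traversed in reverse; after time [n1] comes the step from
   [diag k - e] to [diag k]. *)
pose q i := if (i <= n1)%N then - e - q2 (n1 - i)%N else q1 (i - n1.+1)%N.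
have split (f : nat -> R) : \sum_(i < (n1 + n2).+2) f i =
    \sum_(i < n1.+1) f (n1 - i)%N + \sum_(i < n2.+1) f (n1.+1 + i)%N.
  rewrite -addSn -addnS big_split_ord /=; congr (_ + _).
  by rewrite (reindex_inj rev_ord_inj) /=; apply: eq_bigr => i _; rewrite subSS.
have qE1 i : (i <= n1)%N -> q (n1 - i)%N = - e - q2 i.
  by move=> i1; rewrite /q leq_subr subKn.
have qE2 i : q (n1.+1 + i)%N = q1 i by rewrite /q leqNgt addSn ltnS leq_addr /= subSS addKn.
have qu : urpath q (n1 + n2).+1.
  move=> i i12; have [i1|i1|i1] := ltngtP i n1.
  - have -> : i = (n1 - (n1 - i))%N by rewrite subKn // ltnW.
    have -> : (n1 - (n1 - i)).+1 = (n1 - (n1 - i).-1)%N.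
      by move: i1; clear; lia.
    rewrite !qE1 ?leq_subr //; last by apply: leq_trans (leq_pred _) (leq_subr _ _).
    have E : (n1 - i = (n1 - i).-1.+1)%N by move: i1; clear; lia.
    rewrite [in - e - q2 (n1 - i)%N]E; apply: refl_step; apply: q2u.
    by move: i1; clear; lia.
  - have -> : i = (n1.+1 + (i - n1.+1))%N by rewrite subnKC.
    rewrite -addnS !qE2; apply: q1u.
    by move: i1 i12; clear; lia.
  - rewrite i1 -[in q n1](subn0 n1) qE1 // q20 -[n1.+1]addn0 qE2 q10.
    by case: eE => ->; [left|right]; site_lia.
have := pmax q qu; rewrite -{1}(subnn n1) qE1 // q2v opprB addrC subrK => /(_ erefl).
rewrite -addSn qE2 q1v => /(_ erefl); rewrite addSn (split (w \o q)) (split (w \o p)) /=.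
under eq_bigr => i _ do rewrite qE1 -1?ltnS //.
under [X in _ + X <= _]eq_bigr => i _ do rewrite qE2.
move: q1w q2w; rewrite /rotated /p1 /p2.
have -> : \sum_(i < n1.+1) w (- e - (- e - p (n1 - i)%N)) = \sum_(i < n1.+1) w (p (n1 - i)%N).
  by apply: eq_bigr => i _; rewrite opprB addrC subrK.
lra.
Qed.

End concatenation.

(** * The profile along the antidiagonal and its near-peaks *)

Section profile.
Context {R : realType}.
Implicit Types (a : R) (w : Z2 -> R).

(* Up to a constant, the weight of an optimal path through the edge from
   [diag k - e] to [diag k], as seen from far away on both sides. *)
Definition profile a (e : Z2) K w (k : int) : R :=
  busemann a w K (diag k) + busemann a (rotated w e) K (diag (- k)).

(** The half-turn reverses the antidiagonal, so the second summand is translated by [diag (- c)]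
    while being evaluated at [- j] and [- k]. *)
Lemma profile_shift a e K w c j k :
  profile a e K (fun y => w (y + diag c)) j - profile a e K (fun y => w (y + diag c)) k =
  profile a e K w (j + c) - profile a e K w (k + c).
Proof.
have E : rotated (fun y => w (y + diag c)) e = (fun y => rotated w e (y + diag (- c))).
  apply/funext => y; rewrite /rotated; congr (w _).
  case: e y => [e1 e2] [y1 y2]; site_lia.
rewrite /profile E.
have := busemann_shift a w c K j k.
have := busemann_shift a (rotated w e) (- c) K (- j) (- k).
rewrite -!opprD; lra.
Qed.

Definition near_peak a e K (L : nat) rho w : Prop :=
  forall j : int, `|j| <= L%:Z -> profile a e K w j <= profile a e K w 0 + rho.

End profile.

Lemma measurable_exists d (T : measurableType d) (I : countType) (F : I -> set T) :
  (forall i, measurable (F i)) -> measurable [set w | exists i, F i w].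
Proof.
move=> mF; rewrite (_ : [set w | _] = \bigcup_i F i); last first.
  by apply/seteqP; split => w [i]; exists i.
by apply: countable_bigcupT_measurable => //; exact: countableP.
Qed.

Lemma measurable_forall d (T : measurableType d) (I : countType) (F : I -> set T) :
  (forall i, measurable (F i)) -> measurable [set w | forall i, F i w].
Proof.
move=> mF; rewrite (_ : [set w | _] = ~` [set w | exists i, (~` F i) w]).
  by apply: measurableC; apply: measurable_exists => i; exact: measurableC.
apply/seteqP; split => w /=; first by move=> h [i]; apply; exact: h.
by move=> h i; apply: contrapT => nF; apply: h; exists i.
Qed.

Lemma measurable_cond d (T : measurableType d) (Q : Prop) (A : set T) :
  measurable A -> measurable [set w | Q /\ A w].
Proof.
move=> mA; have [q|nq] := pselect Q.
  by rewrite (_ : [set w | _] = A) //; apply/seteqP; split => w //= [].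
by rewrite (_ : [set w | _] = set0) //; apply/seteqP; split => w //= [].
Qed.

Lemma measurable_imply d (T : measurableType d) (Q : Prop) (A : set T) :
  measurable A -> measurable [set w | Q -> A w].
Proof.
move=> mA; have [q|nq] := pselect Q.
  by rewrite (_ : [set w | _] = A) //; apply/seteqP; split => w /=; [apply|].
by rewrite (_ : [set w | _] = setT) //; apply/seteqP; split => w //= _ /nq.
Qed.

Lemma measurable_profile d (T : measurableType d) (R : realType) (X : Z2 -> T -> R)
    (a : R) e K k : (forall x, measurable_fun setT (X x)) ->
  measurable_fun setT (fun w => profile a e K (X^~ w) k).
Proof.
move=> mX; apply: measurable_funD; first exact: measurable_busemann.
exact: (@measurable_busemann R d T (fun x => X (- e - x)) a K (diag (- k)) (fun x => mX _)).
Qed.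

Lemma measurable_near_peak d (T : measurableType d) (R : realType) (X : Z2 -> T -> R)
    (a : R) e K L rho : (forall x, measurable_fun setT (X x)) ->
  measurable [set w | near_peak a e K L rho (X^~ w)].
Proof.
move=> mX.
apply: (@measurable_forall _ _ _ (fun j : int => [set w | `|j| <= L%:Z ->
  profile a e K (X^~ w) j <= profile a e K (X^~ w) 0 + rho])) => j.
apply: (@measurable_imply _ _ _ [set w | profile a e K (X^~ w) j <= _]).
apply: measurable_le_set; first exact: measurable_profile.
by apply: measurable_funD; [exact: measurable_profile|exact: measurable_cst].
Qed.

Section profile_ties.
Context d (T : measurableType d) (R : realType) (P : probability T R).
Context (X : Z2 -> T -> R) (X_field : exp_field P X).
Context (a : R) (e : Z2) (e_lev : lev e = 1).

(** One step of the recursion, available as the horizon is [K.+1], exposes the weight at [diag j].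
    The rest avoids it: the forward functions see levels above 0 and the site [diag k], the backward
    ones see levels below 0. *)
Lemma profile_tie K j k rho : j != k -> 0 <= rho ->
  (P [set w | (`|profile a e K.+1 (X^~ w) j - profile a e K.+1 (X^~ w) k| <= rho)%R] <=
    (2 * rho)%:E)%E.
Proof.
move=> jk rho0.
pose m w c : R := Num.max (busemann a w K (rt (diag c))) (busemann a w K (up (diag c))).
pose r w c : R := busemann a (rotated w e) K.+1 (diag (- c)).
pose Zf (w : Z2 -> R) := m w j + r w j - (w (diag k) + m w k + r w k).
(* Erasing the weight at [diag j] does not change [Zf], which is therefore measurable in terms of
   the other weights. *)
pose X' y := if y == diag j then cst 0 else X y.
have ZE w : Zf (X^~ w) = Zf (X'^~ w).
  have XE y : lev y <> 0 -> X y w = X' y w.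
    by rewrite /X'; case: eqP => // -> []; rewrite /lev /=; lia.
  have mE c : m (X^~ w) c = m (X'^~ w) c.
    by rewrite /m; congr Num.max; apply: busemann_ext => y cy; apply: XE;
      move: cy; rewrite /lev /=; lia.
  have rE c : r (X^~ w) c = r (X'^~ w) c.
    apply: busemann_ext => y cy; apply: XE.
    by move: cy e_lev; rewrite /lev /=; lia.
  rewrite /Zf !mE !rE; congr (_ - (_ + _ + _)).
  by rewrite /X'; case: eqP => // -[] kj; rewrite kj eqxx in jk.
(* Over an arbitrary measurable space, to serve both for the full sigma-algebra and for the one
   without [diag j]. *)
have mZf d' (T' : measurableType d') (V : Z2 -> T' -> R) :
    (forall y, measurable_fun setT (V y)) -> measurable_fun setT (fun w => Zf (V^~ w)).
  move=> mV.
  have mm c : measurable_fun setT (fun w => m (V^~ w) c).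
    by apply: measurable_maxr; exact: measurable_busemann.
  have mr c : measurable_fun setT (fun w => r (V^~ w) c).
    exact: (@measurable_busemann R d' T' (fun x => V (- e - x)) a K.+1 (diag (- c))
      (fun x => mV _)).
  apply: measurable_funB; first by apply: measurable_funD; [exact: mm|exact: mr].
  apply: measurable_funD; last exact: mr.
  by apply: measurable_funD; [exact: mV|exact: mm].
have -> : [set w | `|profile a e K.+1 (X^~ w) j - profile a e K.+1 (X^~ w) k| <= rho] =
    [set w | `|X (diag j) w + Zf (X^~ w)| <= rho].
  have E w : profile a e K.+1 (X^~ w) j - profile a e K.+1 (X^~ w) k =
      X (diag j) w + Zf (X^~ w) by rewrite /profile 2!(busemann_max a (X^~ w)) /Zf /m /r; ring.
  by apply/funext => w /=; rewrite E.
apply: (near_tie _ _ _ _ _ X_field) => //; first by apply: mZf; exact: X_field.1.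
rewrite (_ : (fun _ => _) = (fun w => Zf (X'^~ w))); last by apply/funext.
apply: (@mZf _ (g_sigma_algebraType (off_site _ _ _ X (diag j))) X') => y.
rewrite /X'; case: eqP => [_|/eqP yj]; first exact: measurable_cst.
exact: measurable_off_site.
Qed.

End profile_ties.

Section peak.
Context d (T : measurableType d) (R : realType) (P : probability T R).
Context (X : Z2 -> T -> R) (X_field : exp_field P X).
Context (theta : int -> T -> T).
Hypothesis theta_meas : forall k, measurable_fun setT (theta k).
Hypothesis theta_pres : forall k A, measurable A -> P (theta k @^-1` A) = P A.
Hypothesis theta_shift : forall k x w, X x (theta k w) = X (x + diag k) w.

(* By stationarity each of L sites is equally likely to be the near-peak of its
   neighbourhood, while two of them are so only in case of a near tie. *)
Lemma near_peak_small (a : R) e K L rho : lev e = 1 -> 0 <= rho -> (0 < L)%N ->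
  (P [set w | near_peak a e K.+1 L rho (X^~ w)] <= (L%:R^-1 + L%:R * (2 * rho))%:E)%E.
Proof.
move=> e1 rho0 L0.
have mX := X_field.1.
set A := [set w | _].
have mA : measurable A by exact: measurable_near_peak.
pose W w := profile a e K.+1 (X^~ w).
pose tie (j k : nat) := [set w | `|W w j%:Z - W w k%:Z| <= rho].
have mtie j k : measurable (tie j k).
  apply: measurable_le_set; last exact: measurable_cst.
  by apply: measurableT_comp => //; apply: measurable_funB; exact: measurable_profile.
have AE (k : nat) w : A (theta k%:Z w) ->
    forall j : int, `|j| <= L%:Z -> W w (j + k%:Z) <= W w k%:Z + rho.
  move=> Aw j jL; have := Aw j jL.
  rewrite (_ : X^~ (theta k%:Z w) = fun y => X (y + diag k%:Z) w); last first.
    by apply/funext => y; exact: theta_shift.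
  have := profile_shift a e K.+1 (X^~ w) k%:Z j 0; rewrite add0r -/(W w _) -/(W w _).
  move=> + h; move: h; lra.
(* Near-peaks at [k] that tie with no earlier site. They are disjoint for [k < L]: two near-peaks at
   distance less than [L] dominate each other up to [rho], which is a tie. *)
pose C (k : nat) := theta k%:Z @^-1` A `\` \big[setU/set0]_(j < k) tie j k.
have mpre k : measurable (theta k%:Z @^-1` A).
  by rewrite -[X in measurable X]setTI; exact: theta_meas.
have mU k : measurable (\big[setU/set0]_(j < k) tie j k).
  exact: bigsetU_measurable.
have mC k : measurable (C k) by exact: measurableD.
have dis : trivIset `I_L C.
  apply/trivIsetP => i j iL jL ij.
  wlog lt : i j iL jL ij / (i < j)%N => [H|].
    have [?|?|E] := ltngtP i j; [exact: H| |by rewrite E eqxx in ij].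
    by rewrite setIC; apply: H => //; rewrite eq_sym.
  apply/seteqP; split => // w [[Ai _] [Aj nU]]; apply: nU.
  rewrite -(bigcup_mkord j (tie^~ j)); exists i; first exact: lt.
  have h1 := AE _ _ Ai (j%:Z - i%:Z) ltac:(move: iL jL; rewrite /=; lia).
  have h2 := AE _ _ Aj (i%:Z - j%:Z) ltac:(move: iL jL; rewrite /=; lia).
  rewrite !subrK in h1 h2; rewrite /tie /= ler_norml; apply/andP; split; lra.
have PC k : (k < L)%N -> (P A <= P (C k) + (L%:R * (2 * rho))%:E)%E.
  move=> kL; rewrite -(theta_pres k%:Z _ mA).
  have tieb : (P (\big[setU/set0]_(j < k) tie j k) <= (L%:R * (2 * rho))%:E)%E.
    apply: (@le_trans _ _ (\sum_(j < k) 2 * rho)%:E).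
      apply: measure_bigsetU_le => j; first exact: mtie.
      by apply: (profile_tie _ _ _ _ _ X_field _ _ e1) => //; rewrite eqz_nat neq_ltn ltn_ord.
    rewrite lee_fin sumr_const card_ord -[leLHS]mulr_natl.
    by apply: ler_wpM2r; [exact: mulr_ge0|rewrite ler_nat ltnW].
  apply: (@le_trans _ _ (P (C k `|` \big[setU/set0]_(j < k) tie j k))).
    apply: le_measure; rewrite ?inE; [exact: mpre|exact: measurableU|].
    by move=> w Aw; have [?|?] := pselect ((\big[setU/set0]_(j < k) tie j k) w);
      [right|left].
  apply: (@le_trans _ _ (P (C k) + P (\big[setU/set0]_(j < k) tie j k))%E).
    by apply: measureU2; [exact: mC|exact: mU].
  by apply: leeD; [exact: lexx|exact: tieb].
have sumC : (\sum_(k < L) P (C k) <= 1)%E.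
  have mUC : measurable (\big[setU/set0]_(k < L) C k).
    by apply: bigsetU_measurable => k _; exact: mC.
  rewrite -(measure_semi_additive_ord_I P (fun k _ => mC k) dis mUC).
  exact: (probability_le1 P mUC).
have sumA : (\sum_(k < L) P A <= 1 + \sum_(k < L) (L%:R * (2 * rho))%:E)%E.
  apply: (@le_trans _ _ (\sum_(k < L) (P (C k) + (L%:R * (2 * rho))%:E))%E).
    by apply: lee_sum => k _; exact: PC.
  by rewrite big_split /=; apply: leeD; [exact: sumC|exact: lexx].
have PAE : P A = (fine (P A))%:E by rewrite fineK // fin_num_measure.
move: sumA; rewrite PAE !sumEFin -EFinD !lee_fin !sumr_const !card_ord.
have L0' : (0 : R) < L%:R by rewrite ltr0n.
rewrite -(mulr_natl (fine _)) -(mulr_natl (_ * _)) => h.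
have -> : L%:R^-1 + L%:R * (2 * rho) = L%:R^-1 * (1 + L%:R * (L%:R * (2 * rho))).
  by field; rewrite gt_eqF.
by rewrite mulrC -ler_pdivrMr ?invr_gt0 // invrK mulrC.
Qed.

End peak.

Lemma exp_field_reindex d (T : measurableType d) (R : realType) (P : probability T R)
    (X : Z2 -> T -> R) (f g : Z2 -> Z2) :
  cancel f g -> exp_field P X -> exp_field P (fun x => X (f x)).
Proof.
move=> fg [mX ind]; split => [x|s B us _ mB]; first exact: mX.
have -> : cylinder (fun x => X (f x)) s B =
    cylinder X [seq f x | x <- s] (fun y => B (g y)).
  by rewrite /cylinder big_map; apply: eq_bigr => x _; rewrite fg.
rewrite ind ?map_inj_uniq ?all_predT //; last exact: can_inj fg.
by rewrite big_map; apply: eq_bigr => x _; rewrite fg.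
Qed.

(** * Rerouting outside a rare event, and rarity of geodesics through an edge *)

Section core.
Context {R : realType}.

(** The order of quantifiers is the point: [delta] and [M] come before the horizon [K], and the
    event [G] before [N], [v] and [p]. *)
Lemma rerouting_gain (a eta rho : R) (L : nat) :
  0 < a -> 0 < 1 - a -> 0 < eta -> 0 < rho ->
  exists (delta : R) (M : nat), 0 < delta /\
  forall d (T : measurableType d) (P : probability T R) X K, exp_field P X ->
  exists G : set T, [/\ measurable G, (P G <= eta%:E)%E & forall w, ~ G w ->
    forall k N v p, `|k| <= L%:Z -> (M <= N)%N -> (N <= K)%N ->
    `|v.1%:~R - (xi a).1 * N%:R| <= delta * N%:R ->
    urpath p N -> p 0%N = (0, 0) -> p N = v ->
    exists q, [/\ urpath q N, q 0%N = diag k, q N = v &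
      \sum_(i < N.+1) X (p i) w +
      (busemann a (X^~ w) K (diag k) - busemann a (X^~ w) K (diag 0) - rho) <=
      \sum_(i < N.+1) X (q i) w]].
Proof.
move=> a0 a1 eta0 rho0.
pose kap := rho / (2 * L.+1%:R).
(* Five events for each of the [2 * L + 1] values of [k]. *)
pose eta' := eta / (5 * (L.*2.+1)%:R).
have kap0 : 0 < kap by rewrite divr_gt0 // mulr_gt0 // ltr0n.
have eta'0 : 0 < eta' by rewrite divr_gt0 // mulr_gt0 // ltr0n.
have Lkap : L%:R * (2 * kap) <= rho.
  have -> : L%:R * (2 * kap) = L%:R / L.+1%:R * rho.
    by rewrite /kap; field; apply/eqP; have := ler0n R L; lra.
  rewrite -[leRHS]mul1r; apply: ler_wpM2r; first exact: ltW.
  by rewrite ler_pdivrMr ?ltr0n // mul1r ler_nat.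
have [eps eps0 close] := incr_close _ _ _ a0 a1 kap0 eta'0.
(* A larger parameter points to a steeper direction: a geodesic started to the right of the origin
   must be steered to the left to meet the path, and conversely. *)
pose b (k : int) := if 0 <= k then a + eps else a - eps.
have bE k : `|b k - a| <= eps.
  by rewrite /b; case: ifP => _; rewrite ler_norml; apply/andP; split; lra.
have b0 k : 0 < b k by have [] := close _ (bE k).
have b1 k : 0 < 1 - b k by have [] := close _ (bE k).
have ba k : b k != a.
  rewrite -subr_eq0 /b; case: ifP => _; apply/eqP; lra.
have [dp [cp [dp0 cp0 conep]]] := cone_drift _ _ a0 a1 (b0 0) (b1 0) (ba 0).
have [dm [cm [dm0 cm0 conem]]] := cone_drift _ _ a0 a1 (b0 (-1)) (b1 (-1)) (ba (-1)).
have {conep} [Mp conep] := conep L.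
have {conem} [Mm conem] := conem L.
have [Np overp] := overtaken_rare _ _ _ _ a0 a1 (b0 0) (b1 0) cp0 eta'0.
have [Nm overm] := overtaken_rare _ _ _ _ a0 a1 (b0 (-1)) (b1 (-1)) cm0 eta'0.
exists (Num.min dp dm), (maxn (maxn Mp Mm) (maxn Np Nm)); split.
  by rewrite lt_min dp0.
move=> d T P X K XF.
pose c (k : int) := if 0 <= k then cp else cm.
pose N0 (k : int) := if 0 <= k then Np else Nm.
(* Event 0: the geodesic from [diag k] may be badly steered. Events 1 to 4: for one of the two
   parameters, an increment at [diag k] differs from that of [a] by [kap] or more. *)
pose F (k : int) (i : nat) : set T := match i with
  | 0 => [set w | overtaken a (b k) (c k) (N0 k) K k (X^~ w)]
  | 1 => [set w | kap <= `|(incr (b 0) (X^~ w) K (diag k)).1 - (incr a (X^~ w) K (diag k)).1|]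
  | 2 => [set w | kap <= `|(incr (b 0) (X^~ w) K (diag k)).2 - (incr a (X^~ w) K (diag k)).2|]
  | 3 => [set w | kap <= `|(incr (b (-1)) (X^~ w) K (diag k)).1 - (incr a (X^~ w) K (diag k)).1|]
  | _ => [set w | kap <= `|(incr (b (-1)) (X^~ w) K (diag k)).2 - (incr a (X^~ w) K (diag k)).2|]
  end.
have bk k : b k = if 0 <= k then b 0 else b (-1) by rewrite /b; case: ifP.
pose rare (S : set T) := measurable S /\ (P S <= eta'%:E)%E.
have FP k i : rare (F k i).
  have far b' : `|b' - a| <= eps ->
      rare [set w | kap <= `|(incr b' (X^~ w) K (diag k)).1 - (incr a (X^~ w) K (diag k)).1|] /\
      rare [set w | kap <= `|(incr b' (X^~ w) K (diag k)).2 - (incr a (X^~ w) K (diag k)).2|].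
    move=> /close[_ _ H]; have [H1 H2] := H d T P X K (diag k) XF.
    have [mIa mJa] := measurable_incr a XF.1 K (diag k).
    have [mIb mJb] := measurable_incr b' XF.1 K (diag k).
    split; split; [|exact: H1| |exact: H2];
      (apply: measurable_le_set; first exact: measurable_cst);
      by apply: measurableT_comp => //; exact: measurable_funB.
  have [? ?] := far _ (bE 0); have [? ?] := far _ (bE (-1)).
  case: i => [|[|[|[|i]]]]; [|by []..].
  rewrite /F bk /c /N0; case: ifP => _; [exact: overp|exact: overm].
pose ks : seq int := [seq i%:Z - L%:Z | i <- iota 0 (L.*2.+1)].
exists (\big[setU/set0]_(k <- ks) \big[setU/set0]_(i <- iota 0 5) F k i); split.
- apply: bigsetU_measurable => k _; apply: bigsetU_measurable => i _; exact: (FP k i).1.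
- apply: (@le_trans _ _ (\sum_(k <- ks) \sum_(i <- iota 0 5) eta')%:E).
    apply: measure_bigsetU_le => k.
      by apply: bigsetU_measurable => i _; exact: (FP k i).1.
    apply: measure_bigsetU_le => i; [exact: (FP k i).1|exact: (FP k i).2].
  rewrite lee_fin !big_const_seq !count_predT !iter_addr_0 size_map !size_iota /eta'.
  rewrite le_eqVlt; apply/orP; left; apply/eqP.
  by field; apply/eqP; have := ler0n R L.*2; lra.
move=> w nG k N v p kL MN NK vcone pu p0 pN.
have nF j i : `|j| <= L%:Z -> (i < 5)%N -> ~ F j i w.
  move=> jL i5 Fw; apply: nG.
  have hj : j \in ks.
    apply/mapP; exists (absz (j + L%:Z)%R); last by move: jL; clear; lia.
    by rewrite mem_iota; move: jL; clear; lia.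
  have hi : i \in iota 0 5 by rewrite mem_iota.
  rewrite -bigcup_seq; exists j; first exact: hj.
  by rewrite -bigcup_seq; exists i; first exact: hi.
have [|q [qu q0 qN qw]] := reroute a (b k) (X^~ w) K k v N p pu NK p0 pN.
  move: MN; rewrite !geq_max => /andP[/andP[MpN MmN] /andP[NpN NmN]].
  have vd : `|v.1%:~R - (xi a).1 * N%:R| <= (if 0 <= k then dp else dm) * N%:R.
    apply: (le_trans vcone); apply: ler_wpM2r; first exact: ler0n.
    by case: ifP => _; rewrite ge_min lexx ?orbT.
  apply: (@not_overtaken_reroutes R a (b k) (c k) (X^~ w) (N0 k) K k N v.1) => //; last 1 first.
  - by rewrite /N0; case: ifP.
  - move=> m n mnN side; rewrite bk /c; move: vd side; case: ifP => k0 vd side.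
      apply: conep MpN mnN kL vd _.
      by rewrite /b /= ltrDl eps0.
    apply: conem MmN mnN kL vd _.
    by have -> : a < b (-1) = false by rewrite /b /=; lra.
  - exact: (nF k 0%N).
exists q; split => //; apply: le_trans qw; rewrite lerD2l lerBlDr.
have near i : `|i| <= L%:Z ->
    `|(incr (b k) (X^~ w) K (diag i)).1 - (incr a (X^~ w) K (diag i)).1| <= kap /\
    `|(incr (b k) (X^~ w) K (diag i)).2 - (incr a (X^~ w) K (diag i)).2| <= kap.
  move=> iL; rewrite bk; case: ifP => _; split; rewrite leNgt; apply/negP => /ltW h.
  - exact: (nF i 1%N iL).
  - exact: (nF i 2%N iL).
  - exact: (nF i 3%N iL).
  - exact: (nF i 4%N iL).
have := busemann_close _ _ _ _ _ _ near _ kL.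
rewrite ler_norml => /andP[h _]; lra.
Qed.

End core.

Definition diag_stationary d (T : measurableType d) (R : realType) (P : probability T R)
    (X : Z2 -> T -> R) : Prop :=
  exists theta : int -> T -> T,
  [/\ forall k, measurable_fun setT (theta k),
      forall k A, measurable A -> P (theta k @^-1` A) = P A &
      forall k x w, X x (theta k w) = X (x + diag k) w].
Arguments diag_stationary {d T R} P X.

Lemma edge_rare (R : realType) (a eta : R) : 0 < a -> 0 < 1 - a -> 0 < eta ->
  exists (delta : R) (M : nat), 0 < delta /\
  forall d (T : measurableType d) (P : probability T R) X e K,
  exp_field P X -> diag_stationary P X -> e = (1, 0) \/ e = (0, 1) ->
  exists G : set T, [/\ measurable G, (P G <= eta%:E)%E & forall w, ~ G w ->
    forall u v n1 n2, (M <= n1 <= K.+1)%N -> (M <= n2 <= K.+1)%N ->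
    `|v.1%:~R - (xi a).1 * n2%:R| <= delta * n2%:R ->
    `|(- e - u).1%:~R - (xi a).1 * n1%:R| <= delta * n1%:R ->
    ~ through (X^~ w) u v e n1 n2].
Proof.
move=> a0 a1 eta0.
(* Brings the stationarity bound [L%:R^-1] below [eta / 4]. *)
pose L := (Num.truncn (4 / eta)).+1.
have L0 : (0 : R) < L%:R by rewrite ltr0n.
have Leta : L%:R^-1 <= eta / 4.
  have -> : eta / 4 = (4 / eta)^-1 by rewrite invf_div.
  by rewrite lef_pV2 ?posrE ?divr_gt0 //; exact/ltW/truncnS_gt.
(* Each half loses [rho], so the near-peak has tolerance [2 * rho], and its ties cost
   [L%:R * (2 * (2 * rho)) = eta / 4]. *)
pose rho := eta / (16 * L%:R).
have rho0 : 0 < rho by rewrite divr_gt0 // mulr_gt0.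
have eta4 : 0 < eta / 4 by rewrite divr_gt0.
have [delta [M [delta0 gain]]] := rerouting_gain a (eta / 4) rho L a0 a1 eta4 rho0.
exists delta, M; split => // d T P X e K XF [theta [th1 th2 th3]] eE.
have e1 : lev e = 1 by case: eE => ->.
have XF' : exp_field P (fun x => X (- e - x)).
  apply: (exp_field_reindex _ _ _ _ _ (fun x => - e - x) (fun x => - e - x)) => // x.
  by rewrite opprB addrC subrK.
have [G1 [mG1 PG1 H1]] := gain d T P X K.+1 XF.
have [G2 [mG2 PG2 H2]] := gain d T P _ K.+1 XF'.
pose G0 := [set w | near_peak a e K.+1 L (2 * rho) (X^~ w)].
have mG0 : measurable G0 by apply: measurable_near_peak; exact: XF.1.
have PG0 : (P G0 <= (eta / 2)%:E)%E.
  apply: (le_trans (near_peak_small _ _ _ _ X XF theta th1 th2 th3 a e K L (2 * rho)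
    e1 _ _)) => //.
    by rewrite mulr_ge0 // ltW.
  rewrite lee_fin.
  have -> : L%:R * (2 * (2 * rho)) = eta / 4 by rewrite /rho; field; rewrite gt_eqF.
  lra.
exists (G0 `|` (G1 `|` G2)); split.
- by apply: measurableU => //; exact: measurableU.
- apply: (@le_trans _ _ (P G0 + (P G1 + P G2))%E).
    apply: (le_trans (measureU2 _ mG0 (measurableU _ _ mG1 mG2))).
    by apply: leeD; [exact: lexx|exact: measureU2].
  apply: (@le_trans _ _ ((eta / 2)%:E + ((eta / 4)%:E + (eta / 4)%:E))%E).
    by apply: leeD => //; exact: leeD.
  by rewrite -!EFinD lee_fin; lra.
move=> w nG u v n1 n2 /andP[M1 K1] /andP[M2 K2] vc uc thr.
have [nG0 nG1 nG2] : [/\ ~ G0 w, ~ G1 w & ~ G2 w].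
  by split => h; apply: nG; [left|right; left|right; right].
apply: nG0 => j jL.
have ineq := through_le (X^~ w) u v e n1 n2 j
  (busemann a (X^~ w) K.+1 (diag j) - busemann a (X^~ w) K.+1 (diag 0) - rho)
  (busemann a (rotated (X^~ w) e) K.+1 (diag (- j)) -
   busemann a (rotated (X^~ w) e) K.+1 (diag 0) - rho) eE thr.
rewrite /profile oppr0.
suff : busemann a (X^~ w) K.+1 (diag j) - busemann a (X^~ w) K.+1 (diag 0) - rho +
    (busemann a (rotated (X^~ w) e) K.+1 (diag (- j)) -
     busemann a (rotated (X^~ w) e) K.+1 (diag 0) - rho) <= 0 by lra.
apply: ineq.
- move=> p pu p0 pv; exact: (H1 w nG1 j n2 v p jL M2 K2 vc pu p0 pv).
move=> p pu p0 pv.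
have jL' : `|- j| <= L%:Z by rewrite normrN.
exact: (H2 w nG2 (- j) n1 (- e - u) p jL' M1 K1 uc pu p0 pv).
Qed.

(** * Geodesics as functions of time, and measurability *)

Lemma up_right_stepP (x y : Z2) : reflect (y = rt x \/ y = up x) (up_right_step x y).
Proof.
have [rtE upE] : rt x = x + (1, 0) /\ up x = x + (0, 1).
  by split; case: x => x1 x2; site_lia.
rewrite rtE upE /up_right_step.
by apply: (iffP orP) => -[/eqP|/eqP] h; [left|right|left|right].
Qed.

Section geodesics.
Context {R : realType}.
Implicit Types (Y : Z2 -> R) (u v z : Z2).

Lemma path_weightE Y u (p : seq Z2) :
  path_weight Y u p = \sum_(i < (size p).+1) Y (nth u (u :: p) i).
Proof. by rewrite /path_weight (big_nth u) big_mkord. Qed.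

Lemma up_right_path_nth u v (p : seq Z2) : up_right_path u v p ->
  urpath (nth u (u :: p)) (size p) /\ nth u (u :: p) (size p) = v.
Proof.
move=> /andP[/(pathP u) pp /eqP lp]; split; last by rewrite -last_nth.
by move=> i ip; apply/up_right_stepP; exact: pp.
Qed.

Lemma urpath_up_right_path (q : nat -> Z2) N :
  urpath q N ->
  up_right_path (q 0%N) (q N) [seq q i.+1 | i <- iota 0 N].
Proof.
move=> qN.
have E i : (i <= N)%N -> nth (q 0%N) (q 0%N :: [seq q i.+1 | i <- iota 0 N]) i = q i.
  case: i => // i iN; rewrite /= (nth_map 0%N) ?size_iota // nth_iota //.
apply/andP; split.
  apply/(pathP (q 0%N)) => i; rewrite size_map size_iota => iN.
  have := E i.+1 iN; rewrite [nth _ (_ :: _) _]/= => ->.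
  by rewrite E ?(ltnW iN) //; apply/up_right_stepP; exact: qN.
by rewrite (last_nth (q 0%N)) size_map size_iota E.
Qed.

Lemma path_weight_urpath Y (q : nat -> Z2) N :
  path_weight Y (q 0%N) [seq q i.+1 | i <- iota 0 N] = \sum_(i < N.+1) Y (q i).
Proof.
rewrite /path_weight big_cons big_ord_recl big_map; congr (_ + _).
by rewrite -{1}[N]subn0 -/(index_iota 0 N) big_mkord.
Qed.

(** The edge is the step of the geodesic into [z], present because [z != u]; it accounts for the
    successor in the first distance. *)
Lemma geodesic_through Y u v z : geodesic Y u v z -> z != u ->
  exists e n1 n2, [/\ e = (1, 0) \/ e = (0, 1), l1norm (z - u) = n1.+1,
    l1norm (v - z) = n2 & through (fun x => Y (z + x)) (u - z) (v - z) e n1 n2].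
Proof.
move=> [p [pp pmax] zp] zu.
have [pu pv] := up_right_path_nth _ _ _ pp.
pose f i := nth u (u :: p) i.
pose n1 := (index z (u :: p)).-1; pose n2 := (size p - n1.+1)%N.
have idx : (0 < index z (u :: p) <= size p)%N.
  apply/andP; split; first by rewrite /= eq_sym (negPf zu).
  by have : (index z (u :: p) < size (u :: p))%N by rewrite index_mem.
have fz : f n1.+1 = z by rewrite /f /n1 prednK ?nth_index //; case/andP: idx.
have n12 : (n1 + n2).+1 = size p.
  by move: idx; rewrite /n2 /n1; clear; lia.
have fu : urpath f (n1 + n2).+1 by rewrite n12.
have f0 : f 0%N = u by [].
have fN : f (n1 + n2).+1 = v by rewrite n12.
have [i [j [ij fij]]] := urpath_fst f (n1 + n2).+1 n1.+1 fu ltac:(clear; lia).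
have gu : urpath (fun k => f (n1.+1 + k)%N) n2.
  by move=> k kn; rewrite addnS; apply: fu; move: kn; clear; lia.
have [i' [j' [ij' fij']]] := urpath_fst _ n2 n2 gu (leqnn _).
rewrite addn0 addSn fz fN in fij'.
rewrite fz f0 in fij.
have [e eE fe] : exists2 e, e = (1, 0) \/ e = (0, 1) & f n1 = z - e.
  have [E|E] := fu n1 ltac:(clear; lia); rewrite -fz E.
    exists (1, 0); [by left|case: (f n1) => x y; site_lia].
  exists (0, 1); [by right|case: (f n1) => x y; site_lia].
exists e, n1, n2; split => //.
- by rewrite fij -ij /l1norm /=; clear; lia.
- by rewrite fij' -ij' /l1norm /=; clear; lia.
have step (x y c : Z2) : y = rt x \/ y = up x -> y - c = rt (x - c) \/ y - c = up (x - c).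
  by case=> ->; [left|right]; case: x c => [x1 x2] [c1 c2]; site_lia.
exists (fun k => f k - z); split.
- by move=> k kn; apply: step; exact: fu.
- by rewrite f0 fe; split => //; rewrite addrAC subrr add0r.
- by rewrite fz subrr.
- by rewrite fN.
move=> q qu q0 qN.
pose g k := q k + z.
have gu' : urpath g (n1 + n2).+1.
  move=> k kn; rewrite /g -[z]opprK; apply: step; exact: qu.
have g0 : g 0%N = u by rewrite /g q0 subrK.
have gN : g (n1 + n2).+1 = v by rewrite /g qN subrK.
have := urpath_up_right_path _ _ gu'; rewrite g0 gN => /pmax.
rewrite -{1}g0 path_weight_urpath path_weightE -n12 => h.
have E1 : \sum_(k < (n1 + n2).+2) Y (z + q k) = \sum_(k < (n1 + n2).+2) Y (g k).
  by apply: eq_bigr => k _; rewrite addrC.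
have E2 : \sum_(k < (n1 + n2).+2) Y (z + (f k - z)) = \sum_(k < (n1 + n2).+2) Y (f k).
  by apply: eq_bigr => k _; rewrite addrC subrK.
by rewrite E1 E2.
Qed.

End geodesics.

(** The endpoints and the path range over countable sets, and maximality is a countable
    intersection. *)
Lemma measurable_geodesic d (T : measurableType d) (R : realType) (Y : Z2 -> T -> R)
    (u v : T -> Z2) (z : Z2) :
  (forall x, measurable_fun setT (Y x)) -> measurable_site u -> measurable_site v ->
  measurable [set w | geodesic (Y^~ w) (u w) (v w) z].
Proof.
move=> mY mu mv.
have mW x p : measurable_fun setT (fun w => path_weight (Y^~ w) x p).
  by apply: measurable_sum => y; exact: mY.
pose F (i : Z2 * Z2 * seq Z2) : set T := let: (x, y, p) := i in
  [set w | u w = x /\ v w = y] `&`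
  [set w | (up_right_path x y p /\ z \in x :: p) /\
    forall q, up_right_path x y q -> path_weight (Y^~ w) x q <= path_weight (Y^~ w) x p].
rewrite (_ : [set w | _] = [set w | exists i, F i w]); last first.
  apply/seteqP; split => w /=.
    by move=> [p [pp pmax] zp]; exists (u w, v w, p).
  by move=> [[[x y] p]] [[-> ->] [[pp zp] pmax]]; exists p.
apply: measurable_exists => -[[x y] p]; apply: measurableI.
  by apply: measurableI; [exact: (mu [set x])|exact: (mv [set y])].
apply: measurable_cond.
apply: (@measurable_forall _ _ _ (fun q => [set w | up_right_path x y q ->
  path_weight (Y^~ w) x q <= path_weight (Y^~ w) x p])) => q.
apply: (@measurable_imply _ _ _ [set w | path_weight (Y^~ w) x q <= _]).
exact: measurable_le_set.
Qed.

(** * From almost sure asymptotics to probabilities, and conclusion *)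

Lemma ae_eventually_small d (T : measurableType d) (R : realType) (P : probability T R)
    (B : nat -> set T) (eta : R) : 0 < eta -> (forall n, measurable (B n)) ->
  {ae P, forall w, \forall n \near \oo, ~ B n w} ->
  exists N, forall n, (N <= n)%N -> (P (B n) <= eta%:E)%E.
Proof.
move=> eta0 mB evB.
have Pfin : (P (\bigcup_(n >= 0) B n) < +oo)%E.
  by apply: le_lt_trans (ltry 1); apply: probability_le1; exact: bigcup_measurable.
(* Almost surely only finitely many of the events occur; the unions of their tails decrease to the
   limit superior, so their probabilities tend to 0. *)
have PL0 : P (lim_sup_set B) = 0%E.
  apply: measure_negligible.
    by apply: bigcapT_measurable => n; exact: bigcup_measurable.
  case: evB => N0 [mN0 N00 sub]; exists N0; split => // w wB; apply: sub => /= -[n _ nB].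
  by have [m /= nm Bm] := wB n Logic.I; exact: (nB m nm).
have := lim_sup_set_cvg P B mB Pfin.
rewrite [X in _ --> X](_ : _ = 0%:E); last exact: PL0.
move=> /fine_cvgP[_] /cvgrPdist_lt /(_ eta eta0) [N _ H].
exists N => n Nn; have := H n Nn; rewrite sub0r normrN.
have mS : measurable (\bigcup_(k >= n) B k) by exact: bigcup_measurable.
move=> /= lt; apply: (@le_trans _ _ (P (\bigcup_(k >= n) B k))).
  apply: le_measure; rewrite ?inE; [exact: mB|exact: mS|].
  by move=> w Bw; exists n => //=.
rewrite -[leLHS]fineK ?fin_num_measure // lee_fin.
by apply/ltW; apply: le_lt_trans lt; exact: ler_norm.
Qed.

(** Supplies the horizon for a fixed [n]: the distance to a random endpoint is finite but need not
    be bounded. *)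
Lemma tail_small d (T : measurableType d) (R : realType) (P : probability T R)
    (f : T -> nat) (eta : R) : 0 < eta -> (forall A, measurable (f @^-1` A)) ->
  exists K, (P [set w | (K < f w)%N] <= eta%:E)%E.
Proof.
move=> eta0 mf.
have [||K H] := ae_eventually_small _ _ _ P (fun K => [set w | (K < f w)%N]) eta eta0.
- by move=> K; exact: (mf [set n | (K < n)%N]).
- by apply: aeW => w; exists (f w) => // n /= fn; rewrite ltnNge fn.
by exists K; exact: H.
Qed.

Lemma iid_exp_field d (T : measurableType d) (R : realType) (P : probability T R)
    (Y : Z2 -> {RV P >-> R}) : iid_Exp1 P Y -> exp_field P (fun x => Y x : T -> R).
Proof.
move=> [ind law]; split => [x|s B us _ mB]; first exact: measurable_funPT.
rewrite /cylinder -bigcap_seq; apply: etrans (ind s B us mB) _.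
by apply: eq_bigr => x _; exact: (law x (B x) (mB x)).
Qed.

Lemma xi1_itv (R : realType) (a : R) : 0 < a -> 0 <= (xi a).1 <= 1.
Proof.
move=> a0; have s0 : 0 < (1 - a) ^+ 2 + a ^+ 2 by rewrite ltr_wpDl ?sqr_ge0 // exprn_gt0.
apply/andP; split; first by rewrite divr_ge0 ?sqr_ge0 // ltW.
by rewrite ler_pdivrMr // mul1r lerDl sqr_ge0.
Qed.

Lemma near_direction (R : realType) (x : nat -> Z2) (p : R * R) (delta : R) : 0 < delta ->
  (fun n => direction R (x n)) @ \oo --> p ->
  \forall n \near \oo, `|(direction R (x n)).1 - p.1| <= delta.
Proof.
move=> delta0 H; apply: (H [set q : R * R | `|q.1 - p.1| <= delta]).
exists ([set q | `|q - p.1| <= delta], setT) => /=; last by move=> q [].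
split; last exact: filterT.
by apply/nbhs_ballP; exists delta => //= q; rewrite /ball /= distrC => /ltW.
Qed.

Lemma direction_cone (R : realType) (x : Z2) (p delta : R) n : l1norm x = n -> (0 < n)%N ->
  `|(direction R x).1 - p| <= delta -> `|x.1%:~R - p * n%:R| <= delta * n%:R.
Proof.
move=> xn n0; have n0' : (0 : R) < n%:R by rewrite ltr0n.
rewrite /direction /= xn => h.
have -> : x.1%:~R - p * n%:R = (x.1%:~R / n%:R - p) * n%:R by field; rewrite gt_eqF.
by rewrite normrM (gtr0_norm n0') ler_pM2r.
Qed.

Theorem theorem4p12 (R : realType) (d : measure_display) (T : measurableType d)
    (P : probability T R) (theta : Z2 -> T -> T) (Y : Z2 -> {RV P >-> R})
    (alpha : R) (u v : nat -> T -> Z2) (z : nat -> Z2)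
    (theta_group : measure_preserving_group P theta)
    (Y_iid : iid_Exp1 P Y)
    (Y_shift : forall (x : Z2) (w : T), Y x w = Y 0 (theta x w))
    (alpha_gt0 : 0 < alpha) (alpha_lt1 : alpha < 1)
    (u_meas : forall n : nat, measurable_site (u n))
    (v_meas : forall n : nat, measurable_site (v n))
    (le_uz : forall (n : nat) (w : T), le_site (u n w) (z n))
    (le_zv : forall (n : nat) (w : T), le_site (z n) (v n w))
    (uv_asymp : {ae P, forall w : T,
      [/\ (fun n : nat => l1norm (v n w - z n)) @ \oo --> \oo,
          (fun n : nat => l1norm (z n - u n w)) @ \oo --> \oo,
          (fun n : nat => direction R (v n w - z n)) @ \oo --> xi alpha &
          (fun n : nat => direction R (z n - u n w)) @ \oo --> xi alpha]}) :
  (fun n : nat => P [set w : T | geodesic (fun x : Z2 => Y x w) (u n w) (v n w) (z n)])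
    @ \oo --> 0%E.
Proof.
have a1 : 0 < 1 - alpha by rewrite subr_gt0.
have YF := iid_exp_field _ _ _ _ _ Y_iid.
have [th0 thD mth thP] := theta_group.
pose rare (A : set T) (r : R) := measurable A /\ (P A <= r%:E)%E.
have rareU A B r s : rare A r -> rare B s -> rare (A `|` B) (r + s).
  move=> [mA PA] [mB PB]; split; first exact: measurableU.
  by apply: (le_trans (measureU2 _ mA mB)); rewrite EFinD; exact: leeD.
pose E n := [set w | geodesic (fun x => Y x w) (u n w) (v n w) (z n)].
have mE n : measurable (E n).
  apply: (measurable_geodesic _ _ _ (fun x => Y x : T -> R)) => //; exact: YF.1.
apply/fine_cvgP; split; first by apply: nearW => n; exact: (fin_num_measure P (E n) (mE n)).
apply/cvgrPdist_le => eta eta0.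
have eta4 : 0 < eta / 4 by rewrite divr_gt0.
have eta8 : 0 < eta / 8 by rewrite divr_gt0.
have [delta [M [delta0 edge]]] := edge_rare _ alpha (eta / 4) alpha_gt0 a1 eta4.
have delta2 : 0 < delta / 2 by rewrite divr_gt0.
(* The geodesic is cut one step before [z n], so [n1] is the distance minus 1. The second entry
   yields [1 + 2 / delta <= n1], by which the error from the removed edge fits between the cones of
   widths [delta / 2] and [delta]. *)
pose M' := maxn M.+1 (Num.truncn (2 / delta)).+3.
pose far x := (M' <= l1norm x)%N && (`|(direction R x).1 - (xi alpha).1| <= delta / 2).
pose B n := ~` ([set w | far (v n w - z n)] `&` [set w | far (z n - u n w)]).
have mB n : measurable (B n).
  apply: measurableC; apply: measurableI.
    exact: (v_meas n [set x | far (x - z n)]).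
  exact: (u_meas n [set x | far (z n - x)]).
have [|N HN] := ae_eventually_small _ _ _ P B (eta / 4) eta4 mB.
  apply: filterS uv_asymp => w [v1 u1 v2 u2].
  have far_near (x : nat -> Z2) : (fun n => l1norm (x n)) @ \oo --> \oo ->
      (fun n => direction R (x n)) @ \oo --> xi alpha -> \forall n \near \oo, far (x n).
    move=> x1 x2; have := near_direction _ _ _ _ delta2 x2.
    have h1 : \forall n \near \oo, (M' <= l1norm (x n))%N := x1 _ (nbhs_infty_ge M').
    by apply: filterS2 h1 => k h1 h2; apply/andP.
  move: (far_near _ v1 v2) (far_near _ u1 u2).
  by apply: filterS2 => n h1 h2; apply.
exists N => // n /= Nn; rewrite sub0r normrN (ger0_norm (fine_ge0 (measure_ge0 P (E n)))).
rewrite -lee_fin (fineK (fin_num_measure P (E n) (mE n))).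
(* The horizon depends on [n]; this is harmless, since [delta] and [M] were obtained for all
   horizons. *)
have [K1 HK1] := tail_small _ _ _ P (fun w => l1norm (v n w - z n)) _ eta8
  (fun A => v_meas n [set x | A (l1norm (x - z n))]).
have [K2 HK2] := tail_small _ _ _ P (fun w => l1norm (z n - u n w)) _ eta8
  (fun A => u_meas n [set x | A (l1norm (z n - x))]).
pose K := maxn K1 K2.
pose X (x : Z2) (w : T) := Y (z n + x) w.
have XF : exp_field P X.
  apply: (exp_field_reindex _ _ _ _ (fun x => Y x : T -> R) (fun x => z n + x)
    (fun x => x - z n)) => // x.
  by rewrite addrAC subrr add0r.
have Xst : diag_stationary P X.
  exists (fun k => theta (diag k)); split=> [k|k A mA|k x w]; [exact: mth|exact: thP|].
  by rewrite /X Y_shift [RHS]Y_shift addrA (thD (z n + x)).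
(* The geodesic enters [z n] through one of two edges, each with its own rare event. *)
have [G1 [mG1 PG1 H1]] := edge _ _ _ X (1, 0) K XF Xst (or_introl erefl).
have [G2 [mG2 PG2 H2]] := edge _ _ _ X (0, 1) K XF Xst (or_intror erefl).
pose S1 := [set w | (K1 < l1norm (v n w - z n)%R)%N].
pose S2 := [set w | (K2 < l1norm (z n - u n w)%R)%N].
have mS1 : measurable S1 by exact: (v_meas n [set x | (K1 < l1norm (x - z n)%R)%N]).
have mS2 : measurable S2 by exact: (u_meas n [set x | (K2 < l1norm (z n - x)%R)%N]).
have [mU PU] : rare (B n `|` (S1 `|` S2) `|` (G1 `|` G2))
    (eta / 4 + (eta / 8 + eta / 8) + (eta / 4 + eta / 4)).
  apply: (rareU); last by apply: rareU; split.
  by apply: (rareU); [split; [exact: mB|exact: HN]|apply: rareU; split].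
apply: (@le_trans _ _ (P (B n `|` (S1 `|` S2) `|` (G1 `|` G2)))); last first.
  by apply: (le_trans PU); rewrite lee_fin; lra.
apply: le_measure; rewrite ?inE; [exact: mE|exact: mU|] => w Ew.
apply: contrapT => nU.
have nB : ~ B n w by move=> h; apply: nU; left; left.
have nS1 : ~ S1 w by move=> h; apply: nU; left; right; left.
have nS2 : ~ S2 w by move=> h; apply: nU; left; right; right.
have nG1 : ~ G1 w by move=> h; apply: nU; right; left.
have nG2 : ~ G2 w by move=> h; apply: nU; right; right.
move/contrapT: nB => -[/andP[Mv dv] /andP[Mu du]].
have zu : z n != u n w.
  by apply/eqP => zu; move: Mu; rewrite zu subrr /M'; clear; rewrite /l1norm /=; lia.
have [e [n1 [n2 [eE n1E n2E thr]]]] := geodesic_through _ _ _ _ Ew zu.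
move: nS1 nS2 => /negP; rewrite -leqNgt n2E => n2K /negP; rewrite -leqNgt n1E => n1K.
rewrite n2E in Mv; rewrite n1E in Mu.
have n2c : `|(v n w - z n).1%:~R - (xi alpha).1 * n2%:R| <= delta * n2%:R.
  apply: (le_trans (direction_cone _ _ _ _ _ n2E _ dv)).
    by move: Mv; rewrite /M'; clear; lia.
  by apply: ler_wpM2r; [exact: ler0n|lra].
have n1c : `|(- e - (u n w - z n)).1%:~R - (xi alpha).1 * n1%:R| <= delta * n1%:R.
  have := direction_cone _ _ _ _ _ n1E isT du.
  have n1d : 1 + 2 / delta <= n1%:R.
    have h : (2 / delta) < (Num.truncn (2 / delta)).+1%:R by exact: truncnS_gt.
    have h' : ((Num.truncn (2 / delta)).+2 <= n1)%N.
      by move: Mu; rewrite /M' geq_max => /andP[].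
    by move: h'; rewrite -(ler_nat R) -[_.+2%:R]natr1; lra.
  have {}n1d : delta / 2 + 1 <= delta / 2 * n1%:R.
    have -> : delta / 2 + 1 = delta / 2 * (1 + 2 / delta) by field; rewrite gt_eqF.
    by rewrite ler_pM2l.
  have e01 : 0 <= (e.1%:~R : R) <= 1 by case: eE => ->; rewrite ler0z lerz1.
  have := xi1_itv _ _ alpha_gt0; move: e01 n1d.
  have -> : (- e - (u n w - z n)).1 = (z n - u n w).1 - e.1.
    by clear; case: e (u n w) (z n) => [? ?] [? ?] [? ?] /=; lia.
  move: (z n - u n w).1 (xi alpha).1 => x p.
  rewrite intrB -(natr1 n1) !ler_norml => /andP[? ?] ? /andP[? ?] /andP[? ?].
  by apply/andP; split; lra.
have M1 : (M <= n1 <= K.+1)%N.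
  by move: Mu n1K; rewrite /M' /K; clear; lia.
have M2 : (M <= n2 <= K.+1)%N.
  by move: Mv n2K; rewrite /M' /K; clear; lia.
case: eE => eE; rewrite eE in n1c thr.
  exact: (H1 w nG1 (u n w - z n) (v n w - z n) n1 n2 M1 M2 n2c n1c thr).
exact: (H2 w nG2 (u n w - z n) (v n w - z n) n1 n2 M1 M2 n2c n1c thr).
Qed.
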